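(* Let $\Lambda$ be a critical lattice associated to the multiplier $g$ (associated to $\phi$), let $t\in(0,1)$ be the constant fixed in the context, and let $c=(c_\lambda)_{\lambda\in\Lambda}$ be a sequence of complex numbers. There exists $f\in\mathcal{F}^\infty_\phi$ satisfying $f|\Lambda=c$ if and only if - $\sup_{\lambda\in\Lambda}|c_\lambda| e^{-\phi(\lambda)}<+\infty$, - $\sup_{\lambda'\in\Lambda_0}\Bigl|-\frac{c_0}{g'(0)\lambda'}+\mathrm{p.v.}\sum_{\lambda\in\Lambda_{\lambda'}\setminus\{0\}}\frac{c_\lambda}{g'(\lambda)}\Bigl(\frac{1}{\lambda-\lambda'}-\frac{1}{\lambda}\Bigr)\Bigr|<+\infty$, and - there exists an integer $N>\frac1t$ such that, for every $2\le n\le N$, $$\sup_{\lambda'\in\Lambda}\Bigl|\rho(\lambda')^{n-1}\,\mathrm{p.v.}\sum_{\lambda\in\Lambda_{\lambda'}}\frac{c_\lambda}{g'(\lambda)(\lambda-\lambda')^n}\Bigr|<+\infty.$$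
   Context: Throughout, $\phi:\mathbb{C}\to\mathbb{R}$ is a (non-harmonic) subharmonic function, assumed $\mathcal{C}^\infty$, whose Laplacian $\mu=\Delta\phi$ is a doubling measure: there is $C>0$ with $\mu(D(z,2r))\le C\mu(D(z,r))$ for all $z\in\mathbb{C}$, $r>0$, where $D(z,r)$ is the disc of centre $z$ and radius $r$. For $z\in\mathbb{C}$, $\rho(z)=\rho_\phi(z)$ is the radius such that $\mu(D(z,\rho(z)))=1$. $d_\phi$ is the distance induced by the metric $\rho(z)^{-2}dz\otimes d\overline{z}$, i.e. $d_\phi(z,\zeta)=\inf_\gamma\int_\gamma\frac{|dw|}{\rho(w)}$ over piecewise $C^1$ curves $\gamma$ from $z$ to $\zeta$, and $d_\phi(z,S)=\inf_{s\in S}d_\phi(z,s)$. The constant $t$: fix $t\in(0,1)$ for which there is a constant $K>0$ with $\frac{\rho(z)}{\rho(\zeta)}\le K\left(\frac{|z-\zeta|}{\rho(\zeta)}\right)^{1-t}$ for all $z,\zeta\in\mathbb{C}$ with $\zeta\notin D(z,\rho(z))$ (it is known that such a $t$ exists, depending only on the doubling constant of $\mu$). $\Lambda\subset\mathbb{C}$ is $\rho$-separated if there is $\delta>0$ with $|\lambda-\lambda'|\ge\delta\max\{\rho(\lambda),\rho(\lambda')\}$ for all $\lambda\ne\lambda'$ in $\Lambda$. A multiplier associated to $\phi$ is an entire function $g$ with zero sequence $\mathcal{Z}(g)$ such that $\mathcal{Z}(g)$ is $\rho$-separated, $\sup_{z\in\mathbb{C}}d_\phi(z,\mathcal{Z}(g))<\infty$,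 and $|g(z)|\simeq e^{\phi(z)}d_\phi(z,\mathcal{Z}(g))$ for all $z\in\mathbb{C}$ (two-sided bounds with constants independent of $z$). Then $\Lambda=\mathcal{Z}(g)$ is called a critical lattice associated to the multiplier $g$. It is assumed throughout that $0\in\Lambda$. $\mathcal{F}^\infty_\phi=\{f\in H(\mathbb{C}):\sup_{z\in\mathbb{C}}|f(z)|e^{-\phi(z)}<+\infty\}$, where $H(\mathbb{C})$ denotes the entire functions. $f|\Lambda=c$ means $f(\lambda)=c_\lambda$ for all $\lambda\in\Lambda$. $\Lambda_{\lambda'}=\Lambda\setminus\{\lambda'\}$; in particular $\Lambda_0=\Lambda\setminus\{0\}$. The principal value of a sum over $S\subseteq\Lambda$ is $\mathrm{p.v.}\sum_{\lambda\in S}a_\lambda=\lim_{R\to\infty}\sum_{\lambda\in S,\,|\lambda|<R}a_\lambda$; a condition involving such principal values is understood to include the existence of these limits. *)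

(* Defs.v *)
(* Written over Stdlib's reals and Coquelicot (Coquelicot's [C] is [R * R]). *)
From Stdlib Require Import Reals List.
From Coquelicot Require Import Coquelicot.

Open Scope R_scope.

(** * The weight [phi] *)

Definition pd_x (f : C -> R) (z : C) : R := Derive (fun x => f (x, snd z)) (fst z).
Definition pd_y (f : C -> R) (z : C) : R := Derive (fun y => f (fst z, y)) (snd z).

Fixpoint of_class_C (k : nat) (f : C -> R) : Prop :=
  (forall z : C, continuous f z) /\
  match k with
  | O => True
  | S k' =>
      (forall z : C, ex_derive (fun x => f (x, snd z)) (fst z)) /\
      (forall z : C, ex_derive (fun y => f (fst z, y)) (snd z)) /\
      of_class_C k' (pd_x f) /\ of_class_C k' (pd_y f)
  end.

Definition smooth (f : C -> R) : Prop := forall k : nat, of_class_C k f.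

Definition Laplacian (f : C -> R) (z : C) : R := pd_x (pd_x f) z + pd_y (pd_y f) z.

Definition harmonic (f : C -> R) : Prop := forall z : C, Laplacian f z = 0.

(* Sub-mean value property.  This is subharmonicity for continuous [f] only:
   upper semicontinuity is not included, and the mean is a Riemann integral. *)
Definition subharmonic (f : C -> R) : Prop :=
  forall (z : C) (r : R), 0 < r ->
    f z <= / (2 * PI) *
           RInt (fun theta => f (fst z + r * cos theta, snd z + r * sin theta))
                0 (2 * PI).

(* [disc_mass phi z r] is the mass of the disc D(z,r) for the measure with
   density [Laplacian phi] with respect to area.  The density is continuous for
   smooth [phi], so the area integral over the disc is the iterated Riemann
   integral along the vertical sections of the disc. *)
Definition disc_mass (phi : C -> R) (z : C) (r : R) : R :=
  RInt (fun x =>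
          RInt (fun y => Laplacian phi (x, y))
               (snd z - sqrt (r ^ 2 - (x - fst z) ^ 2))
               (snd z + sqrt (r ^ 2 - (x - fst z) ^ 2)))
       (fst z - r) (fst z + r).

Definition doubling (phi : C -> R) : Prop :=
  exists K : R, 0 < K /\
    forall (z : C) (r : R), 0 < r ->
      disc_mass phi z (2 * r) <= K * disc_mass phi z r.

Definition is_radius (phi rho : C -> R) : Prop :=
  forall z : C, 0 < rho z /\ disc_mass phi z (rho z) = 1.

Definition growth_exponent (rho : C -> R) (t : R) : Prop :=
  0 < t < 1 /\
  exists K : R, 0 < K /\
    forall z zeta : C, rho z <= Cmod (zeta - z) ->
      rho z / rho zeta <= K * Rpower (Cmod (z - zeta) / rho zeta) (1 - t).

(** * The distance [d_phi] *)

(* [gamma] is a C^1 arc on [0,1] with derivative [dgamma]; asking for two-sided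
   derivatives at the end points loses no arc, since a C^1 arc on a closed
   interval extends to a neighbourhood. *)
Definition C1_arc (gamma dgamma : R -> C) : Prop :=
  forall s : R, 0 <= s <= 1 ->
    is_derive (V := C_R_NormedModule) gamma s (dgamma s) /\ continuous dgamma s.

(* [curve_length rho z w L]: some piecewise C^1 curve from [z] to [w], given as
   a finite concatenation of C^1 arcs, has length [L] for the metric |dw|/rho. *)
Inductive curve_length (rho : C -> R) : C -> C -> R -> Prop :=
| curve_nil (z : C) : curve_length rho z z 0
| curve_cons (gamma dgamma : R -> C) (w : C) (L : R) :
    C1_arc gamma dgamma ->
    curve_length rho (gamma 1) w L ->
    curve_length rho (gamma 0) w
      (RInt (fun s => Cmod (dgamma s) / rho (gamma s)) 0 1 + L).

Definition dist (rho : C -> R) (z zeta : C) : R :=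
  real (Glb_Rbar (curve_length rho z zeta)).

(* Meaningful for nonempty [A] only: for empty [A] the infimum is [p_infty],
   which [real] sends to 0. *)
Definition dist_set (rho : C -> R) (z : C) (A : C -> Prop) : R :=
  real (Glb_Rbar (fun d => exists s : C, A s /\ d = dist rho z s)).

(** * Entire functions, multipliers and critical lattices *)

Definition entire (f : C -> C) : Prop :=
  forall z : C, ex_derive (K := C_AbsRing) (V := C_NormedModule) f z.

Definition zeros (g : C -> C) (z : C) : Prop := g z = 0.

Definition separated (rho : C -> R) (A : C -> Prop) : Prop :=
  exists delta : R, 0 < delta /\
    forall a b : C, A a -> A b -> a <> b ->
      delta * Rmax (rho a) (rho b) <= Cmod (a - b).

(* The zero sequence is represented by the zero set: the two-sided estimate
   forces the zeros to be simple.  It also excludes a zero-free [g], for which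
   [dist_set] would be 0. *)
Definition multiplier (phi rho : C -> R) (g : C -> C) : Prop :=
  entire g /\
  separated rho (zeros g) /\
  (exists M : R, forall z : C, dist_set rho z (zeros g) <= M) /\
  (exists a b : R, 0 < a /\ 0 < b /\
     forall z : C,
       a * (exp (phi z) * dist_set rho z (zeros g)) <= Cmod (g z) /\
       Cmod (g z) <= b * (exp (phi z) * dist_set rho z (zeros g))).

Definition critical_lattice (phi rho : C -> R) (g : C -> C) (Lambda : C -> Prop) : Prop :=
  multiplier phi rho g /\ forall z : C, Lambda z <-> zeros g z.

Definition Fock_infty (phi : C -> R) (f : C -> C) : Prop :=
  entire f /\ exists M : R, forall z : C, Cmod (f z) * exp (- phi z) <= M.

(** * Principal values *)

Definition enumerates (l : list C) (A : C -> Prop) : Prop :=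
  NoDup l /\ forall z : C, In z l <-> A z.

Definition Csum (a : C -> C) (l : list C) : C :=
  fold_right Cplus (RtoC 0) (map a l).

(* [is_pv A a s]: the principal value of the sum of [a] over [A] exists and
   equals [s]. *)
Definition is_pv (A : C -> Prop) (a : C -> C) (s : C) : Prop :=
  exists l : R -> list C,
    (forall r : R, enumerates (l r) (fun z => A z /\ Cmod z < r)) /\
    filterlim (fun r => Csum a (l r)) (Rbar_locally p_infty) (locally s).

(* Main.v *)
(** Write [F = f / g] and [a_l = c_l / g'(l)], the residue of [F] at [l].

    If [f] is in the Fock space then [F] is bounded away from the zeros of [g].
    For each [R] the circle of radius [R] is pushed away from the nearby zeros,
    outwards or inwards according to whether they lie in the disc, which gives a
    closed curve of length [O(R)] on which [F] is bounded and which winds exactly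
    around the zeros of modulus less than [R].  Cauchy's formula on this curve gives
    [F z - F w = sum_(|l| < R) a_l (1/(z-l) - 1/(w-l)) + O(|z-w|/R)],
    and the Fourier coefficients of both sides on small circles centred at zeros of [g] are the
    principal values of the statement.

    Conversely [f = g * sum a_l (1/(z-l) + 1/l)].  Expanding [1/(z-l)] to order [N]
    around the zero closest to [z] leaves a remainder controlled by
    [sum_(l <> p) rho l / |l-p|^(N+1) = O(rho p ^ (-N))]; this sum converges because the
    growth exponent bounds [1 / rho l] by a power [1/t - 1 < N - 1] of [|l-p|], while
    [sum rho l ^ 2] over a disc is at most a multiple of its area. *)
Require Import Defs.
From Stdlib Require Import Reals List Lra Lia Classical ClassicalEpsilon.
From Stdlib Require Import Permutation FunctionalExtensionality PropExtensionality.
From Stdlib Require Import ssreflect.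
From Coquelicot Require Import Coquelicot.

Open Scope R_scope.
Local Open Scope general_if_scope.

(** * Derivatives and integrals of complex-valued functions *)

(** The residues are only [O(rho l)], so [sum a_l / (z - l)] has no reason to converge absolutely.
    The terms with exponents up to [N] converge through the principal values alone, and only the
    remainder beyond order [N] is summed absolutely; that is where [N > 1/t] enters. In the other
    direction, a Cauchy integral of [F] over the contour is bounded but need not tend to 0 as [R]
    grows; only the difference between two points gains a factor [1/R]. Positive frequencies on a
    circle ignore the constant so lost, which gives the sums with [n >= 2]. Frequency 0 sees it, so
    the circle around [p] has to be compared with the circle around 0: hence the differences
    [1/(l - p) - 1/l] and the separate term of the zero 0.

    The geometry passes through two facts: [rho] is 1-Lipschitz, and [d_phi(z, w)] is at least
    [ln (1 + |z - w| / rho)] with [rho] taken at either end point. All deformations of curves and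
    poles go along straight segments, mostly towards 0; the contour is therefore kept in polar form,
    and its winding numbers are computed from a single-valued logarithm. *)

Lemma Cmod_sub_sym (z w : C) : Cmod (z - w) = Cmod (w - z).
Proof. rewrite -Cmod_opp. f_equal. ring. Qed.

Lemma Cmod_triangle_sub (z w : C) : Cmod z - Cmod w <= Cmod (z - w).
Proof.
  have H := Cmod_triangle (z - w) w.
  replace (z - w + w)%C with z in H by ring. lra.
Qed.

Lemma Cmod_triangle3 (x y z : C) : Cmod (x - z) <= Cmod (x - y) + Cmod (y - z).
Proof.
  replace (x - z)%C with ((x - y) + (y - z))%C by ring. exact: Cmod_triangle.
Qed.

Lemma Cmod_minus_le (z w : C) : Cmod (z - w) <= Cmod z + Cmod w.
Proof. rewrite -(Cmod_opp w). exact: Cmod_triangle. Qed.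

Lemma Cmod_pos_neq (z w : C) : 0 < Cmod (z - w) -> z <> w.
Proof. move=> H E. move: H. rewrite E /Cminus Cplus_opp_r Cmod_0. lra. Qed.

Lemma Cmod_sub_pos (z w : C) : z <> w -> 0 < Cmod (z - w).
Proof. move=> H. apply/Cmod_gt_0. exact: Cminus_eq_contra. Qed.

Lemma Cmod_RtoC_pos (x : R) : 0 <= x -> Cmod x = x.
Proof. move=> H. rewrite Cmod_R. exact: Rabs_pos_eq. Qed.

Lemma Cmod_Re_Im (z : C) : Cmod z <= Rabs (fst z) + Rabs (snd z).
Proof.
  destruct z as [x y]. replace (x, y) with (RtoC x + Ci * RtoC y)%C.
  - apply: Rle_trans (Cmod_triangle _ _) _. rewrite Cmod_mult Cmod_Ci !Cmod_R /=.
    ring_simplify (x + (0 * y - 1 * 0)) (0 + (0 * 0 + 1 * y)). rewrite Rmult_1_l.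
    apply: Req_le. by [].
  - rewrite /Cplus /Cmult /=. f_equal; ring.
Qed.

Lemma Rabs_fst_le_Cmod (z : C) : Rabs (fst z) <= Cmod z.
Proof. apply: Rle_trans (Rmax_Cmod z). exact: Rmax_l. Qed.

Lemma Rabs_snd_le_Cmod (z : C) : Rabs (snd z) <= Cmod z.
Proof. apply: Rle_trans (Rmax_Cmod z). exact: Rmax_r. Qed.

(** The uniform structure of [C] is the product one, whose balls are squares; passing between
    squares and discs costs a factor [sqrt 2], bounded here by 2. *)
Lemma locally_C_iff (z : C) (P : C -> Prop) :
  locally (T := C_UniformSpace) z P <->
  exists d : R, 0 < d /\ forall w : C, Cmod (w - z) < d -> P w.
Proof.
  split.
  - case=> d Hd. exists d. split; first exact: cond_pos.
    move=> w Hw. apply: Hd. apply: C_NormedModule_mixin_compat1. exact: Hw.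
  - case=> d [Hd H]. have Hd2 : 0 < d / 2 by lra.
    exists (mkposreal _ Hd2) => w Hw. apply: H.
    have := C_NormedModule_mixin_compat2 z w _ Hw. simpl.
    have Hs : sqrt 2 < 2.
    { rewrite -{2}(sqrt_Rsqr 2); last lra. apply: sqrt_lt_1; rewrite /Rsqr; lra. }
    move=> H2. apply: Rlt_le_trans H2 _. nra.
Qed.

Lemma locally_R_iff (x : R) (P : R -> Prop) :
  locally x P <-> exists d : R, 0 < d /\ forall y : R, Rabs (y - x) < d -> P y.
Proof.
  split.
  - case=> d Hd. exists d. split; [exact: cond_pos | exact: Hd].
  - case=> d [Hd H]. exists (mkposreal d Hd). exact: H.
Qed.

Lemma locally_imp {U : UniformSpace} (u : U) (P Q : U -> Prop) :
  locally u P -> (forall v, P v -> Q v) -> locally u Q.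
Proof. move=> H1 H2. exact: filter_imp H2 H1. Qed.

Lemma locally_imp2 {U : UniformSpace} (u : U) (P Q S : U -> Prop) :
  locally u P -> locally u Q -> (forall v, P v -> Q v -> S v) -> locally u S.
Proof.
  move=> H1 H2 H. apply: locally_imp (filter_and P Q H1 H2) _ => v [A B]. exact: H.
Qed.

Lemma continuous_C_iff {U : UniformSpace} (f : U -> C) (u : U) :
  continuous (U := C_UniformSpace) f u <->
  forall eps : R, 0 < eps -> locally u (fun v => Cmod (f v - f u) < eps).
Proof.
  split.
  - move=> H eps He. apply: (H (fun w => Cmod (w - f u) < eps)).
    apply/locally_C_iff. by exists eps.
  - move=> H P /locally_C_iff [d [Hd HP]].
    apply: (locally_imp _ _ _ (H d Hd)) => v Hv. exact: HP.
Qed.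

Section Continuity.
Context {U : UniformSpace}.
Implicit Types (f g : U -> C) (u : U).
Notation cont f u := (continuous (U := C_UniformSpace) f u).

Lemma Ccont_plus f g u : cont f u -> cont g u -> cont (fun v => f v + g v)%C u.
Proof.
  move=> /continuous_C_iff Hf /continuous_C_iff Hg. apply/continuous_C_iff => eps He.
  apply: (locally_imp2 u _ _ _ (Hf (eps / 2) ltac:(lra)) (Hg (eps / 2) ltac:(lra))) => v A B.
  replace (f v + g v - (f u + g u))%C with ((f v - f u) + (g v - g u))%C by ring.
  have := Cmod_triangle (f v - f u) (g v - g u). lra.
Qed.

Lemma Ccont_opp f u : cont f u -> cont (fun v => - f v)%C u.
Proof.
  move=> /continuous_C_iff Hf. apply/continuous_C_iff => eps He.
  apply: (locally_imp _ _ _ (Hf eps He)) => v A.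
  replace (- f v - - f u)%C with (- (f v - f u))%C by ring. by rewrite Cmod_opp.
Qed.

Lemma Ccont_minus f g u : cont f u -> cont g u -> cont (fun v => f v - g v)%C u.
Proof. move=> Hf Hg. apply: Ccont_plus => //. exact: Ccont_opp. Qed.

Lemma Ccont_const (c : C) u : cont (fun _ => c) u.
Proof. exact: continuous_const. Qed.

Lemma Ccont_mult f g u : cont f u -> cont g u -> cont (fun v => f v * g v)%C u.
Proof.
  move=> /continuous_C_iff Hf /continuous_C_iff Hg. apply/continuous_C_iff => eps He.
  set A := Cmod (f u). set B := Cmod (g u).
  have HA : 0 <= A by apply: Cmod_ge_0. have HB : 0 <= B by apply: Cmod_ge_0.
  set d := Rmin 1 (eps / (A + B + 2)).
  have Hq : 0 < eps / (A + B + 2) by apply: Rdiv_lt_0_compat; lra.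
  have Hd : 0 < d by apply: Rmin_glb_lt; lra.
  have Hd1 : d <= 1 by apply: Rmin_l.
  have Hd2 : d * (A + B + 2) <= eps.
  { have : d <= eps / (A + B + 2) by apply: Rmin_r.
    move=> H. apply: Rle_trans (Rmult_le_compat_r _ _ _ _ H) _; first lra.
    apply: Req_le. field. lra. }
  apply: (locally_imp2 u _ _ _ (Hf d Hd) (Hg d Hd)) => v X Y.
  replace (f v * g v - f u * g u)%C
    with ((f v - f u) * (g v - g u) + (f u * (g v - g u) + g u * (f v - f u)))%C by ring.
  apply: Rle_lt_trans (Cmod_triangle _ _) _.
  apply: Rle_lt_trans (Rplus_le_compat_l _ _ _ (Cmod_triangle _ _)) _.
  rewrite !Cmod_mult -/A -/B.
  have P1 := Cmod_ge_0 (f v - f u). have P2 := Cmod_ge_0 (g v - g u).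
  have : Cmod (f v - f u) * Cmod (g v - g u) <= d * 1 by apply: Rmult_le_compat; lra.
  nra.
Qed.

Lemma Ccont_inv f u : f u <> 0 -> cont f u -> cont (fun v => / f v)%C u.
Proof.
  move=> Hn /continuous_C_iff Hf. apply/continuous_C_iff => eps He.
  set A := Cmod (f u). have HA : 0 < A by apply/Cmod_gt_0.
  have Hq : 0 < eps * (A * A / 2) by apply: Rmult_lt_0_compat => //; nra.
  apply: (locally_imp2 u _ _ _ (Hf (A / 2) ltac:(lra)) (Hf _ Hq)) => v X Y.
  have HB : A / 2 < Cmod (f v).
  { have := Cmod_triangle_sub (f u) (f v). rewrite (Cmod_sub_sym (f u)) -/A. lra. }
  have Hfv : f v <> 0 by apply/Cmod_gt_0; lra.
  replace (/ f v - / f u)%C with ((f u - f v) / (f v * f u))%C by (field; by split).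
  rewrite Cmod_div; last exact: Cmult_neq_0.
  rewrite Cmod_mult -/A Cmod_sub_sym.
  apply/(Rlt_div_l _ _ _); first nra.
  apply: Rlt_le_trans Y _. apply: Rmult_le_compat_l; nra.
Qed.

Lemma Ccont_div f g u : g u <> 0 -> cont f u -> cont g u -> cont (fun v => f v / g v)%C u.
Proof. move=> H Hf Hg. apply: Ccont_mult => //. exact: Ccont_inv. Qed.

Lemma Ccont_Cmod f u : cont f u -> continuous (fun v => Cmod (f v)) u.
Proof.
  move=> /continuous_C_iff Hf. apply/filterlim_locally => eps.
  apply: (locally_imp _ _ _ (Hf eps (cond_pos eps))) => v A.
  rewrite /ball /= /AbsRing_ball /abs /minus /plus /opp /=.
  apply: Rle_lt_trans A. apply: Rabs_le.
  have := Cmod_triangle_sub (f v) (f u). have := Cmod_triangle_sub (f u) (f v).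
  rewrite (Cmod_sub_sym (f u)). lra.
Qed.

Lemma Ccont_RtoC (h : U -> R) u : continuous h u -> cont (fun v => RtoC (h v)) u.
Proof.
  move=> H. apply/continuous_C_iff => eps He.
  have H2 : locally u (fun v => ball (h u) (mkposreal _ He) (h v)) := proj1 (filterlim_locally _ _) H (mkposreal _ He).
  apply: (locally_imp _ _ _ (H2 _)) => v. rewrite /ball /= /AbsRing_ball /abs /minus /plus /opp /= => A.
  by rewrite -RtoC_minus Cmod_R.
Qed.

Lemma Ccont_pow f n u : cont f u -> cont (fun v => f v ^ n)%C u.
Proof.
  move=> H. elim: n => [|n IH] /=; first exact: Ccont_const. exact: Ccont_mult.
Qed.

Lemma Ccont_fst f u : cont f u -> continuous (fun v => fst (f v)) u.
Proof.
  move=> /continuous_C_iff Hf. apply/filterlim_locally => eps.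
  apply: (locally_imp _ _ _ (Hf eps (cond_pos eps))) => v A.
  rewrite /ball /= /AbsRing_ball /abs /minus /plus /opp /=.
  apply: Rle_lt_trans A. exact: (Rabs_fst_le_Cmod (f v - f u)).
Qed.

Lemma Ccont_snd f u : cont f u -> continuous (fun v => snd (f v)) u.
Proof.
  move=> /continuous_C_iff Hf. apply/filterlim_locally => eps.
  apply: (locally_imp _ _ _ (Hf eps (cond_pos eps))) => v A.
  rewrite /ball /= /AbsRing_ball /abs /minus /plus /opp /=.
  apply: Rle_lt_trans A. exact: (Rabs_snd_le_Cmod (f v - f u)).
Qed.

Lemma Ccont_pair (p q : U -> R) u : continuous p u -> continuous q u -> cont (fun v => (p v, q v)) u.
Proof.
  move=> Hp Hq.
  apply: (continuous_ext (fun v => RtoC (p v) + Ci * RtoC (q v))%C).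
  - move=> v. rewrite /Cplus /Cmult /=. f_equal; ring.
  - apply: Ccont_plus; first exact: Ccont_RtoC.
    apply: Ccont_mult; [exact: Ccont_const | exact: Ccont_RtoC].
Qed.

End Continuity.

(* One notion of derivative serves functions of a complex variable ([e] the identity)
   and curves ([e = RtoC]). *)
Definition deriv_along {U : UniformSpace} (e f : U -> C) (u : U) (l : C) : Prop :=
  forall eps : R, 0 < eps ->
    locally u (fun v => Cmod (f v - f u - l * (e v - e u)) <= eps * Cmod (e v - e u)).

Section Derivative.
Context {U : UniformSpace} (e : U -> C).
Implicit Types (f g : U -> C) (u : U) (l : C).
Notation D f u l := (deriv_along e f u l).
Notation cont f u := (continuous (U := C_UniformSpace) f u).

Lemma deriv_const (c : C) u : D (fun _ => c) u 0%C.
Proof.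
  move=> eps He. apply: filter_forall => v.
  replace (c - c - 0 * (e v - e u))%C with (RtoC 0) by ring.
  rewrite Cmod_0. have := Cmod_ge_0 (e v - e u). nra.
Qed.

Lemma deriv_self u : D e u 1%C.
Proof.
  move=> eps He. apply: filter_forall => v.
  replace (e v - e u - 1 * (e v - e u))%C with (RtoC 0) by ring.
  rewrite Cmod_0. have := Cmod_ge_0 (e v - e u). nra.
Qed.

Lemma deriv_plus f g u l m : D f u l -> D g u m -> D (fun v => f v + g v)%C u (l + m)%C.
Proof.
  move=> Hf Hg eps He.
  apply: (locally_imp2 u _ _ _ (Hf (eps / 2) ltac:(lra)) (Hg (eps / 2) ltac:(lra))) => v A B.
  replace (f v + g v - (f u + g u) - (l + m) * (e v - e u))%C
    with ((f v - f u - l * (e v - e u)) + (g v - g u - m * (e v - e u)))%C by ring.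
  have := Cmod_triangle (f v - f u - l * (e v - e u)) (g v - g u - m * (e v - e u)). lra.
Qed.

Lemma deriv_ext_loc f g u l : locally u (fun v => f v = g v) -> D f u l -> D g u l.
Proof.
  move=> Hl Hf eps He.
  have E := locally_singleton _ _ Hl.
  apply: (locally_imp2 u _ _ _ Hl (Hf eps He)) => v <- B. by rewrite -E.
Qed.

Lemma deriv_ext f g u l : (forall v, f v = g v) -> D f u l -> D g u l.
Proof. move=> H. apply: deriv_ext_loc. exact: filter_forall. Qed.

Lemma deriv_comp (F : C -> C) f u l m :
  deriv_along (U := C_UniformSpace) (fun z => z) F (f u) l -> cont f u ->
  D f u m -> D (fun v => F (f v)) u (l * m)%C.
Proof.
  move=> HF /continuous_C_iff Hc Hf eps He.
  set A := Cmod l. set B := Cmod m.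
  have HA : 0 <= A by apply: Cmod_ge_0. have HB : 0 <= B by apply: Cmod_ge_0.
  set d := Rmin 1 (eps / (A + B + 1)).
  have Hq : 0 < eps / (A + B + 1) by apply: Rdiv_lt_0_compat; lra.
  have Hd : 0 < d by apply: Rmin_glb_lt; lra.
  have Hd1 : d <= 1 by apply: Rmin_l.
  have Hd2 : d * (A + B + 1) <= eps.
  { have : d <= eps / (A + B + 1) by apply: Rmin_r.
    move=> H. apply: Rle_trans (Rmult_le_compat_r _ _ _ _ H) _; first lra.
    apply: Req_le. field. lra. }
  have /locally_C_iff [r [Hr HFr]] := HF d Hd.
  apply: (locally_imp2 u _ _ _ (Hc r Hr) (Hf d Hd)) => v X Y.
  have Z := HFr _ X.
  set h := Cmod (e v - e u) in Y *. have Hh : 0 <= h by apply: Cmod_ge_0.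
  have W : Cmod (f v - f u) <= (d + B) * h.
  { replace (f v - f u)%C with ((f v - f u - m * (e v - e u)) + m * (e v - e u))%C by ring.
    apply: Rle_trans (Cmod_triangle _ _) _. rewrite Cmod_mult -/h -/B. lra. }
  replace (F (f v) - F (f u) - l * m * (e v - e u))%C
    with ((F (f v) - F (f u) - l * (f v - f u)) + l * (f v - f u - m * (e v - e u)))%C by ring.
  apply: Rle_trans (Cmod_triangle _ _) _. rewrite Cmod_mult -/A.
  have : d * Cmod (f v - f u) <= d * ((1 + B) * h).
  { apply: Rmult_le_compat_l; first lra. apply: Rle_trans W _. apply: Rmult_le_compat_r; lra. }
  have : A * Cmod (f v - f u - m * (e v - e u)) <= A * (d * h) by apply: Rmult_le_compat_l.
  have : d * (A + B + 1) * h <= eps * h by apply: Rmult_le_compat_r.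
  lra.
Qed.

Lemma deriv_scal (c : C) f u l : D f u l -> D (fun v => c * f v)%C u (c * l)%C.
Proof.
  move=> Hf eps He.
  have HA := Cmod_ge_0 c.
  have Hq : 0 < eps / (Cmod c + 1) by apply: Rdiv_lt_0_compat; lra.
  apply: (locally_imp _ _ _ (Hf _ Hq)) => v X.
  replace (c * f v - c * f u - c * l * (e v - e u))%C with (c * (f v - f u - l * (e v - e u)))%C by ring.
  rewrite Cmod_mult.
  apply: Rle_trans (Rmult_le_compat_l _ _ _ HA X) _.
  have Hh := Cmod_ge_0 (e v - e u).
  rewrite -Rmult_assoc. apply: Rmult_le_compat_r => //.
  replace (Cmod c * (eps / (Cmod c + 1))) with (eps * (Cmod c / (Cmod c + 1))) by (field; lra).
  have : Cmod c / (Cmod c + 1) <= 1 by apply/(Rle_div_l _ _ _); lra.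
  nra.
Qed.

Lemma deriv_opp f u l : D f u l -> D (fun v => - f v)%C u (- l)%C.
Proof.
  move=> H. have := deriv_scal (- (1))%C f u l H.
  replace (- (1) * l)%C with (- l)%C by ring. apply: deriv_ext => v. ring.
Qed.

Lemma deriv_minus f g u l m : D f u l -> D g u m -> D (fun v => f v - g v)%C u (l - m)%C.
Proof. move=> Hf Hg. apply: deriv_plus => //. exact: deriv_opp. Qed.

Hypothesis e_cont : forall u, cont e u.

Lemma deriv_continuous f u l : D f u l -> cont f u.
Proof.
  move=> Hf. apply/continuous_C_iff => eps He.
  have Hl := Cmod_ge_0 l.
  have Hq : 0 < eps / (Cmod l + 1) by apply: Rdiv_lt_0_compat; lra.
  have /continuous_C_iff Hc := e_cont u.
  apply: (locally_imp2 u _ _ _ (Hf 1 Rlt_0_1) (Hc _ Hq)) => v X Y.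
  replace (f v - f u)%C with ((f v - f u - l * (e v - e u)) + l * (e v - e u))%C by ring.
  apply: Rle_lt_trans (Cmod_triangle _ _) _. rewrite Cmod_mult.
  apply: Rle_lt_trans (_ : (Cmod l + 1) * Cmod (e v - e u) < eps); first lra.
  have : (Cmod l + 1) * Cmod (e v - e u) < (Cmod l + 1) * (eps / (Cmod l + 1)) by apply: Rmult_lt_compat_l; lra.
  replace ((Cmod l + 1) * (eps / (Cmod l + 1))) with eps by (field; lra). lra.
Qed.

Lemma deriv_mult f g u l m : D f u l -> D g u m -> D (fun v => f v * g v)%C u (l * g u + f u * m)%C.
Proof.
  move=> Hf Hg.
  (* The product of the two increments is of second order, and the product of the functions differs
     from it by an affine combination of [f] and [g]. *)
  have Z : D (fun v => (f v - f u) * (g v - g u))%C u 0%C.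
  { move=> eps He.
    have /continuous_C_iff Hc := deriv_continuous g u m Hg.
    have Hl := Cmod_ge_0 l.
    have Hq : 0 < eps / (Cmod l + 1) by apply: Rdiv_lt_0_compat; lra.
    apply: (locally_imp2 u _ _ _ (Hf 1 Rlt_0_1) (Hc _ Hq)) => v X Y.
    replace ((f v - f u) * (g v - g u) - (f u - f u) * (g u - g u) - 0 * (e v - e u))%C
      with ((f v - f u) * (g v - g u))%C by ring.
    rewrite Cmod_mult. set h := Cmod (e v - e u) in X *. have Hh : 0 <= h by apply: Cmod_ge_0.
    have W : Cmod (f v - f u) <= (Cmod l + 1) * h.
    { replace (f v - f u)%C with ((f v - f u - l * (e v - e u)) + l * (e v - e u))%C by ring.
      apply: Rle_trans (Cmod_triangle _ _) _. rewrite Cmod_mult -/h. lra. }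
    apply: Rle_trans (Rmult_le_compat _ _ _ _ (Cmod_ge_0 _) (Cmod_ge_0 _) W (Rlt_le _ _ Y)) _.
    apply: Req_le. field. lra. }
  have := deriv_plus _ _ _ _ _ Z
    (deriv_plus _ _ _ _ _ (deriv_scal (g u) _ _ _ Hf)
      (deriv_plus _ _ _ _ _ (deriv_scal (f u) _ _ _ Hg) (deriv_const (- (f u * g u))%C u))).
  replace (0 + (g u * l + (f u * m + 0)))%C with (l * g u + f u * m)%C by ring.
  apply: deriv_ext => v. ring.
Qed.

End Derivative.

Notation is_Cderiv := (deriv_along (U := C_UniformSpace) (fun z => z)).
Notation is_curve_deriv := (deriv_along (U := R_UniformSpace) RtoC).

Lemma id_continuous_C (z : C) : continuous (T := C_UniformSpace) (U := C_UniformSpace) (fun z => z) z.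
Proof. exact: continuous_id. Qed.

Lemma RtoC_continuous (x : R) : continuous (U := C_UniformSpace) RtoC x.
Proof. apply: (Ccont_RtoC (fun x => x)). exact: continuous_id. Qed.

Lemma Cderiv_continuous (f : C -> C) (z l : C) :
  is_Cderiv f z l -> continuous (T := C_UniformSpace) (U := C_UniformSpace) f z.
Proof. apply: deriv_continuous. exact: id_continuous_C. Qed.

Lemma curve_deriv_continuous (f : R -> C) (x : R) (l : C) :
  is_curve_deriv f x l -> continuous (U := C_UniformSpace) f x.
Proof. apply: deriv_continuous. exact: RtoC_continuous. Qed.

Lemma Cderiv_inv (z : C) : z <> 0 -> is_Cderiv Cinv z (- / (z * z))%C.
Proof.
  move=> Hz eps He.
  have Hc : continuous (T := C_UniformSpace) (U := C_UniformSpace) Cinv z.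
  { apply: (Ccont_inv (U := C_UniformSpace) (fun z => z)) => //. }
  have Hm : 0 < Cmod z by apply/Cmod_gt_0.
  have /continuous_C_iff H := Hc.
  have Hq : 0 < eps * Cmod z by nra.
  apply/locally_C_iff.
  have /locally_C_iff [r [Hr HH]] := H _ Hq.
  exists (Rmin r (Cmod z)). split; first by apply: Rmin_glb_lt.
  move=> w Hw.
  have Hwz : Cmod (w - z) < Cmod z by apply: Rlt_le_trans Hw _; apply: Rmin_r.
  have Hw0 : w <> 0.
  { move=> E. move: Hwz. rewrite E Cmod_sub_sym. replace (z - 0)%C with z by ring. lra. }
  have X : Cmod (/ w - / z) < eps * Cmod z by apply: HH; apply: Rlt_le_trans Hw _; apply: Rmin_l.
  replace (/ w - / z - - / (z * z) * (w - z))%C with (- / z * (w - z) * (/ w - / z))%C by (field; by split).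
  rewrite !Cmod_mult Cmod_opp Cmod_inv //.
  have Hh := Cmod_ge_0 (w - z).
  apply: Rle_trans (_ : / Cmod z * Cmod (w - z) * (eps * Cmod z) <= _).
  - apply: Rmult_le_compat_l; last lra.
    apply: Rmult_le_pos => //. apply: Rlt_le. exact: Rinv_0_lt_compat.
  - apply: Req_le. field. lra.
Qed.

Lemma is_Cderiv_iff (f : C -> C) (z l : C) :
  is_Cderiv f z l <-> is_derive (K := C_AbsRing) (V := C_NormedModule) f z l.
Proof.
  split.
  - move=> H. split; first exact: is_linear_scal_l.
    move=> x Hx. have <- := is_filter_lim_locally_unique _ _ Hx.
    move=> eps.
    have /locally_C_iff [d [Hd HH]] := H eps (cond_pos eps).
    exists (mkposreal d Hd) => w Hw.
    have := HH w Hw.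
    rewrite /norm /= /minus /plus /opp /scal /= /mult /=.
    rewrite {2}/Cminus. rewrite (Cmult_comm l). by [].
  - case=> _ H eps He.
    have := H z (fun P HP => HP) (mkposreal _ He).
    case=> d Hd. apply/locally_C_iff. exists d. split; first exact: cond_pos.
    move=> w Hw. have := Hd w Hw. rewrite /norm /= /minus /plus /opp /scal /= /mult /=.
    by rewrite (Cmult_comm l).
Qed.

Lemma is_curve_deriv_iff (f : R -> C) (x : R) (l : C) :
  is_curve_deriv f x l <-> is_derive (K := R_AbsRing) (V := C_R_NormedModule) f x l.
Proof.
  have E : forall y, RtoC (y - x) = (RtoC y - RtoC x)%C by move=> y; exact: RtoC_minus.
  split.
  - move=> H. split; first exact: is_linear_scal_l.
    move=> y Hy. have <- := is_filter_lim_locally_unique _ _ Hy.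
    move=> eps.
    apply: (locally_imp _ _ _ (H eps (cond_pos eps))) => w .
    rewrite -E Cmod_R (Cmult_comm l) => Hw.
    rewrite -Cmod_norm scal_R_Cmult. exact: Hw.
  - case=> _ H eps He.
    apply: (locally_imp _ _ _ (H x (fun P HP => HP) (mkposreal _ He))) => w .
    rewrite -E Cmod_R (Cmult_comm l) => Hw.
    move: Hw. rewrite -Cmod_norm scal_R_Cmult. by [].
Qed.

Lemma is_Cderiv_C_derive (f : C -> C) (z l : C) : is_Cderiv f z l -> C_derive f z = l.
Proof. move/is_Cderiv_iff. exact: is_C_derive_unique. Qed.

Lemma entire_Cderiv (f : C -> C) : entire f <-> forall z, is_Cderiv f z (C_derive f z).
Proof.
  split.
  - move=> H z. apply/is_Cderiv_iff. exact: (C_derive_correct f z z (H z)).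
  - move=> H z. exists (C_derive f z). by apply/is_Cderiv_iff.
Qed.

Lemma entire_intro (f f' : C -> C) : (forall z, is_Cderiv f z (f' z)) -> entire f.
Proof. move=> H z. exists (f' z). by apply/is_Cderiv_iff. Qed.

Lemma entire_continuous (f : C -> C) z :
  entire f -> continuous (T := C_UniformSpace) (U := C_UniformSpace) f z.
Proof. move/entire_Cderiv => H. exact: Cderiv_continuous (H z). Qed.

(** * Integrals of complex-valued functions over an interval *)

Definition CInt (f : R -> C) (a b : R) : C := RInt (V := C_R_CompleteNormedModule) f a b.

Notation Rcont f x := (continuous (T := R_UniformSpace) (U := C_UniformSpace) f x).
Notation Ccont f z := (continuous (T := C_UniformSpace) (U := C_UniformSpace) f z).

Lemma CInt_is (f : R -> C) (a b : R) :
  (forall x, Rmin a b <= x <= Rmax a b -> Rcont f x) ->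
  is_RInt (V := C_R_NormedModule) f a b (CInt f a b).
Proof.
  move=> H. apply: (RInt_correct (V := C_R_CompleteNormedModule)).
  exact: (ex_RInt_continuous (V := C_R_CompleteNormedModule)).
Qed.

Lemma CInt_unique (f : R -> C) (a b : R) (l : C) :
  is_RInt (V := C_R_NormedModule) f a b l -> CInt f a b = l.
Proof. exact: (is_RInt_unique (V := C_R_CompleteNormedModule)). Qed.

Lemma CInt_ext (f g : R -> C) (a b : R) :
  (forall x, Rmin a b < x < Rmax a b -> f x = g x) -> CInt f a b = CInt g a b.
Proof. exact: (RInt_ext (V := C_R_CompleteNormedModule)). Qed.

Lemma is_RInt_pair (f : R -> C) (a b : R) (p q : R) :
  is_RInt (fun x => fst (f x)) a b p -> is_RInt (fun x => snd (f x)) a b q ->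
  is_RInt (V := C_R_NormedModule) f a b (p, q).
Proof. exact: (is_RInt_fct_extend_pair (U := R_NormedModule) (V := R_NormedModule)). Qed.

Lemma is_RInt_fst (f : R -> C) (a b : R) (l : C) :
  is_RInt (V := C_R_NormedModule) f a b l -> is_RInt (fun x => fst (f x)) a b (fst l).
Proof. exact: (is_RInt_fct_extend_fst (U := R_NormedModule) (V := R_NormedModule)). Qed.

Lemma is_RInt_snd (f : R -> C) (a b : R) (l : C) :
  is_RInt (V := C_R_NormedModule) f a b l -> is_RInt (fun x => snd (f x)) a b (snd l).
Proof. exact: (is_RInt_fct_extend_snd (U := R_NormedModule) (V := R_NormedModule)). Qed.

Lemma is_CInt_Cscal (c : C) (f : R -> C) (a b : R) (l : C) :
  is_RInt (V := C_R_NormedModule) f a b l ->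
  is_RInt (V := C_R_NormedModule) (fun x => c * f x)%C a b (c * l)%C.
Proof.
  move=> H. have H1 := is_RInt_fst _ _ _ _ H. have H2 := is_RInt_snd _ _ _ _ H.
  apply: is_RInt_pair.
  - apply: (is_RInt_ext (fun x => minus (scal (fst c) (fst (f x))) (scal (snd c) (snd (f x))))).
    + by [].
    + apply: (is_RInt_minus (V := R_NormedModule)); exact: (is_RInt_scal (V := R_NormedModule)).
  - apply: (is_RInt_ext (fun x => plus (scal (fst c) (snd (f x))) (scal (snd c) (fst (f x))))).
    + by [].
    + apply: (is_RInt_plus (V := R_NormedModule)); exact: (is_RInt_scal (V := R_NormedModule)).
Qed.

Section CIntCont.
Variables (a b : R).
Definition cont_on (f : R -> C) := forall x, Rmin a b <= x <= Rmax a b -> Rcont f x.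

Lemma CInt_plus f g : cont_on f -> cont_on g ->
  CInt (fun x => f x + g x)%C a b = (CInt f a b + CInt g a b)%C.
Proof.
  move=> Hf Hg. apply: CInt_unique.
  apply: (is_RInt_plus (V := C_R_NormedModule)); exact: CInt_is.
Qed.

Lemma CInt_minus f g : cont_on f -> cont_on g ->
  CInt (fun x => f x - g x)%C a b = (CInt f a b - CInt g a b)%C.
Proof.
  move=> Hf Hg. apply: CInt_unique.
  apply: (is_RInt_minus (V := C_R_NormedModule)); exact: CInt_is.
Qed.

Lemma CInt_Cscal (c : C) f : cont_on f ->
  CInt (fun x => c * f x)%C a b = (c * CInt f a b)%C.
Proof. move=> Hf. apply: CInt_unique. apply: is_CInt_Cscal. exact: CInt_is. Qed.

Lemma CInt_FTC (F f : R -> C) :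
  (forall x, Rmin a b <= x <= Rmax a b -> is_curve_deriv F x (f x)) -> cont_on f ->
  CInt f a b = (F b - F a)%C.
Proof.
  move=> HF Hf. apply: CInt_unique.
  apply: (is_RInt_derive (V := C_R_CompleteNormedModule) F f a b) => // x Hx.
  apply/is_curve_deriv_iff. exact: HF.
Qed.

Lemma CInt_norm_le f (M : R) : a <= b -> cont_on f ->
  (forall x, a <= x <= b -> Cmod (f x) <= M) -> Cmod (CInt f a b) <= (b - a) * M.
Proof.
  move=> Hab Hf HM. rewrite Cmod_norm.
  apply: (norm_RInt_le_const (V := C_R_NormedModule) f a b _ M Hab); last exact: CInt_is.
  move=> x Hx. rewrite -Cmod_norm. exact: HM.
Qed.

End CIntCont.

Lemma CInt_const (c : C) (a b : R) : CInt (fun _ => c) a b = (RtoC (b - a) * c)%C.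
Proof.
  rewrite -scal_R_Cmult. exact: (RInt_const (V := C_R_CompleteNormedModule)).
Qed.

Lemma CInt_Chasles (f : R -> C) (a b c : R) :
  (forall x, Rcont f x) -> (CInt f a b + CInt f b c)%C = CInt f a c.
Proof.
  move=> H. apply: (RInt_Chasles (V := C_R_CompleteNormedModule));
    by apply: (ex_RInt_continuous (V := C_R_CompleteNormedModule)).
Qed.

Lemma curve_deriv_fst (f : R -> C) x l : is_curve_deriv f x l -> is_derive (fun y => fst (f y)) x (fst l).
Proof.
  move=> H. split; first exact: is_linear_scal_l.
  move=> y Hy. have <- := is_filter_lim_locally_unique _ _ Hy. move=> eps.
  apply: (locally_imp _ _ _ (H eps (cond_pos eps))) => w Hw.
  have E : RtoC (w - x) = (RtoC w - RtoC x)%C by exact: RtoC_minus.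
  rewrite -E Cmod_R in Hw.
  apply: Rle_trans Hw.
  rewrite /norm /= /abs /= /minus /plus /opp /scal /= /mult /=.
  have := Rabs_fst_le_Cmod (f w - f x - l * RtoC (w - x))%C. simpl.
  replace (fst (f w) + - fst (f x) + - (fst l * (w - x) - snd l * 0))
    with (fst (f w) + - fst (f x) + - ((w + - x) * fst l)) by ring. by [].
Qed.

Lemma curve_deriv_snd (f : R -> C) x l : is_curve_deriv f x l -> is_derive (fun y => snd (f y)) x (snd l).
Proof.
  move=> H. split; first exact: is_linear_scal_l.
  move=> y Hy. have <- := is_filter_lim_locally_unique _ _ Hy. move=> eps.
  apply: (locally_imp _ _ _ (H eps (cond_pos eps))) => w Hw.
  have E : RtoC (w - x) = (RtoC w - RtoC x)%C by exact: RtoC_minus.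
  rewrite -E Cmod_R in Hw.
  apply: Rle_trans Hw.
  rewrite /norm /= /abs /= /minus /plus /opp /scal /= /mult /=.
  have := Rabs_snd_le_Cmod (f w - f x - l * RtoC (w - x))%C. simpl.
  replace (snd (f w) + - snd (f x) + - (fst l * 0 + snd l * (w - x)))
    with (snd (f w) + - snd (f x) + - ((w + - x) * snd l)) by ring. by [].
Qed.

Lemma curve_deriv_pair (p q : R -> R) x dp dq : is_derive p x dp -> is_derive q x dq ->
  is_curve_deriv (fun y => (p y, q y)) x (dp, dq).
Proof.
  move=> [_ Hp] [_ Hq] eps He.
  have He2 : 0 < eps / 2 by lra.
  apply: (locally_imp2 x _ _ _ (Hp x (fun P HP => HP) (mkposreal _ He2)) (Hq x (fun P HP => HP) (mkposreal _ He2))) => w A B.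
  have E : RtoC (w - x) = (RtoC w - RtoC x)%C by exact: RtoC_minus.
  rewrite -E Cmod_R.
  move: A B. rewrite /norm /= /abs /= /minus /plus /opp /scal /= /mult /= => A B.
  apply: Rle_trans (Cmod_Re_Im _) _. simpl.
  replace (p w + - p x + - (dp * (w - x) - dq * 0)) with (p w + - p x + - ((w + - x) * dp)) by ring.
  replace (q w + - q x + - (dp * 0 + dq * (w - x))) with (q w + - q x + - ((w + - x) * dq)) by ring.
  replace (Rabs (w - x)) with (Rabs (w + - x)) by (f_equal; ring).
  lra.
Qed.

Lemma curve_deriv_RtoC (h : R -> R) x l : is_derive h x l -> is_curve_deriv (fun y => RtoC (h y)) x (RtoC l).
Proof. move=> H. apply: curve_deriv_pair => //; exact: (is_derive_const (V := R_NormedModule) 0). Qed.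

(* Differentiation under the integral sign, when the derivative integrates to 0. *)
Lemma CInt_param_const (Phi dPhi : R -> R -> C) (a b : R) :
  (forall tau theta, is_curve_deriv (fun u => Phi u theta) tau (dPhi tau theta)) ->
  (forall tau theta, continuous (T := prod_UniformSpace R_UniformSpace R_UniformSpace)
     (U := C_UniformSpace) (fun p => dPhi (fst p) (snd p)) (tau, theta)) ->
  (forall tau theta, Rcont (Phi tau) theta) ->
  (forall tau, CInt (dPhi tau) a b = 0) ->
  forall t1 t2, CInt (Phi t1) a b = CInt (Phi t2) a b.
Proof.
  move=> HD HC Hc H0.
  have cd : forall tau theta, Rcont (dPhi tau) theta.
  { move=> tau theta.
    apply: (continuous_comp (fun th : R => (tau, th)) (fun p => dPhi (fst p) (snd p))) => //=.
    apply: (continuous_comp_2 (U := R_UniformSpace) (V := R_UniformSpace) (W := R_UniformSpace)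
       (X := prod_UniformSpace R_UniformSpace R_UniformSpace) (fun _ => tau) (fun th => th) (fun x y => (x, y))).
    - exact: continuous_const.
    - exact: continuous_id.
    - apply: (continuous_ext (fun p => p)); [by case | exact: continuous_id]. }
  (* Differentiation under the integral is applied to real integrands; [pr] stands for the real or
     the imaginary part. *)
  have key : forall (pr : C -> R), (pr = fst \/ pr = snd) ->
     forall t1 t2, RInt (fun th => pr (Phi t1 th)) a b = RInt (fun th => pr (Phi t2 th)) a b.
  { move=> pr Hpr.
    have prD : forall tau theta, is_derive (fun u => pr (Phi u theta)) tau (pr (dPhi tau theta)).
    { move=> tau theta. case: Hpr => ->; [exact: curve_deriv_fst | exact: curve_deriv_snd]. }
    have prc : forall (U : UniformSpace) (f : U -> C) u, continuous (U := C_UniformSpace) f u -> continuous (fun v => pr (f v)) u.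
    { move=> U f u. case: Hpr => ->; [exact: Ccont_fst | exact: Ccont_snd]. }
    have D0 : forall tau, is_derive (fun u => RInt (fun th => pr (Phi u th)) a b) tau 0.
    { move=> tau.
      have E : RInt (fun t => Derive (fun u => pr (Phi u t)) tau) a b = 0.
      { rewrite (RInt_ext _ (fun t => pr (dPhi tau t))).
        - have HI : is_RInt (V := C_R_NormedModule) (dPhi tau) a b (RtoC 0).
          { rewrite -(H0 tau). apply: CInt_is => x _. exact: cd. }
          apply: (is_RInt_unique (V := R_CompleteNormedModule)).
          case: Hpr => ->; [exact: (is_RInt_fst _ _ _ _ HI) | exact: (is_RInt_snd _ _ _ _ HI)].
        - move=> x _. apply: is_derive_unique. exact: prD. }
      rewrite -E.
      apply: (is_derive_RInt_param (fun u t => pr (Phi u t))).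
      - apply: filter_forall => u t _. eexists. exact: prD.
      - move=> t _. apply/continuity_2d_pt_filterlim.
        apply: (continuous_ext (fun p : R * R => pr (dPhi (fst p) (snd p)))).
        + move=> p. symmetry. apply: is_derive_unique. exact: prD.
        + exact: (prc (prod_UniformSpace R_UniformSpace R_UniformSpace)).
      - apply: filter_forall => u. apply: (ex_RInt_continuous (V := R_CompleteNormedModule)) => z _.
        exact: (prc R_UniformSpace). }
    move=> t1 t2.
    case: (Rtotal_order t1 t2) => [H|[->|H]] //.
    - exact: (eq_is_derive (V := R_NormedModule) (fun u => RInt (fun th => pr (Phi u th)) a b) t1 t2).
    - symmetry. exact: (eq_is_derive (V := R_NormedModule) (fun u => RInt (fun th => pr (Phi u th)) a b) t2 t1). }
  move=> t1 t2.
  have split_int : forall t, CInt (Phi t) a b = (RInt (fun th => fst (Phi t th)) a b, RInt (fun th => snd (Phi t th)) a b).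
  { move=> t. apply: CInt_unique. apply: is_RInt_pair;
      apply: (RInt_correct (V := R_CompleteNormedModule));
      apply: (ex_RInt_continuous (V := R_CompleteNormedModule)) => z _;
      [exact: (Ccont_fst (U := R_UniformSpace)) | exact: (Ccont_snd (U := R_UniformSpace))]. }
  rewrite !split_int (key fst (or_introl eq_refl) t1 t2) (key snd (or_intror eq_refl) t1 t2). by [].
Qed.

(** * Closed curves, their deformations and winding numbers *)

Definition cis (theta : R) : C := (cos theta, sin theta).

Lemma cis_deriv theta : is_curve_deriv cis theta (Ci * cis theta)%C.
Proof.
  have -> : (Ci * cis theta)%C = (- sin theta, cos theta).
  { rewrite /Ci /cis /Cmult /=. f_equal; ring. }
  apply: curve_deriv_pair.
  - exact: is_derive_cos.
  - exact: is_derive_sin.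
Qed.

Lemma cis_cont theta : Rcont cis theta.
Proof. exact: curve_deriv_continuous (cis_deriv theta). Qed.

Lemma Cmod_cis theta : Cmod (cis theta) = 1.
Proof.
  rewrite /Cmod /cis /=. have := sin2_cos2 theta. rewrite /Rsqr => H.
  replace (cos theta * (cos theta * 1) + sin theta * (sin theta * 1)) with 1 by lra. exact: sqrt_1.
Qed.

Lemma cis_neq_0 theta : cis theta <> 0%C.
Proof. apply/Cmod_gt_0. rewrite Cmod_cis. lra. Qed.

Lemma cis_2PI : cis (2 * PI) = cis 0.
Proof. rewrite /cis sin_2PI cos_2PI sin_0 cos_0. by []. Qed.

Record closed_curve (gam dgam : R -> C) : Prop := {
  cc_deriv : forall th, is_curve_deriv gam th (dgam th);
  cc_cont : forall th, Rcont dgam th;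
  cc_closed : gam (2 * PI) = gam 0 }.

Lemma cc_gcont gam dgam : closed_curve gam dgam -> forall th, Rcont gam th.
Proof. move=> H th. exact: curve_deriv_continuous (cc_deriv _ _ H th). Qed.

Lemma Rcont_cont_on f a b : (forall x, Rcont f x) -> cont_on a b f.
Proof. by move=> H x _. Qed.

Lemma two_PI_pos : 0 < 2 * PI.
Proof. have := PI_RGT_0. lra. Qed.

(** Homotopy parameter. [CInt_param_const] asks for differentiability on the whole line, while the
    homotopies make sense for parameters in [0,1] only. [ramp] is smooth, stays in that interval,
    and takes the value 0 at [0] and 1 at [PI / 2]. *)
Definition ramp (tau : R) : R := (sin tau) ^ 2.

Lemma ramp_range tau : 0 <= ramp tau <= 1.
Proof.
  rewrite /ramp. have := sin2_cos2 tau. rewrite /Rsqr. nra.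
Qed.

Lemma ramp_deriv tau : is_curve_deriv (fun u => RtoC (ramp u)) tau (RtoC (2 * sin tau * cos tau)).
Proof.
  apply: curve_deriv_RtoC. rewrite /ramp. auto_derive => //. ring.
Qed.

Section Homotopy.
Variables (gam dgam : R -> C).
Hypothesis Hg : closed_curve gam dgam.

Lemma pair_fst_cont (f : R -> C) (tau theta : R) : Rcont f tau ->
  continuous (T := prod_UniformSpace R_UniformSpace R_UniformSpace) (U := C_UniformSpace) (fun p => f (fst p)) (tau, theta).
Proof.
  move=> H. apply: (continuous_comp (V := R_UniformSpace) (fun p : R * R => fst p) f) => //.
  exact: continuous_fst.
Qed.

Lemma pair_snd_cont (f : R -> C) (tau theta : R) : Rcont f theta ->
  continuous (T := prod_UniformSpace R_UniformSpace R_UniformSpace) (U := C_UniformSpace) (fun p => f (snd p)) (tau, theta).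
Proof.
  move=> H. apply: (continuous_comp (V := R_UniformSpace) (fun p : R * R => snd p) f) => //.
  exact: continuous_snd.
Qed.

Lemma sincos_cont (tau : R) : Rcont (fun u => RtoC (2 * sin u * cos u)) tau.
Proof.
  apply: Ccont_RtoC. apply: (ex_derive_continuous (V := R_NormedModule)). auto_derive. by [].
Qed.

(** Contraction to 0 along rays: the derivative of [s * Q (s * gam) * dgam] in [s] is the derivative
    of [Q (s * gam) * gam] in the curve parameter, so it integrates to 0 over a closed curve. [Q] is
    examined only on the segments from 0 to the curve and may have poles elsewhere. *)
Lemma star_cauchy (Q dQ : C -> C) :
  (forall s th, 0 <= s <= 1 -> is_Cderiv Q (RtoC s * gam th)%C (dQ (RtoC s * gam th)%C) /\
                               Ccont dQ (RtoC s * gam th)%C) ->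
  CInt (fun th => Q (gam th) * dgam th)%C 0 (2 * PI) = 0.
Proof.
  move=> HQ.
  set s := fun tau => RtoC (ramp tau).
  set s' := fun tau => RtoC (2 * sin tau * cos tau).
  have gc := cc_gcont _ _ Hg. have dgc := cc_cont _ _ Hg.
  have HS tau th := HQ (ramp tau) th (ramp_range tau).
  have sc : forall tau, Rcont s tau by move=> tau; exact: curve_deriv_continuous (ramp_deriv tau).
  have QC : forall tau th, Ccont Q (s tau * gam th)%C.
  { move=> tau th. exact: Cderiv_continuous (proj1 (HS tau th)). }
  pose dPhi := fun tau th => (s' tau * (dQ (s tau * gam th) * gam th * s tau + Q (s tau * gam th)) * dgam th)%C.
  have K := CInt_param_const (fun tau th => Q (s tau * gam th) * s tau * dgam th)%C dPhi 0 (2 * PI).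
  have E := K _ _ _ _ 0 (PI / 2).
  rewrite (CInt_ext _ (fun th => Q (s (PI/2)%R * gam th) * s (PI/2)%R * dgam th)%C).
  - rewrite -E.
    + rewrite (CInt_ext _ (fun _ => RtoC 0)).
      * rewrite CInt_const. ring.
      * move=> x _. rewrite /s /ramp sin_0. replace (0 ^ 2) with 0 by ring. ring.
    + move=> tau th.
      have D1 : is_curve_deriv (fun u => s u * gam th)%C tau (s' tau * gam th + s tau * 0)%C.
      { apply: (deriv_mult _ RtoC_continuous s (fun _ => gam th)); [exact: ramp_deriv | exact: deriv_const]. }
      have D2 := deriv_comp RtoC Q _ _ _ _ (proj1 (HS tau th)) (curve_deriv_continuous _ _ _ D1) D1.
      have D3 := deriv_mult _ RtoC_continuous _ _ _ _ _ (deriv_mult _ RtoC_continuous _ _ _ _ _ D2 (ramp_deriv tau)) (deriv_const RtoC (dgam th) tau).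
      rewrite /dPhi.
      match type of D3 with deriv_along _ _ _ ?x => replace (s' tau * _ * _)%C with x; first exact: D3 end.
      rewrite /s' /s. ring.
    + move=> tau th. rewrite /dPhi.
      have Arg : continuous (T := prod_UniformSpace R_UniformSpace R_UniformSpace) (U := C_UniformSpace) (fun p => s (fst p) * gam (snd p))%C (tau, th).
      { apply: Ccont_mult; [apply: (pair_fst_cont s); exact: sc | apply: (pair_snd_cont gam); exact: gc]. }
      apply: Ccont_mult; last by apply: (pair_snd_cont dgam).
      apply: Ccont_mult; first by apply: (pair_fst_cont s'); exact: sincos_cont.
      apply: Ccont_plus.
      * apply: Ccont_mult; last by apply: (pair_fst_cont s).
        apply: Ccont_mult; last by apply: (pair_snd_cont gam).
        apply: (continuous_comp (V := C_UniformSpace) _ dQ) => //; exact: (proj2 (HS tau th)).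
      * apply: (continuous_comp (V := C_UniformSpace) _ Q) => //; exact: QC.
    + move=> tau th. apply: Ccont_mult => //. apply: Ccont_mult; last exact: Ccont_const.
      apply: (continuous_comp (V := C_UniformSpace) _ Q); last exact: QC.
      by apply: Ccont_mult => //; exact: Ccont_const.
    + move=> tau. rewrite (CInt_FTC _ _ (fun th => s' tau * (Q (s tau * gam th) * gam th))%C).
      * rewrite (cc_closed _ _ Hg). ring.
      * move=> th _. rewrite /dPhi.
        have D1 := deriv_scal RtoC (s tau) _ _ _ (cc_deriv _ _ Hg th).
        have D2 := deriv_comp RtoC Q _ _ _ _ (proj1 (HS tau th)) (curve_deriv_continuous _ _ _ D1) D1.
        have D3 := deriv_scal RtoC (s' tau) _ _ _ (deriv_mult _ RtoC_continuous _ _ _ _ _ D2 (cc_deriv _ _ Hg th)).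
        match type of D3 with deriv_along _ _ _ ?x => replace (s' tau * _ * _)%C with x; first exact: D3 end.
        rewrite /s' /s. ring.
      * apply: Rcont_cont_on => th. rewrite /dPhi.
        have Arg : Rcont (fun x => s tau * gam x)%C th by apply: Ccont_mult => //; exact: Ccont_const.
        apply: Ccont_mult => //. apply: Ccont_mult; first exact: Ccont_const.
        apply: Ccont_plus.
        -- apply: Ccont_mult; last exact: Ccont_const. apply: Ccont_mult => //.
           apply: (continuous_comp (V := C_UniformSpace) _ dQ) => //; exact: (proj2 (HS tau th)).
        -- apply: (continuous_comp (V := C_UniformSpace) _ Q) => //; exact: QC.
  - move=> x _. rewrite /s /ramp sin_PI2. replace (1 ^ 2) with 1 by ring.
    replace (RtoC 1 * gam x)%C with (gam x) by ring. ring.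
Qed.

(** The pole moves from [l] to 0 along a segment missed by the curve. The derivative of the
    integrand in [s], with the pole at [s * l], is exact along the curve with primitive
    [- l / (gam - s * l)], so the integral does not change. *)
Lemma winding_move (l : C) :
  (forall s th, 0 <= s <= 1 -> gam th <> (RtoC s * l)%C) ->
  CInt (fun th => dgam th / (gam th - l))%C 0 (2 * PI) = CInt (fun th => dgam th / gam th)%C 0 (2 * PI).
Proof.
  move=> HN.
  set s := fun tau => RtoC (ramp tau).
  set s' := fun tau => RtoC (2 * sin tau * cos tau).
  have gc := cc_gcont _ _ Hg. have dgc := cc_cont _ _ Hg.
  have HS tau th : (gam th - s tau * l)%C <> 0.
  { apply: Cminus_eq_contra. exact: (HN (ramp tau) th (ramp_range tau)). }
  have sc : forall tau, Rcont s tau by move=> tau; exact: curve_deriv_continuous (ramp_deriv tau).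
  pose dPhi := fun tau th => (s' tau * l * (dgam th / ((gam th - s tau * l) * (gam th - s tau * l))))%C.
  have K := CInt_param_const (fun tau th => dgam th / (gam th - s tau * l))%C dPhi 0 (2 * PI).
  have E := K _ _ _ _ (PI / 2) 0.
  have D0 tau th : is_curve_deriv (fun u => gam th - s u * l)%C tau (0 - (s' tau * l + s tau * 0))%C.
  { apply: deriv_minus; first exact: deriv_const.
    apply: (deriv_mult _ RtoC_continuous s (fun _ => l)); [exact: ramp_deriv | exact: deriv_const]. }
  rewrite (CInt_ext _ (fun th => dgam th / (gam th - s (PI/2)%R * l))%C).
  - rewrite E.
    + apply: CInt_ext => x _. rewrite /s /ramp sin_0. replace (0 ^ 2) with 0 by ring.
      do 2 f_equal. ring.
    + move=> tau th.
      have D2 := deriv_scal _ (dgam th) _ _ _ (deriv_comp RtoC Cinv _ _ _ _ (Cderiv_inv _ (HS tau th)) (curve_deriv_continuous _ _ _ (D0 tau th)) (D0 tau th)).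
      rewrite /dPhi.
      match type of D2 with deriv_along _ _ _ ?x => replace (s' tau * _ * _)%C with x; first exact: D2 end.
      field. exact: HS.
    + move=> tau th. rewrite /dPhi.
      have Arg : continuous (T := prod_UniformSpace R_UniformSpace R_UniformSpace) (U := C_UniformSpace) (fun p => gam (snd p) - s (fst p) * l)%C (tau, th).
      { apply: Ccont_minus; first by apply: (pair_snd_cont gam).
        apply: Ccont_mult; [by apply: (pair_fst_cont s) | exact: Ccont_const]. }
      apply: Ccont_mult.
      * apply: Ccont_mult; last exact: Ccont_const. apply: (pair_fst_cont s'); exact: sincos_cont.
      * apply: Ccont_div => /=.
        -- apply: Cmult_neq_0; exact: HS.
        -- by apply: (pair_snd_cont dgam).
        -- exact: Ccont_mult.
    + move=> tau th. apply: Ccont_div => //. apply: Ccont_minus => //; exact: Ccont_const.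
    + move=> tau. rewrite (CInt_FTC _ _ (fun th => (- (s' tau * l)) * (/ (gam th - s tau * l)))%C).
      * rewrite (cc_closed _ _ Hg). ring.
      * move=> th _. rewrite /dPhi.
        have D1 := deriv_minus RtoC _ _ _ _ _ (cc_deriv _ _ Hg th) (deriv_const RtoC (s tau * l)%C th).
        have D2 := deriv_scal _ (- (s' tau * l))%C _ _ _ (deriv_comp RtoC Cinv _ _ _ _ (Cderiv_inv _ (HS tau th)) (curve_deriv_continuous _ _ _ D1) D1).
        match type of D2 with deriv_along _ _ _ ?x => replace (s' tau * _ * _)%C with x; first exact: D2 end.
        field. exact: HS.
      * apply: Rcont_cont_on => th. rewrite /dPhi.
        have Arg : Rcont (fun x => gam x - s tau * l)%C th by apply: Ccont_minus => //; exact: Ccont_const.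
        apply: Ccont_mult; first exact: Ccont_const.
        apply: Ccont_div => //.
        -- apply: Cmult_neq_0; exact: HS.
        -- exact: Ccont_mult.
  - move=> x _. rewrite /s /ramp sin_PI2. replace (1 ^ 2) with 1 by ring.
    do 2 f_equal. ring.
Qed.

(* Cauchy's formula for a function with continuous derivative, by contracting the curve to [w]. *)
Lemma cauchy_C1 (P p : C -> C) (w : C) :
  (forall z, is_Cderiv P z (p z)) -> (forall z, Ccont p z) -> (forall th, gam th <> w) ->
  CInt (fun th => P (gam th) * (dgam th / (gam th - w)))%C 0 (2 * PI) =
  (P w * CInt (fun th => dgam th / (gam th - w))%C 0 (2 * PI))%C.
Proof.
  move=> HP Hp HN.
  set s := fun tau => RtoC (ramp tau).
  set s' := fun tau => RtoC (2 * sin tau * cos tau).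
  have gc := cc_gcont _ _ Hg. have dgc := cc_cont _ _ Hg.
  have HS th : (gam th - w)%C <> 0 by apply: Cminus_eq_contra.
  have sc : forall tau, Rcont s tau by move=> tau; exact: curve_deriv_continuous (ramp_deriv tau).
  have QC : forall z, Ccont P z by move=> z; exact: Cderiv_continuous (HP z).
  pose dPhi := fun tau th => (s' tau * p (w + s tau * (gam th - w)) * dgam th)%C.
  have K := CInt_param_const (fun tau th => P (w + s tau * (gam th - w)) * (dgam th / (gam th - w)))%C dPhi 0 (2 * PI).
  have E := K _ _ _ _ (PI / 2) 0.
  have kc th : Rcont (fun th => dgam th / (gam th - w))%C th.
  { apply: Ccont_div => //. apply: Ccont_minus => //; exact: Ccont_const. }
  rewrite (CInt_ext _ (fun th => P (w + s (PI/2)%R * (gam th - w)) * (dgam th / (gam th - w)))%C).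
  - rewrite E.
    + rewrite -CInt_Cscal; last exact: Rcont_cont_on.
      apply: CInt_ext => x _. rewrite /s /ramp sin_0. replace (0 ^ 2) with 0 by ring.
      do 2 f_equal. ring.
    + move=> tau th.
      have D1 : is_curve_deriv (fun u => w + s u * (gam th - w))%C tau (0 + (s' tau * (gam th - w) + s tau * 0))%C.
      { apply: deriv_plus; first exact: deriv_const.
        apply: (deriv_mult _ RtoC_continuous s (fun _ => gam th - w)%C); [exact: ramp_deriv | exact: deriv_const]. }
      have D2 := deriv_comp RtoC P _ _ _ _ (HP _) (curve_deriv_continuous _ _ _ D1) D1.
      have D3 := deriv_mult _ RtoC_continuous _ _ _ _ _ D2 (deriv_const RtoC (dgam th / (gam th - w))%C tau).
      rewrite /dPhi.
      match type of D3 with deriv_along _ _ _ ?x => replace (s' tau * _ * _)%C with x; first exact: D3 end.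
      field. exact: HS.
    + move=> tau th. rewrite /dPhi.
      apply: Ccont_mult; last by apply: (pair_snd_cont dgam).
      apply: Ccont_mult; first by apply: (pair_fst_cont s'); exact: sincos_cont.
      apply: (continuous_comp (V := C_UniformSpace) _ p) => //.
      apply: Ccont_plus; first exact: Ccont_const.
      apply: Ccont_mult; first by apply: (pair_fst_cont s).
      apply: Ccont_minus; [by apply: (pair_snd_cont gam) | exact: Ccont_const].
    + move=> tau th. apply: Ccont_mult => //.
      apply: (continuous_comp (V := C_UniformSpace) _ P) => //.
      apply: Ccont_plus; first exact: Ccont_const.
      apply: Ccont_mult; first exact: Ccont_const. apply: Ccont_minus => //; exact: Ccont_const.
    + move=> tau. rewrite /dPhi.
      (* The primitive used in the second case divides by [s tau]. Where this vanishes,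
         [sin tau = 0], so the factor [s' tau] vanishes as well. *)
      case: (Ceq_dec (s tau) 0) => [Hs|Hs].
      * have -> : s' tau = 0.
        { rewrite /s'. f_equal. have : ramp tau = 0 by move: Hs; rewrite /s; exact: RtoC_inj.
          rewrite /ramp => H. have -> : sin tau = 0 by nra. ring. }
        rewrite (CInt_ext _ (fun _ => RtoC 0)); last by move=> x _; ring.
        rewrite CInt_const. ring.
      * rewrite (CInt_FTC _ _ (fun th => s' tau / s tau * P (w + s tau * (gam th - w)))%C).
        -- rewrite (cc_closed _ _ Hg). ring.
        -- move=> th _.
           have D1 := deriv_plus _ _ _ _ _ _ (deriv_const RtoC w th) (deriv_scal RtoC (s tau) _ _ _ (deriv_minus RtoC _ _ _ _ _ (cc_deriv _ _ Hg th) (deriv_const RtoC w th))).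
           have D2 := deriv_scal _ (s' tau / s tau)%C _ _ _ (deriv_comp RtoC P _ _ _ _ (HP _) (curve_deriv_continuous _ _ _ D1) D1).
           match type of D2 with deriv_along _ _ _ ?x => replace (s' tau * _ * _)%C with x; first exact: D2 end.
           field. exact: Hs.
        -- apply: Rcont_cont_on => th.
           apply: Ccont_mult => //. apply: Ccont_mult; first exact: Ccont_const.
           apply: (continuous_comp (V := C_UniformSpace) _ p) => //.
           apply: Ccont_plus; first exact: Ccont_const.
           apply: Ccont_mult; first exact: Ccont_const. apply: Ccont_minus => //; exact: Ccont_const.
  - move=> x _. rewrite /s /ramp sin_PI2. replace (1 ^ 2) with 1 by ring.
    do 2 f_equal. ring.
Qed.

End Homotopy.

(** The logarithmic derivative of [r * cis] is [dr / r + Ci], with the single-valued primitive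
    [ln r + Ci * th]; over one turn only the angle contributes. *)
Lemma winding_polar (r dr : R -> R) :
  (forall th, is_derive r th (dr th)) -> (forall th, continuous dr th) -> (forall th, 0 < r th) ->
  r (2 * PI) = r 0 ->
  CInt (fun th => (RtoC (dr th) * cis th + RtoC (r th) * (Ci * cis th)) / (RtoC (r th) * cis th))%C 0 (2 * PI)
   = (2 * PI * Ci)%C.
Proof.
  move=> Hr Hc Hp Hcl.
  have rc : forall th, Rcont (fun x => RtoC (r x)) th.
  { move=> th. apply: Ccont_RtoC. apply: (ex_derive_continuous (V := R_NormedModule)). eexists. exact: Hr. }
  have nz : forall th, RtoC (r th) <> 0.
  { move=> th /RtoC_inj H. have := Hp th. lra. }
  rewrite (CInt_ext _ (fun th => RtoC (dr th / r th) + Ci)%C).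
  - rewrite (CInt_FTC _ _ (fun th => RtoC (ln (r th)) + RtoC th * Ci)%C).
    + rewrite Hcl -!RtoC_mult. rewrite RtoC_mult. ring.
    + move=> th _. apply: deriv_plus.
      * apply: curve_deriv_RtoC.
        have := is_derive_comp ln r th _ _ (is_derive_ln (r th) (Hp th)) (Hr th).
        rewrite /scal /= /mult /=. by [].
      * have := deriv_mult _ RtoC_continuous _ _ _ _ _ (deriv_self RtoC th) (deriv_const RtoC Ci th).
        replace (1 * Ci + RtoC th * 0)%C with Ci by ring. by [].
    + apply: Rcont_cont_on => th. apply: Ccont_plus; last exact: Ccont_const.
      apply: Ccont_RtoC. apply: continuous_mult => //.
      apply: (continuous_comp r Rinv).
      * apply: (ex_derive_continuous (V := R_NormedModule)). eexists. exact: Hr.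
      * apply/continuity_pt_filterlim. apply: continuity_pt_inv.
        -- exact: continuity_pt_id.
        -- have := Hp th. rewrite /id. lra.
  - move=> th _. rewrite RtoC_div; last by have := Hp th; lra.
    field. split; [exact: nz | exact: cis_neq_0].
Qed.

(** * Goursat, Morera and the regularity of entire functions *)

Lemma CInt_swap (f : R -> C) a b : (forall x, Rcont f x) -> CInt f b a = (- CInt f a b)%C.
Proof.
  move=> H. have E := CInt_Chasles f a b a H.
  have E0 : CInt f a a = 0 by exact: (RInt_point (V := C_R_CompleteNormedModule)).
  rewrite E0 in E. replace (CInt f b a) with ((CInt f a b + CInt f b a) - CInt f a b)%C by ring.
  rewrite E. ring.
Qed.

Lemma CInt_norm_le_abs (f : R -> C) a b M : (forall x, Rcont f x) ->
  (forall x, Rmin a b <= x <= Rmax a b -> Cmod (f x) <= M) -> Cmod (CInt f a b) <= Rabs (b - a) * M.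
Proof.
  move=> Hc HM. case: (Rle_dec a b) => Hab.
  - rewrite Rabs_pos_eq; last lra.
    apply: CInt_norm_le => // x Hx. apply: HM. rewrite Rmin_left // Rmax_right //.
  - rewrite CInt_swap // Cmod_opp Rabs_left; last lra.
    replace (- (b - a)) with (a - b) by ring.
    apply: CInt_norm_le => //; first lra.
    move=> x Hx. apply: HM. rewrite Rmin_right ?Rmax_left; lra.
Qed.

Lemma hline_deriv (y x : R) : is_curve_deriv (fun x => (x, y)) x 1%C.
Proof.
  apply: curve_deriv_pair; first exact: (is_derive_id (K := R_AbsRing)).
  exact: (is_derive_const (V := R_NormedModule)).
Qed.

Lemma vline_deriv (x y : R) : is_curve_deriv (fun y => (x, y)) y Ci.
Proof.
  apply: curve_deriv_pair; last exact: (is_derive_id (K := R_AbsRing)).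
  exact: (is_derive_const (V := R_NormedModule)).
Qed.

Lemma hline_cont (f : C -> C) y x : (forall z, Ccont f z) -> Rcont (fun x => f (x, y)) x.
Proof.
  move=> H. apply: (continuous_comp (V := C_UniformSpace) (fun x : R => (x, y)) f) => //.
  exact: curve_deriv_continuous (hline_deriv y x).
Qed.

Lemma vline_cont (f : C -> C) x y : (forall z, Ccont f z) -> Rcont (fun y => f (x, y)) y.
Proof.
  move=> H. apply: (continuous_comp (V := C_UniformSpace) (fun y : R => (x, y)) f) => //.
  exact: curve_deriv_continuous (vline_deriv x y).
Qed.

(** Oriented integrals, so that [a], [b] and [c], [d] may come in any order: splitting a rectangle,
    or joining two arbitrary points by its sides, needs no case distinction. *)
Definition hInt (f : C -> C) (y a b : R) : C := CInt (fun x => f (x, y)) a b.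
Definition vInt (f : C -> C) (x c d : R) : C := (Ci * CInt (fun y => f (x, y)) c d)%C.
Definition rect_int (f : C -> C) (a b c d : R) : C :=
  (hInt f c a b + vInt f b c d - hInt f d a b - vInt f a c d)%C.

Lemma rect_int_primitive (F f : C -> C) a b c d :
  (forall z, is_Cderiv F z (f z)) -> (forall z, Ccont f z) -> rect_int f a b c d = 0.
Proof.
  move=> HF Hf.
  have Hh : forall y a b, hInt f y a b = (F (b, y) - F (a, y))%C.
  { move=> y a' b'. apply: (CInt_FTC _ _ (fun x => F (x, y))).
    - move=> x _. have := deriv_comp RtoC F _ _ _ _ (HF (x, y)) (curve_deriv_continuous _ _ _ (hline_deriv y x)) (hline_deriv y x).
      by rewrite Cmult_1_r.
    - move=> x _. exact: hline_cont. }
  have Hv : forall x c d, vInt f x c d = (F (x, d) - F (x, c))%C.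
  { move=> x c' d'. rewrite /vInt -CInt_Cscal; last by move=> y _; exact: vline_cont.
    apply: (CInt_FTC _ _ (fun y => F (x, y))).
    - move=> y _. have := deriv_comp RtoC F _ _ _ _ (HF (x, y)) (curve_deriv_continuous _ _ _ (vline_deriv x y)) (vline_deriv x y).
      by rewrite Cmult_comm.
    - move=> y _. apply: Ccont_mult; [exact: Ccont_const | exact: vline_cont]. }
  rewrite /rect_int !Hh !Hv. ring.
Qed.

Lemma rect_int_minus (f g : C -> C) a b c d :
  (forall z, Ccont f z) -> (forall z, Ccont g z) ->
  rect_int (fun z => f z - g z)%C a b c d = (rect_int f a b c d - rect_int g a b c d)%C.
Proof.
  move=> Hf Hg. rewrite /rect_int /hInt /vInt.
  rewrite !CInt_minus; try (move=> x _; exact: hline_cont); try (move=> x _; exact: vline_cont).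
  ring.
Qed.

Lemma rect_int_norm_le (f : C -> C) a b c d M : (forall z, Ccont f z) ->
  (forall x y, Rmin a b <= x <= Rmax a b -> Rmin c d <= y <= Rmax c d -> Cmod (f (x, y)) <= M) ->
  Cmod (rect_int f a b c d) <= 2 * (Rabs (b - a) + Rabs (d - c)) * M.
Proof.
  move=> Hf HM.
  have Hh : forall y, Rmin c d <= y <= Rmax c d -> Cmod (hInt f y a b) <= Rabs (b - a) * M.
  { move=> y Hy. apply: CInt_norm_le_abs => x; [exact: hline_cont | by move=> Hx; exact: HM]. }
  have Hv : forall x, Rmin a b <= x <= Rmax a b -> Cmod (vInt f x c d) <= Rabs (d - c) * M.
  { move=> x Hx. rewrite /vInt Cmod_mult Cmod_Ci Rmult_1_l.
    apply: CInt_norm_le_abs => y; [exact: vline_cont | by move=> Hy; exact: HM]. }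
  have mm : forall p q, (Rmin p q <= p <= Rmax p q) /\ (Rmin p q <= q <= Rmax p q).
  { move=> p q. have := Rmin_l p q. have := Rmin_r p q. have := Rmax_l p q. have := Rmax_r p q. lra. }
  have h1 := Hh c (proj1 (mm c d)). have h2 := Hh d (proj2 (mm c d)).
  have h3 := Hv a (proj1 (mm a b)). have h4 := Hv b (proj2 (mm a b)).
  rewrite /rect_int.
  have T1 := Cmod_triangle (hInt f c a b + vInt f b c d - hInt f d a b) (- vInt f a c d).
  have T2 := Cmod_triangle (hInt f c a b + vInt f b c d) (- hInt f d a b).
  have T3 := Cmod_triangle (hInt f c a b) (vInt f b c d).
  rewrite Cmod_opp in T1. rewrite Cmod_opp in T2. rewrite /Cminus in T1 T2 *. lra.
Qed.

Lemma rect_int_split_x (f : C -> C) a m b c d : (forall z, Ccont f z) ->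
  rect_int f a b c d = (rect_int f a m c d + rect_int f m b c d)%C.
Proof.
  move=> Hf. rewrite /rect_int /hInt.
  rewrite -(CInt_Chasles (fun x => f (x, c)) a m b); last by move=> x; exact: hline_cont.
  rewrite -(CInt_Chasles (fun x => f (x, d)) a m b); last by move=> x; exact: hline_cont.
  ring.
Qed.

Lemma rect_int_split_y (f : C -> C) a b c m d : (forall z, Ccont f z) ->
  rect_int f a b c d = (rect_int f a b c m + rect_int f a b m d)%C.
Proof.
  move=> Hf. rewrite /rect_int /vInt.
  rewrite -(CInt_Chasles (fun y => f (b, y)) c m d); last by move=> x; exact: vline_cont.
  rewrite -(CInt_Chasles (fun y => f (a, y)) c m d); last by move=> x; exact: vline_cont.
  ring.
Qed.

Section Goursat.
Variables (f : C -> C) (a0 c0 w h eta : R).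
Hypothesis f_cont : forall z, Ccont f z.

(** Boundary integral of the box obtained after [n] halvings, identified by one corner [p]; the side
    lengths [w] and [h] are signed. *)
Definition box (n : nat) (p : R * R) : C :=
  rect_int f (fst p) (fst p + w / 2 ^ n) (snd p) (snd p + h / 2 ^ n).
Definition big (n : nat) (p : R * R) := eta / 4 ^ n <= Cmod (box n p).

(* Among the four half-size boxes, pick one whose integral is not small. *)
Definition next (n : nat) (p : R * R) : R * R :=
  let w' := w / 2 ^ S n in let h' := h / 2 ^ S n in
  let p1 := (fst p + w', snd p) in let p2 := (fst p, snd p + h') in
  let p3 := (fst p + w', snd p + h') in
  if Rle_dec (eta / 4 ^ S n) (Cmod (box (S n) p)) then p
  else if Rle_dec (eta / 4 ^ S n) (Cmod (box (S n) p1)) then p1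
  else if Rle_dec (eta / 4 ^ S n) (Cmod (box (S n) p2)) then p2 else p3.

Lemma pow2_pos n : 0 < 2 ^ n. Proof. apply: pow_lt; lra. Qed.
Lemma pow4_pos n : 0 < 4 ^ n. Proof. apply: pow_lt; lra. Qed.

Lemma big_next n p : big n p -> big (S n) (next n p).
Proof.
  rewrite /big => H.
  have E : box n p = (box (S n) p + box (S n) ((fst p + w / 2 ^ S n)%R, snd p)
      + box (S n) (fst p, (snd p + h / 2 ^ S n)%R) + box (S n) ((fst p + w / 2 ^ S n)%R, (snd p + h / 2 ^ S n)%R))%C.
  { rewrite /box /=. have H2 := pow2_pos n.
    rewrite (rect_int_split_x f (fst p) (fst p + w / (2 * 2 ^ n)) _ _ _ f_cont).
    rewrite (rect_int_split_y f _ _ (snd p) (snd p + h / (2 * 2 ^ n)) _ f_cont).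
    rewrite (rect_int_split_y f (fst p + w / (2 * 2 ^ n)) _ (snd p) (snd p + h / (2 * 2 ^ n)) _ f_cont).
    replace (fst p + w / (2 * 2 ^ n) + w / (2 * 2 ^ n)) with (fst p + w / 2 ^ n) by (field; lra).
    replace (snd p + h / (2 * 2 ^ n) + h / (2 * 2 ^ n)) with (snd p + h / 2 ^ n) by (field; lra).
    ring. }
  rewrite E in H. rewrite /next.
  have H4 := pow4_pos n.
  have EE : eta / 4 ^ S n = eta / 4 ^ n / 4 by simpl; field; lra.
  case: Rle_dec => // N0. case: Rle_dec => // N1. case: Rle_dec => // N2.
  have T1 := Cmod_triangle (box (S n) p + box (S n) ((fst p + w / 2 ^ S n)%R, snd p)
      + box (S n) (fst p, (snd p + h / 2 ^ S n)%R)) (box (S n) ((fst p + w / 2 ^ S n)%R, (snd p + h / 2 ^ S n)%R)).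
  have T2 := Cmod_triangle (box (S n) p + box (S n) ((fst p + w / 2 ^ S n)%R, snd p)) (box (S n) (fst p, (snd p + h / 2 ^ S n)%R)).
  have T3 := Cmod_triangle (box (S n) p) (box (S n) ((fst p + w / 2 ^ S n)%R, snd p)).
  lra.
Qed.

Fixpoint corner (n : nat) : R * R :=
  match n with O => (a0, c0) | S k => next k (corner k) end.

Lemma big_corner : eta <= Cmod (rect_int f a0 (a0 + w) c0 (c0 + h)) -> forall n, big n (corner n).
Proof.
  move=> H. elim=> [|n IH]; last exact: big_next.
  rewrite /big /box /=. rewrite !Rdiv_1_r. exact: H.
Qed.

Lemma next_step n p :
  Rabs (fst (next n p) - fst p) <= Rabs w / 2 ^ S n /\ Rabs (snd (next n p) - snd p) <= Rabs h / 2 ^ S n.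
Proof.
  have A : forall v, 0 <= Rabs v / 2 ^ S n.
  { move=> v. apply: Rdiv_le_0_compat; [exact: Rabs_pos | exact: pow2_pos]. }
  have B : forall v, Rabs (v / 2 ^ S n) = Rabs v / 2 ^ S n.
  { move=> v. rewrite Rabs_div; last by have := pow2_pos (S n); lra.
    rewrite (Rabs_pos_eq (2 ^ S n)) //. apply: Rlt_le. exact: pow2_pos. }
  have Aw := A w. have Ah := A h.
  have Bw := B w. have Bh := B h.
  have S0 : forall x, Rabs (x - x) = 0 by move=> x; rewrite Rminus_diag Rabs_R0.
  have S1 : forall x y, Rabs (x + y - x) = Rabs y by move=> x y; f_equal; ring.
  rewrite /next.
  case: Rle_dec => _; last (case: Rle_dec => _; last case: Rle_dec => _);
    cbn [fst snd]; rewrite ?S0 ?S1 ?Bw ?Bh; split; lra.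
Qed.

End Goursat.

(** The explicit rate is what matters: it keeps the limit within one box size of the corner at every
    generation. *)
Lemma geometric_cauchy_limit (u : nat -> R) (K : R) :
  0 <= K -> (forall n, Rabs (u (S n) - u n) <= K / 2 ^ S n) ->
  exists l, forall n, Rabs (u n - l) <= K / 2 ^ n.
Proof.
  move=> HK Hu.
  have H2 := pow2_pos.
  have D : forall n k, Rabs (u (n + k)%nat - u n) <= K / 2 ^ n - K / 2 ^ (n + k).
  { move=> n. elim=> [|k IH].
    - rewrite Nat.add_0_r !Rminus_diag Rabs_R0. lra.
    - rewrite Nat.add_succ_r. have A := Hu (n + k)%nat.
      have B := Rabs_triang (u (S (n + k)) - u (n + k)%nat) (u (n + k)%nat - u n).
      replace (u (S (n + k)) - u (n + k)%nat + (u (n + k)%nat - u n)) with (u (S (n + k)) - u n) in B by ring.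
      have E : K / 2 ^ S (n + k) = K / 2 ^ (n + k) / 2 by simpl; field; have := H2 (n + k)%nat; lra.
      lra. }
  have Dle : forall n m, (n <= m)%nat -> Rabs (u m - u n) <= K / 2 ^ n.
  { move=> n m Hnm. have := D n (m - n)%nat. replace (n + (m - n))%nat with m by lia.
    have : 0 <= K / 2 ^ m by apply: Rdiv_le_0_compat. lra. }
  have C : ex_finite_lim_seq u.
  { apply/ex_lim_seq_cauchy_corr => eps.
    have L : is_lim_seq (fun n => K * (/ 2) ^ n) 0.
    { replace (Finite 0) with (Rbar_mult K 0) by (simpl; f_equal; ring).
      apply: is_lim_seq_scal_l. apply: is_lim_seq_geom. rewrite Rabs_pos_eq; lra. }
    have Hep : 0 < eps / 2 by have := cond_pos eps; lra.
    have [N HN] := proj2 (is_lim_seq_spec _ _) L (mkposreal _ Hep).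
    exists N => n m Hn Hm. simpl in HN.
    have X := HN N (Nat.le_refl _).
    rewrite Rminus_0_r pow_inv in X. have X1 := Rle_abs (K * / 2 ^ N).
    have A := Dle N n Hn. have B := Dle N m Hm. rewrite /Rdiv in A B.
    have T := Rabs_triang (u n - u N) (u N - u m).
    rewrite (Rabs_minus_sym (u N)) in T.
    replace (u n - u N + (u N - u m)) with (u n - u m) in T by ring.
    lra. }
  case: C => l Hl. exists l => n.
  have L : is_lim_seq (fun m => Rabs (u n - u (m + n)%nat)) (Rabs (u n - l)).
  { apply: (is_lim_seq_abs _ (Finite (u n - l))).
    apply: is_lim_seq_minus'; first exact: is_lim_seq_const.
    exact: (proj1 (is_lim_seq_incr_n u n l)). }
  have := is_lim_seq_le _ _ _ _ _ L (is_lim_seq_const (K / 2 ^ n)). apply.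
  move=> m. rewrite Rabs_minus_sym. apply: Dle. lia.
Qed.

Theorem goursat (f : C -> C) (a b c d : R) : entire f -> rect_int f a b c d = 0.
Proof.
  move=> Hent. have Hf := proj1 (entire_Cderiv f) Hent.
  have fc : forall z, Ccont f z by move=> z; exact: entire_continuous.
  apply: Cmod_eq_0.
  set w := b - a. set h := d - c. set eta := Cmod (rect_int f a b c d).
  case: (Req_dec eta 0) => // Hne.
  have Heta : 0 < eta by have := Cmod_ge_0 (rect_int f a b c d); rewrite -/eta; lra.
  have HB : forall n, big f w h eta n (corner f a c w h eta n).
  { apply: big_corner => //. rewrite /w /h. replace (a + (b - a)) with b by ring.
    replace (c + (d - c)) with d by ring. exact: Rle_refl. }
  have [p1 Hp1] := geometric_cauchy_limit (fun n => fst (corner f a c w h eta n)) (Rabs w) (Rabs_pos w)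
    (fun n => proj1 (next_step f w h eta n _)).
  have [p2 Hp2] := geometric_cauchy_limit (fun n => snd (corner f a c w h eta n)) (Rabs h) (Rabs_pos h)
    (fun n => proj2 (next_step f w h eta n _)).
  set L := Rabs w + Rabs h. have HL : 0 <= L by have := Rabs_pos w; have := Rabs_pos h; rewrite /L; lra.
  pose p : C := (p1, p2).
  (* On the box of generation [n] the boundary has length at most [2 * L / 2 ^ n] and lies within
     [2 * L / 2 ^ n] of [p], so the integral is at most [4 * eps * L ^ 2 / 4 ^ n]. The factor 8
     makes this smaller than [eta / 4 ^ n], and [L + 1] avoids a division by 0. *)
  set eps := eta / (8 * (L + 1) * (L + 1)).
  have Heps : 0 < eps by apply: Rdiv_lt_0_compat => //; nra.
  have /locally_C_iff [r [Hr HD]] := Hf p eps Heps.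
  have [n Hn] : exists n, 2 * L / 2 ^ n < r.
  { have Lm : is_lim_seq (fun n => (2 * L) * (/ 2) ^ n) 0.
    { replace (Finite 0) with (Rbar_mult (2 * L) 0) by (simpl; f_equal; ring).
      apply: is_lim_seq_scal_l. apply: is_lim_seq_geom. rewrite Rabs_pos_eq; lra. }
    have [N HN] := proj2 (is_lim_seq_spec _ _) Lm (mkposreal _ Hr).
    exists N. have := HN N (Nat.le_refl _). simpl. rewrite Rminus_0_r pow_inv.
    have := Rle_abs (2 * L * / 2 ^ N). rewrite /Rdiv. lra. }
  have H2 := pow2_pos n.
  have HBn := HB n. rewrite /big /box in HBn.
  set q := corner f a c w h eta n in HBn *.
  (* The affine approximation of [f] at [p] has a primitive, so subtracting it changes no rectangle
     integral. *)
  pose A := fun z : C => (f p + C_derive f p * (z - p))%C.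
  have A_entire : forall z, is_Cderiv (fun z => (f p * z + C_derive f p * (/ 2 * (z - p) * (z - p)))%C) z (A z).
  { move=> z.
    have D1 := deriv_minus _ _ _ _ _ _ (deriv_self (fun z : C_UniformSpace => z) z) (deriv_const (fun z : C_UniformSpace => z) p z).
    have D2 := deriv_mult _ id_continuous_C _ _ _ _ _ (deriv_scal _ (/ 2)%C _ _ _ D1) D1.
    have D3 := deriv_plus _ _ _ _ _ _ (deriv_scal _ (f p) _ _ _ (deriv_self (fun z : C_UniformSpace => z) z)) (deriv_scal _ (C_derive f p) _ _ _ D2).
    match type of D3 with deriv_along _ _ _ ?x => replace (A z) with x; first exact: D3 end.
    rewrite /A. field. }
  have Ac : forall z, Ccont A z.
  { move=> z. apply: Ccont_plus; first exact: Ccont_const. apply: Ccont_mult; first exact: Ccont_const.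
    apply: Ccont_minus; [exact: id_continuous_C | exact: Ccont_const]. }
  set a' := fst q in HBn *. set c' := snd q in HBn *.
  have E : rect_int f a' (a' + w / 2 ^ n) c' (c' + h / 2 ^ n) =
           rect_int (fun z => f z - A z)%C a' (a' + w / 2 ^ n) c' (c' + h / 2 ^ n).
  { rewrite rect_int_minus // (rect_int_primitive _ _ _ _ _ _ A_entire Ac). ring. }
  have absdiv : forall v, Rabs (v / 2 ^ n) = Rabs v / 2 ^ n.
  { move=> v. rewrite Rabs_div; last lra. by rewrite (Rabs_pos_eq (2 ^ n)); last lra. }
  have B : Cmod (rect_int (fun z => f z - A z)%C a' (a' + w / 2 ^ n) c' (c' + h / 2 ^ n))
     <= 2 * (Rabs (a' + w / 2 ^ n - a') + Rabs (c' + h / 2 ^ n - c')) * (eps * (2 * L / 2 ^ n)).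
  { apply: rect_int_norm_le.
    - move=> z. exact: Ccont_minus.
    - move=> x y Hx Hy.
      have Near : forall u v s l, Rabs (u - l) <= Rabs v / 2 ^ n -> Rmin u (u + v / 2 ^ n) <= s <= Rmax u (u + v / 2 ^ n) ->
         Rabs (s - l) <= 2 * (Rabs v / 2 ^ n).
      { move=> u v s l Hu Hs. have Hs2 : Rabs (s - u) <= Rabs v / 2 ^ n.
        { rewrite -absdiv. move: Hs. rewrite /Rmin /Rmax /Rabs. case: Rle_dec => ?; case: Rcase_abs => ?; case: Rcase_abs => ?; lra. }
        replace (s - l) with ((s - u) + (u - l)) by ring. apply: Rle_trans (Rabs_triang _ _) _. lra. }
      have N1 := Near _ _ _ _ (Hp1 n) Hx. have N2 := Near _ _ _ _ (Hp2 n) Hy.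
      have Dist : Cmod ((x, y) - p) <= 2 * L / 2 ^ n.
      { apply: Rle_trans (Cmod_Re_Im _) _.
        apply: Rle_trans (Rplus_le_compat _ _ _ _ N1 N2) _. apply: Req_le. rewrite /L. field. lra. }
      have := HD (x, y) (Rle_lt_trans _ _ _ Dist Hn).
      replace (f (x, y) - A (x, y))%C with (f (x, y) - f p - C_derive f p * ((x, y) - p))%C by (rewrite /A; ring).
      move=> X. apply: Rle_trans X _. apply: Rmult_le_compat_l; lra. }
  replace (a' + w / 2 ^ n - a') with (w / 2 ^ n) in B by ring.
  replace (c' + h / 2 ^ n - c') with (h / 2 ^ n) in B by ring.
  rewrite -E !absdiv in B.
  have F : 2 * (Rabs w / 2 ^ n + Rabs h / 2 ^ n) * (eps * (2 * L / 2 ^ n)) = 4 * eps * (L * L) / 4 ^ n.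
  { have -> : 4 ^ n = 2 ^ n * 2 ^ n by rewrite -Rpow_mult_distr; f_equal; ring.
    rewrite /L. field. lra. }
  rewrite F in B.
  have G : eta / 4 ^ n <= 4 * eps * (L * L) / 4 ^ n by lra.
  have H4 := pow4_pos n.
  have G2 : eta <= 4 * eps * (L * L).
  { apply: (Rmult_le_reg_r (/ 4 ^ n)); first exact: Rinv_0_lt_compat. exact: G. }
  have G3 : 4 * eps * ((L + 1) * (L + 1)) = eta / 2 by rewrite /eps; field; lra.
  nra.
Qed.

Theorem morera (f : C -> C) : (forall z, Ccont f z) ->
  (forall a b c d, rect_int f a b c d = 0) -> exists P : C -> C, forall z, is_Cderiv P z (f z).
Proof.
  move=> fc Hr.
  (* Primitive along the path from 0 that goes horizontally, then vertically. The hypothesis on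
     rectangles turns the increment from [z] to [w] into the integral over the same kind of path
     starting at [z]. *)
  pose P := fun z : C => (hInt f 0 0 (fst z) + vInt f (fst z) 0 (snd z))%C.
  exists P => z eps He.
  have He2 : 0 < eps / 2 by lra.
  have /continuous_C_iff Hc := fc z.
  have /locally_C_iff [r [Hr0 HH]] := Hc _ He2.
  apply/locally_C_iff. exists (r / 2). split; first lra.
  move=> w Hw.
  have E : (P w - P z)%C = (hInt f (snd z) (fst z) (fst w) + vInt f (fst w) (snd z) (snd w))%C.
  { have R0 := Hr (fst z) (fst w) 0 (snd z). rewrite /rect_int in R0.
    have C1 := CInt_Chasles (fun x => f (x, 0)) 0 (fst z) (fst w) (fun x => hline_cont _ _ _ fc).
    have C2 := CInt_Chasles (fun y => f (fst w, y)) 0 (snd z) (snd w) (fun x => vline_cont _ _ _ fc).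
    rewrite /P /hInt /vInt in R0 *. rewrite -C1 -C2.
    set X := CInt _ _ _ in R0 *.
    apply/Ceq_minus. rewrite -R0 /X. ring. }
  rewrite E.
  have F : (f z * (w - z))%C = (CInt (fun _ => f z) (fst z) (fst w) + Ci * CInt (fun _ => f z) (snd z) (snd w))%C.
  { rewrite !CInt_const.
    have -> : (w - z)%C = (RtoC (fst w - fst z) + Ci * RtoC (snd w - snd z))%C.
    { rewrite /Cminus /Cplus /Cmult /Copp /=. f_equal; ring. }
    ring. }
  rewrite F /hInt /vInt.
  have kc : forall x, Rcont (fun _ : R => f z) x by move=> x; exact: Ccont_const.
  set I1 := CInt (fun x => f (x, snd z)) _ _. set I2 := CInt (fun y => f (fst w, y)) _ _.
  set J1 := CInt (fun _ => f z) (fst z) _. set J2 := CInt (fun _ => f z) (snd z) _.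
  replace (I1 + Ci * I2 - (J1 + Ci * J2))%C with ((I1 - J1) + Ci * (I2 - J2))%C by ring.
  have hc : forall x, Rcont (fun x => f (x, snd z)) x by move=> x; exact: hline_cont.
  have vc : forall x, Rcont (fun y => f (fst w, y)) x by move=> x; exact: vline_cont.
  rewrite -(CInt_minus _ _ _ _ (fun x _ => hc x) (fun x _ => kc x)).
  rewrite -(CInt_minus _ _ _ _ (fun x _ => vc x) (fun x _ => kc x)).
  have D1 := Rabs_fst_le_Cmod (w - z). have D2 := Rabs_snd_le_Cmod (w - z). simpl in D1, D2.
  replace (fst w + - fst z) with (fst w - fst z) in D1 by ring.
  replace (snd w + - snd z) with (snd w - snd z) in D2 by ring.
  have between : forall u v s, Rmin u v <= s <= Rmax u v -> Rabs (s - u) <= Rabs (v - u).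
  { move=> u v s. rewrite /Rmin /Rmax /Rabs. case: Rle_dec => ?; case: Rcase_abs => ?; case: Rcase_abs => ?; lra. }
  have B1 : Cmod (CInt (fun x => f (x, snd z) - f z)%C (fst z) (fst w)) <= Rabs (fst w - fst z) * (eps / 2).
  { apply: CInt_norm_le_abs.
    - move=> x. exact: Ccont_minus.
    - move=> x Hx. apply: Rlt_le. apply: HH. apply: Rle_lt_trans (Cmod_Re_Im _) _. simpl.
      replace (snd z + - snd z) with 0 by ring. rewrite Rabs_R0.
      have := between _ _ _ Hx. rewrite /Rminus in D1 D2 *. lra. }
  have B2 : Cmod (CInt (fun y => f (fst w, y) - f z)%C (snd z) (snd w)) <= Rabs (snd w - snd z) * (eps / 2).
  { apply: CInt_norm_le_abs.
    - move=> x. exact: Ccont_minus.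
    - move=> x Hx. apply: Rlt_le. apply: HH. apply: Rle_lt_trans (Cmod_Re_Im _) _. simpl.
      have := between _ _ _ Hx. rewrite /Rminus in D1 D2 *. lra. }
  apply: Rle_trans (Cmod_triangle _ _) _. rewrite Cmod_mult Cmod_Ci.
  have : Rabs (fst w - fst z) * (eps / 2) <= Cmod (w - z) * (eps / 2) by apply: Rmult_le_compat_r; lra.
  have : Rabs (snd w - snd z) * (eps / 2) <= Cmod (w - z) * (eps / 2) by apply: Rmult_le_compat_r; lra.
  move=> X Y. apply: Rle_trans (Rplus_le_compat _ _ _ _ B1 (Rmult_le_compat_l 1 _ _ Rle_0_1 B2)) _. lra.
Qed.

(** * Cauchy integrals and their derivatives *)

Lemma Rcont_bounded (f : R -> C) (a b : R) : a <= b -> (forall x, Rcont f x) ->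
  exists M, 0 <= M /\ forall x, a <= x <= b -> Cmod (f x) <= M.
Proof.
  move=> Hab H.
  have [x [Hx _]] := continuity_ab_maj (fun x => Cmod (f x)) a b Hab
    (fun c _ => proj2 (continuity_pt_filterlim _ c) (Ccont_Cmod f c (H c))).
  exists (Cmod (f x)). split; [exact: Cmod_ge_0 | exact: Hx].
Qed.

(* Integration against a kernel that is differentiable in the parameter, uniformly on the curve. *)
Lemma kernel_deriv (phi : R -> C) (q dq : R -> C -> C) (w : C) (d K : R) :
  0 < d -> (forall th, Rcont phi th) ->
  (forall v th, Cmod (v - w) < d -> Rcont (fun t => q t v) th) -> (forall th, Rcont (fun t => dq t w) th) ->
  (forall th v, Cmod (v - w) < d -> Cmod (q th v - q th w - dq th w * (v - w)) <= K * (Cmod (v - w)) ^ 2) ->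
  is_Cderiv (fun v => CInt (fun t => phi t * q t v)%C 0 (2 * PI)) w (CInt (fun t => phi t * dq t w)%C 0 (2 * PI)).
Proof.
  move=> Hd Hphi Hq Hdq HK eps He.
  have P2 := two_PI_pos.
  have [M [HM0 HM]] := Rcont_bounded phi 0 (2 * PI) (Rlt_le _ _ P2) Hphi.
  set B := 2 * PI * (M * Rabs K) + 1.
  have HB0 : 0 <= 2 * PI * (M * Rabs K).
  { apply: Rmult_le_pos; first lra. apply: Rmult_le_pos => //. exact: Rabs_pos. }
  have HB : 0 < B by rewrite /B; lra.
  have Hr : 0 < eps / B by apply: Rdiv_lt_0_compat.
  apply/locally_C_iff. exists (Rmin d (eps / B)). split; first by apply: Rmin_glb_lt.
  move=> v Hv.
  have Hv1 : Cmod (v - w) < d by apply: Rlt_le_trans Hv _; exact: Rmin_l.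
  have Hv2 : Cmod (v - w) < eps / B by apply: Rlt_le_trans Hv _; exact: Rmin_r.
  have Hww : Cmod (w - w) < d by replace (w - w)%C with (RtoC 0) by ring; rewrite Cmod_0.
  set h := Cmod (v - w) in Hv1 Hv2 *. have Hh : 0 <= h by exact: Cmod_ge_0.
  have c1 : cont_on 0 (2 * PI) (fun t => phi t * q t v)%C by move=> x _; apply: Ccont_mult => //; exact: Hq.
  have c2 : cont_on 0 (2 * PI) (fun t => phi t * q t w)%C by move=> x _; apply: Ccont_mult => //; exact: Hq.
  have c3 : cont_on 0 (2 * PI) (fun t => phi t * dq t w)%C by move=> x _; apply: Ccont_mult.
  have c4 : cont_on 0 (2 * PI) (fun t => (v - w) * (phi t * dq t w))%C.
  { move=> x Hx. apply: Ccont_mult; [exact: Ccont_const | exact: c3]. }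
  have c5 : cont_on 0 (2 * PI) (fun t => phi t * q t v - phi t * q t w)%C.
  { move=> x Hx. apply: Ccont_minus; [exact: c1 | exact: c2]. }
  rewrite -(CInt_minus _ _ _ _ c1 c2) (Cmult_comm (CInt _ _ _)) -(CInt_Cscal _ _ _ _ c3) -(CInt_minus _ _ _ _ c5 c4).
  apply: Rle_trans (_ : (2 * PI - 0) * (M * (Rabs K * h ^ 2)) <= _).
  - apply: CInt_norm_le.
    + lra.
    + move=> x Hx. apply: Ccont_minus; first by apply: Ccont_minus; [exact: c1 | exact: c2].
      apply: Ccont_mult; [exact: Ccont_const | exact: c3].
    + move=> x Hx.
      replace (phi x * q x v - phi x * q x w - (v - w) * (phi x * dq x w))%C
        with (phi x * (q x v - q x w - dq x w * (v - w)))%C by ring.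
      rewrite Cmod_mult. apply: Rmult_le_compat; try exact: Cmod_ge_0; first exact: HM.
      apply: Rle_trans (HK x v Hv1) _. apply: Rmult_le_compat_r; [exact: pow2_ge_0 | exact: Rle_abs].
  - have X : h * B <= eps.
    { apply: Rle_trans (Rmult_le_compat_r _ _ _ (Rlt_le _ _ HB) (Rlt_le _ _ Hv2)) _. apply: Req_le. field. lra. }
    replace ((2 * PI - 0) * (M * (Rabs K * h ^ 2))) with ((h * (2 * PI * (M * Rabs K))) * h) by ring.
    apply: Rmult_le_compat_r => //. apply: Rle_trans X. apply: Rmult_le_compat_l => //. rewrite /B; lra.
Qed.

Lemma Cinv_le (u : C) (d : R) : 0 < d -> d <= Cmod u -> Cmod (/ u) <= / d.
Proof.
  move=> Hd Hu. have Hu0 : u <> 0 by apply/Cmod_gt_0; lra.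
  rewrite Cmod_inv //. exact: Rinv_le_contravar.
Qed.

Lemma Cpow_inv_le (u : C) (d : R) n : 0 < d -> d <= Cmod u -> Cmod (/ u ^ n) <= (/ d) ^ n.
Proof.
  move=> Hd Hu. have Hu0 : u <> 0 by apply/Cmod_gt_0; lra.
  rewrite -Cpow_inv // Cmod_pow. apply: pow_incr. split; [exact: Cmod_ge_0 | exact: Cinv_le].
Qed.

(* Second-order error of [h |-> 1/(u-h)^n] at [h = 0], by induction on [n]. *)
Lemma inv_pow_taylor (u h : C) (d : R) (n : nat) : 0 < d -> 2 * d <= Cmod u -> Cmod h <= d ->
  Cmod (/ (u - h) ^ n - / u ^ n - RtoC (INR n) * (h * / u ^ S n)) <= INR n * INR n * (/ d) ^ (n + 2) * Cmod h ^ 2.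
Proof.
  move=> Hd Hu Hh.
  have Hu' : d <= Cmod (u - h) by have := Cmod_triangle_sub u h; lra.
  have Hud : d <= Cmod u by lra.
  have u0 : u <> 0 by apply/Cmod_gt_0; lra.
  have uh0 : (u - h)%C <> 0 by apply/Cmod_gt_0; lra.
  have Hi : 0 < / d by exact: Rinv_0_lt_compat.
  have hp := pow2_ge_0 (Cmod h).
  elim: n => [|n IH].
  - simpl. replace (/ 1 - / 1 - RtoC 0 * (h * / (u * 1)))%C with (RtoC 0) by ring. rewrite Cmod_0. nra.
  - have un0 : (u ^ n)%C <> 0 by exact: Cpow_nz. have uhn0 : ((u - h) ^ n)%C <> 0 by exact: Cpow_nz.
    set En := (/ (u - h) ^ n - / u ^ n - RtoC (INR n) * (h * / u ^ S n))%C in IH.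
    have E : (/ (u - h) ^ S n - / u ^ S n - RtoC (INR (S n)) * (h * / u ^ S (S n)))%C =
      (/ (u - h) ^ 1 * En + (/ u ^ (n + 2) * / (u - h) ^ 1 * h ^ 2 + RtoC (INR n) * (/ u ^ (n + 2) * / (u - h) ^ 1 * h ^ 2)))%C.
    { rewrite /En S_INR RtoC_plus Cpow_add_r !Cpow_S. simpl. field. repeat split => //. }
    rewrite E.
    have Ehh : Cmod (h ^ 2)%C = Cmod h ^ 2 by exact: Cmod_pow.
    move: Ehh. generalize (h ^ 2)%C => hh Ehh.
    have T1 := Cmod_triangle (/ (u - h) ^ 1 * En) (/ u ^ (n + 2) * / (u - h) ^ 1 * hh + RtoC (INR n) * (/ u ^ (n + 2) * / (u - h) ^ 1 * hh)).
    have T2 := Cmod_triangle (/ u ^ (n + 2) * / (u - h) ^ 1 * hh) (RtoC (INR n) * (/ u ^ (n + 2) * / (u - h) ^ 1 * hh)).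
    have B1 := Cpow_inv_le (u - h) d 1 Hd Hu'. have B2 := Cpow_inv_le u d (n + 2) Hd Hud.
    rewrite !Cmod_mult ?Ehh in T1 T2.
    have HRn : Cmod (RtoC (INR n)) = INR n by apply: Cmod_RtoC_pos; exact: pos_INR.
    rewrite HRn in T2.
    have Xn := pos_INR n.
    have Q : Cmod (/ u ^ (n + 2)) * Cmod (/ (u - h) ^ 1) * Cmod h ^ 2 <= (/ d) ^ (n + 2) * (/ d) ^ 1 * Cmod h ^ 2.
    { apply: Rmult_le_compat_r => //. apply: Rmult_le_compat => //; exact: Cmod_ge_0. }
    have W : Cmod (/ (u - h) ^ 1) * Cmod En <= (/ d) ^ 1 * (INR n * INR n * (/ d) ^ (n + 2) * Cmod h ^ 2).
    { apply: Rmult_le_compat => //; exact: Cmod_ge_0. }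
    set Y := (/ d) ^ (n + 2) * (/ d) ^ 1 * Cmod h ^ 2 in Q.
    have HY : 0 <= Y by apply: Rmult_le_pos => //; apply: Rmult_le_pos; apply: pow_le; lra.
    replace ((/ d) ^ 1 * (INR n * INR n * (/ d) ^ (n + 2) * Cmod h ^ 2)) with (INR n * INR n * Y) in W by (rewrite /Y; ring).
    replace ((/ d) ^ (S n + 2)) with ((/ d) ^ (n + 2) * (/ d) ^ 1) by (simpl; ring).
    replace (INR (S n) * INR (S n) * ((/ d) ^ (n + 2) * (/ d) ^ 1) * Cmod h ^ 2) with (INR (S n) * INR (S n) * Y) by (rewrite /Y; ring).
    rewrite S_INR.
    have Q2 := Rmult_le_compat_l _ _ _ Xn Q.
    nra.
Qed.

Definition circle (c : C) (r : R) (th : R) : C := (c + RtoC r * cis th)%C.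
Definition dcircle (r : R) (th : R) : C := (RtoC r * (Ci * cis th))%C.

Lemma circle_curve (c : C) (r : R) : closed_curve (circle c r) (dcircle r).
Proof.
  split.
  - move=> th. have := deriv_plus _ _ _ _ _ _ (deriv_const RtoC c th) (deriv_scal RtoC (RtoC r) _ _ _ (cis_deriv th)).
    rewrite Cplus_0_l. by [].
  - move=> th. apply: Ccont_mult; first exact: Ccont_const.
    apply: Ccont_mult; [exact: Ccont_const | exact: cis_cont].
  - by rewrite /circle cis_2PI.
Qed.

Lemma Cmod_circle c r th : 0 <= r -> Cmod (circle c r th - c) = r.
Proof.
  move=> Hr. replace (circle c r th - c)%C with (RtoC r * cis th)%C by (rewrite /circle; ring).
  rewrite Cmod_mult Cmod_cis Cmod_RtoC_pos //. ring.
Qed.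

Lemma circle_winding (r : R) (w : C) : Cmod w < r ->
  CInt (fun th => dcircle r th / (circle 0 r th - w))%C 0 (2 * PI) = (2 * PI * Ci)%C.
Proof.
  move=> Hw. have Hr : 0 < r by have := Cmod_ge_0 w; lra.
  rewrite (winding_move _ _ (circle_curve 0 r)).
  - rewrite -(winding_polar (fun _ => r) (fun _ => 0)) //.
    + apply: CInt_ext => th _. rewrite /circle /dcircle.
      replace (0 + RtoC r * cis th)%C with (RtoC r * cis th)%C by ring.
      f_equal. ring.
    + move=> th. exact: (is_derive_const (V := R_NormedModule)).
    + move=> th. exact: continuous_const.
  - move=> s th Hs E.
    have := Cmod_circle 0 r th (Rlt_le _ _ Hr).
    replace (circle 0 r th - 0)%C with (circle 0 r th) by ring.
    rewrite E Cmod_mult Cmod_RtoC_pos; last lra. have := Cmod_ge_0 w. nra.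
Qed.

Lemma two_PI_Ci_neq_0 : (2 * PI * Ci)%C <> 0.
Proof.
  have HP := PI_RGT_0.
  apply: Cmult_neq_0; last exact: Ci_nz. apply: Cmult_neq_0 => /RtoC_inj; lra.
Qed.

Lemma circle_kernel_deriv (phi : R -> C) (r : R) (w : C) (n : nat) : Cmod w < r -> (forall th, Rcont phi th) ->
  is_Cderiv (fun v => CInt (fun th => phi th * / (circle 0 r th - v) ^ n)%C 0 (2 * PI)) w
    (RtoC (INR n) * CInt (fun th => phi th * / (circle 0 r th - w) ^ S n)%C 0 (2 * PI))%C.
Proof.
  move=> Hw Hphi.
  (* Half the gap between [w] and the circle: points within [d] of [w] keep the distance [d] from
     the circle. *)
  set d := (r - Cmod w) / 2. have Hd : 0 < d by rewrite /d; lra.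
  have Hr : 0 <= r by have := Cmod_ge_0 w; lra.
  have far : forall th, 2 * d <= Cmod (circle 0 r th - w).
  { move=> th. have := Cmod_triangle_sub (circle 0 r th) w.
    have := Cmod_circle 0 r th Hr. replace (circle 0 r th - 0)%C with (circle 0 r th) by ring.
    rewrite /d. lra. }
  have cc := cc_gcont _ _ (circle_curve 0 r).
  have kc : forall v m th, Cmod (v - w) < d -> Rcont (fun t => / (circle 0 r t - v) ^ m)%C th.
  { move=> v m th Hv. apply: Ccont_inv.
    - apply: Cpow_nz. apply/Cmod_gt_0. have := far th. have := Cmod_triangle3 (circle 0 r th) v w. lra.
    - apply: Ccont_pow. apply: Ccont_minus; [exact: cc | exact: Ccont_const]. }
  have Hww : Cmod (w - w) < d by replace (w - w)%C with (RtoC 0) by ring; rewrite Cmod_0.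
  rewrite -CInt_Cscal; last by move=> x _; apply: Ccont_mult => //; exact: kc.
  have K := kernel_deriv phi (fun th v => / (circle 0 r th - v) ^ n)%C
     (fun th v => RtoC (INR n) * / (circle 0 r th - v) ^ S n)%C w d (INR n * INR n * (/ d) ^ (n + 2)) Hd Hphi.
  rewrite (CInt_ext _ (fun t => phi t * (RtoC (INR n) * / (circle 0 r t - w) ^ S n))%C); last by move=> x _; ring.
  apply: K.
  - move=> v th Hv. exact: kc.
  - move=> th. apply: Ccont_mult; [exact: Ccont_const | exact: kc].
  - move=> th v Hv.
    have := inv_pow_taylor (circle 0 r th - w) (v - w) d n Hd (far th) (Rlt_le _ _ Hv).
    replace (circle 0 r th - w - (v - w))%C with (circle 0 r th - v)%C by ring.
    replace (RtoC (INR n) * ((v - w) * / (circle 0 r th - w) ^ S n))%C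
      with (RtoC (INR n) * / (circle 0 r th - w) ^ S n * (v - w))%C by ring. by [].
Qed.

Lemma Cderiv_unique (f : C -> C) z l m : is_Cderiv f z l -> is_Cderiv f z m -> l = m.
Proof. move=> /is_Cderiv_C_derive <- /is_Cderiv_C_derive <-. by []. Qed.

Lemma locally_lt_Cmod (z : C) (r : R) : Cmod z < r -> locally (T := C_UniformSpace) z (fun v => Cmod v < r).
Proof.
  move=> Hz. apply/locally_C_iff. exists (r - Cmod z). split; first lra.
  move=> v Hv. have := Cmod_triangle_sub v z. lra.
Qed.

(* A primitive of [f] is C^1, so Cauchy's formula applies to it; differentiating the formula
   three times shows that the derivative of [f] is differentiable. *)
Theorem entire_C_derive (f : C -> C) : entire f -> entire (C_derive f).
Proof.
  move=> Hf.
  have fc : forall z, Ccont f z by move=> z; exact: entire_continuous.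
  have [F HF] := morera f fc (fun a b c d => goursat f a b c d Hf).
  have Fc : forall z, Ccont F z by move=> z; exact: Cderiv_continuous (HF z).
  move=> z. apply: ex_intro _. apply/is_Cderiv_iff.
  set r := Cmod z + 1. have Hz : Cmod z < r by rewrite /r; lra.
  have cc := cc_gcont _ _ (circle_curve 0 r).
  pose phi := fun th => (/ (2 * PI * Ci) * (F (circle 0 r th) * dcircle r th))%C.
  have Hphi : forall th, Rcont phi th.
  { move=> th. apply: Ccont_mult; first exact: Ccont_const. apply: Ccont_mult; last exact: (cc_cont _ _ (circle_curve 0 r)).
    apply: (continuous_comp (V := C_UniformSpace) (circle 0 r) F); [exact: cc | exact: Fc]. }
  pose K := fun n v => CInt (fun th => phi th * / (circle 0 r th - v) ^ n)%C 0 (2 * PI).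
  have KD : forall n v, Cmod v < r -> is_Cderiv (K n) v (RtoC (INR n) * K (S n) v)%C.
  { move=> n v Hv. exact: circle_kernel_deriv. }
  have FK : forall v, Cmod v < r -> F v = K 1%nat v.
  { move=> v Hv. have Hne : forall th, circle 0 r th <> v.
    { move=> th E. have := Cmod_circle 0 r th. replace (circle 0 r th - 0)%C with (circle 0 r th) by ring.
      rewrite E. have := Cmod_ge_0 v. lra. }
    have := cauchy_C1 _ _ (circle_curve 0 r) F f v HF fc Hne. rewrite circle_winding // => E.
    have N := two_PI_Ci_neq_0.
    replace (F v) with (/ (2 * PI * Ci) * (F v * (2 * PI * Ci)))%C by (field; move: N; rewrite /not => N' ; repeat split; move=> E'; apply: N'; rewrite E'; ring).
    rewrite -E -CInt_Cscal.
    - apply: CInt_ext => th _. rewrite /phi /= Cmult_1_r /Cdiv. ring.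
    - move=> th _. apply: Ccont_mult.
      + apply: (continuous_comp (V := C_UniformSpace) (circle 0 r) F); [exact: cc | exact: Fc].
      + apply: Ccont_div; [exact: Cminus_eq_contra | exact: (cc_cont _ _ (circle_curve 0 r)) |].
        apply: Ccont_minus; [exact: cc | exact: Ccont_const]. }
  have fK : forall v, Cmod v < r -> f v = K 2%nat v.
  { move=> v Hv. apply: (Cderiv_unique F v); first exact: HF.
    apply: (deriv_ext_loc _ (K 1%nat)).
    - apply: locally_imp (locally_lt_Cmod v r Hv) _ => u Hu. by rewrite FK.
    - have := KD 1%nat v Hv. by rewrite /= Cmult_1_l. }
  have f'K : forall v, Cmod v < r -> C_derive f v = (RtoC (INR 2) * K 3%nat v)%C.
  { move=> v Hv. apply: is_Cderiv_C_derive. apply: (deriv_ext_loc _ (K 2%nat)); last exact: KD.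
    apply: locally_imp (locally_lt_Cmod v r Hv) _ => u Hu. by rewrite fK. }
  apply: (deriv_ext_loc _ (fun v => RtoC (INR 2) * K 3%nat v)%C).
  - apply: locally_imp (locally_lt_Cmod z r Hz) _ => u Hu. by rewrite f'K.
  - apply: deriv_scal. exact: KD.
Qed.

Lemma entire_C_derive_cont (f : C -> C) z : entire f -> Ccont (C_derive f) z.
Proof. move=> Hf. apply: entire_continuous. exact: entire_C_derive. Qed.

Lemma Cmod_eq_dist0 (z : C) : Cmod (z - z) = 0.
Proof. replace (z - z)%C with (RtoC 0) by ring. exact: Cmod_0. Qed.

(* The divided difference; its derivative at [p] is [f''(p)/2]. *)
Theorem entire_divide (f : C -> C) (p : C) : entire f -> f p = 0 ->
  exists q : C -> C, entire q /\ (forall z, f z = (z - p) * q z)%C /\ q p = C_derive f p.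
Proof.
  move=> Hf Hp.
  have fD := proj1 (entire_Cderiv f) Hf.
  have f'D := proj1 (entire_Cderiv _) (entire_C_derive f Hf).
  have f'c : forall z, Ccont (C_derive f) z by move=> z; exact: entire_C_derive_cont.
  pose q := fun z => match Ceq_dec z p with left _ => C_derive f p | right _ => (f z / (z - p))%C end.
  have qp : q p = C_derive f p by rewrite /q; case: Ceq_dec.
  have qz : forall z, z <> p -> q z = (f z / (z - p))%C by move=> z Hz; rewrite /q; case: Ceq_dec.
  exists q. split; last split => //.
  - move=> z. case: (Ceq_dec z p) => [->|Hz].
    + set m := C_derive (C_derive f) p.
      exists (m / 2)%C. apply/is_Cderiv_iff => eps He.
      have /locally_C_iff [d [Hd HH]] := f'D p eps He.
      apply/locally_C_iff. exists d. split => // v Hv.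
      case: (Ceq_dec v p) => [->|Hvp].
      { rewrite Cmod_eq_dist0. replace (q p - q p - m / 2 * (p - p))%C with (RtoC 0) by ring. rewrite Cmod_0. lra. }
      have Hvp' : (v - p)%C <> 0 by exact: Cminus_eq_contra.
      have Hm : 0 < Cmod (v - p) by exact: Cmod_sub_pos.
      rewrite qp qz //.
      (* [G] is the second-order Taylor expression of [f] along the segment from [p] to [v].
         Differentiability of the derivative at [p] bounds [dG] by [eps * |v - p| ^ 2]; dividing by
         [v - p] leaves the first-order error required of [q]. *)
      pose G := fun s : R => (f (p + RtoC s * (v - p)) - C_derive f p * (RtoC s * (v - p)) - m / 2 * ((RtoC s * (v - p)) * (RtoC s * (v - p))))%C.
      pose dG := fun s : R => ((C_derive f (p + RtoC s * (v - p)) - C_derive f p - m * (RtoC s * (v - p))) * (v - p))%C.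
      have lin : forall s : R, is_curve_deriv (fun s => RtoC s * (v - p))%C s (v - p)%C.
      { move=> s. have := deriv_mult _ RtoC_continuous _ _ _ _ _ (deriv_self RtoC s) (deriv_const RtoC (v - p)%C s).
        replace (1 * (v - p) + RtoC s * 0)%C with (v - p)%C by ring. by []. }
      have arg : forall s : R, is_curve_deriv (fun s => p + RtoC s * (v - p))%C s (v - p)%C.
      { move=> s. have := deriv_plus _ _ _ _ _ _ (deriv_const RtoC p s) (lin s). by rewrite Cplus_0_l. }
      have GD : forall s, is_curve_deriv G s (dG s).
      { move=> s.
        have D := deriv_minus _ _ _ _ _ _ (deriv_minus _ _ _ _ _ _ (deriv_comp RtoC f _ _ _ _ (fD _) (curve_deriv_continuous _ _ _ (arg s)) (arg s))
           (deriv_scal _ (C_derive f p) _ _ _ (lin s))) (deriv_scal _ (m / 2)%C _ _ _ (deriv_mult _ RtoC_continuous _ _ _ _ _ (lin s) (lin s))).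
        match type of D with deriv_along _ _ _ ?x => replace (dG s) with x; first exact: D end.
        rewrite /dG. field. }
      have dGc : forall s, Rcont dG s.
      { move=> s. apply: Ccont_mult; last exact: Ccont_const. apply: Ccont_minus.
        - apply: Ccont_minus; last exact: Ccont_const.
          apply: (continuous_comp (V := C_UniformSpace) (fun s => p + RtoC s * (v - p))%C) => //.
          exact: curve_deriv_continuous (arg s).
        - apply: Ccont_mult; first exact: Ccont_const. exact: curve_deriv_continuous (lin s). }
      have I := CInt_FTC 0 1 G dG (fun s _ => GD s) (fun s _ => dGc s).
      have B : Cmod (CInt dG 0 1) <= (1 - 0) * (eps * Cmod (v - p) * Cmod (v - p)).
      { apply: CInt_norm_le; [lra | by move=> s _ | move=> s Hs].
        rewrite /dG Cmod_mult. apply: Rmult_le_compat_r; first lra.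
        have E : (RtoC s * (v - p))%C = ((p + RtoC s * (v - p)) - p)%C by ring.
        have M : Cmod ((p + RtoC s * (v - p)) - p) <= Cmod (v - p).
        { rewrite -E Cmod_mult Cmod_RtoC_pos; last lra. nra. }
        rewrite {2}E. apply: Rle_trans (HH _ (Rle_lt_trans _ _ _ M Hv)) _.
        apply: Rmult_le_compat_l => //. lra. }
      have E : (f v / (v - p) - C_derive f p - m / 2 * (v - p))%C = (CInt dG 0 1 / (v - p))%C.
      { rewrite I /G.
        replace (p + 1 * (v - p))%C with v by ring. replace (p + 0 * (v - p))%C with p by ring.
        rewrite Hp. field. exact: Hvp'. }
      rewrite E Cmod_div //. apply/(Rle_div_l _ _ _ Hm). lra.
    + have Hz' : (z - p)%C <> 0 by exact: Cminus_eq_contra.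
      have D1 := deriv_minus _ _ _ _ _ _ (deriv_self (fun z : C_UniformSpace => z) z) (deriv_const (fun z : C_UniformSpace => z) p z).
      have D2 := deriv_comp (fun z : C_UniformSpace => z) Cinv (fun v : C_UniformSpace => v - p)%C z _ _ (Cderiv_inv _ Hz') (Cderiv_continuous _ _ _ D1) D1.
      have D3 := deriv_mult _ id_continuous_C _ _ _ _ _ (fD z) D2.
      eexists. apply/is_Cderiv_iff. apply: (deriv_ext_loc _ _ q) D3.
      apply/locally_C_iff. exists (Cmod (z - p)). split; first exact: Cmod_sub_pos.
      move=> v Hv. rewrite qz // => E. move: Hv. rewrite E Cmod_sub_sym. lra.
  - move=> z. case: (Ceq_dec z p) => [->|Hz].
    + rewrite Hp. ring.
    + rewrite qz //. field. exact: Cminus_eq_contra.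
Qed.

(** Uniform limits on discs keep continuity and vanishing rectangle integrals, so Morera provides a
    primitive; the limit is then the derivative of an entire function. *)
Theorem entire_unif_limit (fn : nat -> C -> C) (f : C -> C) :
  (forall n, entire (fn n)) ->
  (forall B eps, 0 < eps -> exists n, forall z, Cmod z <= B -> Cmod (fn n z - f z) <= eps) -> entire f.
Proof.
  move=> He Hu.
  have fc : forall z, Ccont f z.
  { move=> z. apply/continuous_C_iff => eps Heps.
    have [n Hn] := Hu (Cmod z + 1) (eps / 4) ltac:(lra).
    have /continuous_C_iff Hc := entire_continuous _ z (He n).
    have He4 : 0 < eps / 4 by lra.
    apply: locally_imp2 (locally_lt_Cmod z (Cmod z + 1) ltac:(lra)) (Hc _ He4) _ => v Hv Hv2.
    have A := Hn v (Rlt_le _ _ Hv). have B := Hn z ltac:(lra).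
    have T1 := Cmod_triangle3 (f v) (fn n v) (f z). have T2 := Cmod_triangle3 (fn n v) (fn n z) (f z).
    rewrite (Cmod_sub_sym (f v) (fn n v)) in T1. lra. }
  have R0 : forall a b c d, rect_int f a b c d = 0.
  { move=> a b c d. apply: Cmod_eq_0.
    case: (Req_dec (Cmod (rect_int f a b c d)) 0) => // Hne.
    have Hp : 0 < Cmod (rect_int f a b c d) by have := Cmod_ge_0 (rect_int f a b c d); lra.
    set L := 2 * (Rabs (b - a) + Rabs (d - c)).
    have HL : 0 <= L by rewrite /L; have := Rabs_pos (b - a); have := Rabs_pos (d - c); lra.
    set eps := Cmod (rect_int f a b c d) / (2 * (L + 1)).
    have Heps : 0 < eps by apply: Rdiv_lt_0_compat; lra.
    set B := Rmax (Rabs a) (Rabs b) + Rmax (Rabs c) (Rabs d).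
    have [n Hn] := Hu B eps Heps.
    have E : rect_int f a b c d = (- rect_int (fun z => fn n z - f z) a b c d)%C.
    { rewrite rect_int_minus //; last by move=> z; exact: entire_continuous.
      rewrite (goursat (fn n)) //. ring. }
    have M : Cmod (rect_int (fun z => fn n z - f z)%C a b c d) <= L * eps.
    { apply: rect_int_norm_le.
      - move=> z. apply: Ccont_minus => //. exact: entire_continuous.
      - move=> x y Hx Hy. apply: Hn. apply: Rle_trans (Cmod_Re_Im _) _. rewrite /B /=.
        have bnd : forall u v s, Rmin u v <= s <= Rmax u v -> Rabs s <= Rmax (Rabs u) (Rabs v).
        { move=> u v s [S1 S2]. set X := Rmax (Rabs u) (Rabs v).
          have /Rabs_le_between U := Rmax_l (Rabs u) (Rabs v : R). have /Rabs_le_between V := Rmax_r (Rabs u) (Rabs v).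
          apply: Rabs_le. split.
          - apply: Rle_trans S1. apply: Rmin_glb; [exact: (proj1 U) | exact: (proj1 V)].
          - apply: Rle_trans S2 _. apply: Rmax_lub; [exact: (proj2 U) | exact: (proj2 V)]. }
        have := bnd _ _ _ Hx. have := bnd _ _ _ Hy. lra. }
    rewrite -Cmod_opp -E in M.
    have X : eps * (2 * (L + 1)) = Cmod (rect_int f a b c d) by rewrite /eps; field; lra.
    nra. }
  have [P HP] := morera f fc R0.
  have PE : entire P by exact: entire_intro HP.
  move=> z. have D := proj1 (entire_Cderiv _) (entire_C_derive P PE) z.
  eexists. apply/is_Cderiv_iff. apply: (deriv_ext _ _ f) D => v. exact: is_Cderiv_C_derive.
Qed.

(** * The radius function of a doubling weight *)

Lemma RInt_param_continuous (k : R -> R -> R) (a b : R) : a <= b ->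
  (forall x u, continuity_2d_pt k x u) -> forall x, continuous (fun x => RInt (k x) a b) x.
Proof.
  move=> Hab Hk x0.
  have kc : forall x u, continuous (k x) u.
  { move=> x u. apply/continuity_pt_filterlim.
    move=> eps He. have [d Hd] := Hk x u (mkposreal eps He).
    exists d. split; first exact: cond_pos. move=> v [_ Hv]. apply: Hd => //.
    rewrite Rminus_diag Rabs_R0. exact: cond_pos. }
  have ki : forall x, ex_RInt (k x) a b.
  { move=> x. apply: (ex_RInt_continuous (V := R_CompleteNormedModule)) => u _. exact: kc. }
  apply/filterlim_locally => eps.
  have Hp : 0 < eps / (b - a + 1) by apply: Rdiv_lt_0_compat; [exact: cond_pos | lra].
  have [d Hd] := uniform_continuity_2d_1d' k a b x0 (fun u _ => Hk x0 u) (mkposreal _ Hp).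
  exists d => x Hx. rewrite /ball /= /AbsRing_ball /abs /minus /plus /opp /=.
  have Hx' : Rabs (x - x0) < d := Hx.
  replace (RInt (k x) a b + - RInt (k x0) a b) with (RInt (fun u => minus (k x u) (k x0 u)) a b);
    last by rewrite (RInt_minus (V := R_CompleteNormedModule)).
  apply: Rle_lt_trans (_ : (b - a) * (eps / (b - a + 1)) < eps).
  - apply: (norm_RInt_le_const (V := R_NormedModule) (fun u => minus (k x u) (k x0 u)) a b) => //.
    + move=> u Hu. apply: Rlt_le. apply: (Hd u x0 u x) => //.
      * have := cond_pos d. lra.
      * move/Rabs_lt_between: Hx'. lra.
      * rewrite Rminus_diag Rabs_R0. exact: cond_pos.
    + apply: (RInt_correct (V := R_CompleteNormedModule)). exact: (ex_RInt_minus (V := R_NormedModule)).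
  - have := cond_pos eps. move=> He.
    replace (pos eps) with ((b - a + 1) * (eps / (b - a + 1))) at 2 by (field; lra). nra.
Qed.

Lemma RInt_mono_interval (f : R -> R) (a b a' b' : R) :
  (forall x, continuous f x) -> (forall x, 0 <= f x) -> a' <= a -> a <= b -> b <= b' ->
  RInt f a b <= RInt f a' b'.
Proof.
  move=> Hc H0 H1 H2 H3.
  have ex : forall u v, ex_RInt f u v.
  { move=> u v. exact: (ex_RInt_continuous (V := R_CompleteNormedModule)). }
  rewrite -(RInt_Chasles (V := R_CompleteNormedModule) f a' a b') // -(RInt_Chasles (V := R_CompleteNormedModule) f a b b') //.
  rewrite /plus /=.
  have P1 : 0 <= RInt f a' a by apply: RInt_ge_0.
  have P2 : 0 <= RInt f b b' by apply: RInt_ge_0.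
  lra.
Qed.

Section Radius.
Variables (phi rho : C -> R).
Hypothesis phi_smooth : smooth phi.
Hypothesis phi_doubling : doubling phi.
Hypothesis rho_radius : is_radius phi rho.

Let L := Laplacian phi.

Lemma Laplacian_cont z : continuous (T := C_UniformSpace) L z.
Proof.
  have [_ [_ [_ [[_ [_ [_ [[Hx _] _]]]] [_ [_ [_ [_ [Hy _]]]]]]]]] := phi_smooth 2%nat.
  apply: (continuous_plus (V := R_NormedModule)); [exact: Hx | exact: Hy].
Qed.

Definition half_chord (z : C) (r x : R) : R := sqrt (r ^ 2 - (x - fst z) ^ 2).
Definition slice (z : C) (r x : R) : R :=
  RInt (fun y => L (x, y)) (snd z - half_chord z r x) (snd z + half_chord z r x).

Lemma disc_mass_slice z r : disc_mass phi z r = RInt (slice z r) (fst z - r) (fst z + r).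
Proof. by []. Qed.

Lemma vert_cont x y : continuous (fun y => L (x, y)) y.
Proof.
  apply: (continuous_comp (V := C_UniformSpace) (fun y : R => (x, y)) L); last exact: Laplacian_cont.
  apply: (Ccont_pair (U := R_UniformSpace) (fun _ => x) (fun y => y)); [exact: continuous_const | exact: continuous_id].
Qed.

Lemma vert_int x a b : ex_RInt (fun y => L (x, y)) a b.
Proof. apply: (ex_RInt_continuous (V := R_CompleteNormedModule)) => y _. exact: vert_cont. Qed.

Lemma half_chord_cont z r x : continuous (half_chord z r) x.
Proof.
  apply: (continuous_comp (fun x => r ^ 2 - (x - fst z) ^ 2) sqrt).
  - apply: (ex_derive_continuous (V := R_NormedModule)). auto_derive. by [].
  - exact: continuous_sqrt.
Qed.

Lemma slice_cont z r x : continuous (slice z r) x.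
Proof.
  set S := half_chord z r.
  (* Rescaling the chord to the fixed interval [-1,1] turns the variable end points into a parameter
     of the integrand; chords reduced to a point are included. *)
  pose k := fun x u => S x * L (x, S x * u + snd z).
  apply: (continuous_ext (fun x => RInt (k x) (-1) 1)).
  - move=> y. rewrite /k /slice -/S.
    have := RInt_comp_lin (V := R_CompleteNormedModule) (fun v => L (y, v)) (S y) (snd z) (-1) 1 (vert_int _ _ _).
    rewrite /scal /= /mult /= => ->. f_equal; ring.
  - apply: RInt_param_continuous; first lra.
    move=> y u. apply/continuity_2d_pt_filterlim.
    have SC : continuous (fun p : R * R => S (fst p)) (y, u).
    { apply: (continuous_comp (V := R_UniformSpace) (fun p : R * R => fst p) S); [exact: continuous_fst | exact: half_chord_cont]. }
    change (continuous (T := prod_UniformSpace R_UniformSpace R_UniformSpace) (U := AbsRing_UniformSpace R_AbsRing)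
      (fun p => mult (S (fst p)) (L (fst p, S (fst p) * snd p + snd z))) (y, u)).
    apply: (continuous_mult (K := R_AbsRing)) => //.
    apply: (continuous_comp (V := C_UniformSpace) (fun p : R * R => (fst p, S (fst p) * snd p + snd z)) L); last exact: Laplacian_cont.
    apply: Ccont_pair; first exact: continuous_fst.
    apply: (continuous_plus (V := R_NormedModule)); last exact: continuous_const.
    apply: (continuous_mult (K := R_AbsRing)); [exact: SC | exact: continuous_snd].
Qed.

Lemma slice_int z r a b : ex_RInt (slice z r) a b.
Proof. apply: (ex_RInt_continuous (V := R_CompleteNormedModule)) => y _. exact: slice_cont. Qed.

Lemma half_chord_pos z r x : fst z - r < x < fst z + r -> 0 < half_chord z r x.
Proof. move=> H. apply: sqrt_lt_R0. nra. Qed.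

Lemma half_chord_dist z r x y : snd z - half_chord z r x < y < snd z + half_chord z r x ->
  Cmod ((x, y) - z) < r \/ r <= 0.
Proof.
  move=> Hy. case: (Rle_lt_dec r 0) => Hr; [by right | left].
  have Hs : 0 <= half_chord z r x by exact: sqrt_pos.
  have Hr2 : 0 <= r ^ 2 - (x - fst z) ^ 2.
  { case: (Rle_lt_dec 0 (r ^ 2 - (x - fst z) ^ 2)) => // Hneg.
    have : half_chord z r x = 0 by apply: sqrt_neg_0; lra. lra. }
  have E : half_chord z r x * half_chord z r x = r ^ 2 - (x - fst z) ^ 2 by exact: sqrt_sqrt.
  have A : (y - snd z) * (y - snd z) < half_chord z r x * half_chord z r x.
  { set S := half_chord z r x in Hy Hs *. nra. }
  rewrite E in A. rewrite /Cmod /= -(sqrt_pow2 r); last lra.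
  have X := Rle_0_sqr (x - fst z). have Y := Rle_0_sqr (y - snd z). rewrite /Rsqr in X Y.
  apply: sqrt_lt_1; lra.
Qed.

Lemma mass_neg_double z r n : 0 < r -> disc_mass phi z r < 0 -> disc_mass phi z (2 ^ n * r) < 0.
Proof.
  move=> Hr H. have [K [HK HD]] := phi_doubling.
  elim: n => [|n IH]; first by rewrite /= Rmult_1_l.
  have P : 0 < 2 ^ n * r by apply: Rmult_lt_0_compat => //; apply: pow_lt; lra.
  have := HD z _ P. replace (2 * (2 ^ n * r)) with (2 ^ S n * r) by (simpl; ring). nra.
Qed.

Lemma mass_nonpos_double z r n : 0 < r -> disc_mass phi z r <= 0 -> disc_mass phi z (2 ^ n * r) <= 0.
Proof.
  move=> Hr H. have [K [HK HD]] := phi_doubling.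
  elim: n => [|n IH]; first by rewrite /= Rmult_1_l.
  have P : 0 < 2 ^ n * r by apply: Rmult_lt_0_compat => //; apply: pow_lt; lra.
  have := HD z _ P. replace (2 * (2 ^ n * r)) with (2 ^ S n * r) by (simpl; ring). nra.
Qed.

Lemma pow2_unbounded (x : R) : exists n, x < 2 ^ n.
Proof.
  have [n Hn] := Pow_x_infinity 2 ltac:(rewrite Rabs_pos_eq; lra) (x + 1).
  exists n. have := Hn n (Nat.le_refl _). rewrite Rabs_pos_eq; first lra. apply: pow_le. lra.
Qed.

(* Where the density is negative, small discs have negative mass, and doubling
   propagates the sign up to the radius [rho z]. *)
Lemma Laplacian_nonneg z : 0 <= L z.
Proof.
  case: (Rle_lt_dec 0 (L z)) => // Hneg. exfalso.
  have Hc := Laplacian_cont z.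
  have : locally (T := C_UniformSpace) z (fun w => L w < 0).
  { apply: (Hc (fun v => v < 0)). exact: open_lt. }
  move/locally_C_iff => [d [Hd HL]].
  have [Hr Hm] := rho_radius z.
  have [n Hn] := pow2_unbounded (rho z / d).
  have H2 : 0 < 2 ^ n by apply: pow_lt; lra.
  set r := rho z / 2 ^ n.
  have Hr0 : 0 < r by apply: Rdiv_lt_0_compat.
  have Hrd : r < d.
  { apply/(Rlt_div_l _ _ _ H2). move/(Rlt_div_l _ _ _ Hd): Hn. lra. }
  have Neg : disc_mass phi z r < 0.
  { rewrite disc_mass_slice.
    have : 0 < RInt (fun x => - slice z r x) (fst z - r) (fst z + r).
    { apply: RInt_gt_0; first lra.
      - move=> x Hx. have Hs := half_chord_pos z r x Hx.
        have : 0 < RInt (fun y => - L (x, y)) (snd z - half_chord z r x) (snd z + half_chord z r x).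
        { apply: RInt_gt_0; first lra.
          - move=> y Hy. case: (half_chord_dist z r x y Hy) => Hd2; last lra.
            have := HL (x, y) (Rlt_trans _ _ _ Hd2 Hrd). lra.
          - move=> y _. apply: (continuous_opp (V := R_NormedModule)). exact: vert_cont. }
        rewrite (RInt_opp (V := R_CompleteNormedModule)); last exact: vert_int. by [].
      - move=> x _. apply: (continuous_opp (V := R_NormedModule)). exact: slice_cont. }
    rewrite (RInt_opp (V := R_CompleteNormedModule)); last exact: slice_int.
    rewrite /opp /=. lra. }
  have := mass_neg_double z r n Hr0 Neg.
  replace (2 ^ n * r) with (rho z) by (rewrite /r; field; lra). lra.
Qed.

Lemma slice_nonneg z r x : 0 <= slice z r x.
Proof.
  apply: RInt_ge_0.
  - have : 0 <= half_chord z r x by exact: sqrt_pos. lra.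
  - exact: vert_int.
  - move=> y _. exact: Laplacian_nonneg.
Qed.

(** The end points of the chord of D(z,r) above [x] are at distance [r] from [z], hence within [s]
    of [w]; the chord is therefore part of that of D(w,s), and the density is nonnegative. *)
Lemma slice_le z r w s x : 0 <= r -> Cmod (z - w) + r <= s -> fst z - r <= x <= fst z + r ->
  slice z r x <= slice w s x.
Proof.
  move=> Hr Hs Hx.
  have Hd0 : 0 <= Cmod (z - w) by exact: Cmod_ge_0.
  have H0 : 0 <= half_chord z r x by exact: sqrt_pos.
  have E : half_chord z r x * half_chord z r x = r ^ 2 - (x - fst z) ^ 2 by apply: sqrt_sqrt; nra.
  have key : forall sg, sg = 1 \/ sg = -1 -> Rabs (snd z + sg * half_chord z r x - snd w) <= half_chord w s x.
  { move=> sg Hsg.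
    have D1 : Cmod ((x, snd z + sg * half_chord z r x) - z) = r.
    { rewrite /Cmod /=. rewrite -{3}(sqrt_pow2 r) //. f_equal. case: Hsg => ->; nra. }
    have D2 : Cmod ((x, snd z + sg * half_chord z r x) - w) <= s.
    { apply: Rle_trans (Cmod_triangle3 _ z _) _. lra. }
    rewrite -sqrt_Rsqr_abs. apply: sqrt_le_1_alt.
    have D3 : Cmod ((x, snd z + sg * half_chord z r x) - w) ^ 2 <= s ^ 2.
    { apply: pow_incr. split => //. exact: Cmod_ge_0. }
    rewrite Cmod2_alt /= in D3. rewrite /Rsqr. nra. }
  have /Rabs_le_between K1 := key 1 (or_introl eq_refl).
  have /Rabs_le_between K2 := key (-1) (or_intror eq_refl).
  apply: RInt_mono_interval; try lra.
  - move=> y. exact: vert_cont.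
  - move=> y. exact: Laplacian_nonneg.
Qed.

Lemma disc_mass_mono z r w s : 0 <= r -> Cmod (z - w) + r <= s -> disc_mass phi z r <= disc_mass phi w s.
Proof.
  move=> Hr Hs. rewrite !disc_mass_slice.
  have /Rabs_le_between D := Rle_trans _ _ _ (Rabs_fst_le_Cmod (z - w)) (Rle_refl _). simpl in D.
  apply: Rle_trans (_ : RInt (slice w s) (fst z - r) (fst z + r) <= _).
  - apply: RInt_le; [lra | exact: slice_int | exact: slice_int |].
    move=> x Hx. apply: slice_le => //. lra.
  - apply: RInt_mono_interval; try lra; [move=> x; exact: slice_cont | move=> x; exact: slice_nonneg].
Qed.

(** A disc without mass would, by doubling, leave no mass to any dilate, yet some dilate contains
    D(w, rho w), of mass 1. *)
Lemma disc_mass_pos w s : 0 < s -> 0 < disc_mass phi w s.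
Proof.
  move=> Hs. case: (Rle_lt_dec (disc_mass phi w s) 0) => // H. exfalso.
  have [Hr Hm] := rho_radius w.
  have [n Hn] := pow2_unbounded (rho w / s).
  have := mass_nonpos_double w s n Hs H.
  have : disc_mass phi w (rho w) <= disc_mass phi w (2 ^ n * s).
  { apply: disc_mass_mono; first lra.
    replace (w - w)%C with (RtoC 0) by ring. rewrite Cmod_0. move/(Rlt_div_l _ _ _ Hs): Hn. lra. }
  lra.
Qed.

Theorem rho_lipschitz z w : rho w <= rho z + Cmod (z - w).
Proof.
  set r := rho z + Cmod (z - w).
  case: (Rle_lt_dec (rho w) r) => // H. exfalso.
  have [Hrz Hmz] := rho_radius z. have [Hrw Hmw] := rho_radius w.
  have Hd0 : 0 <= Cmod (z - w) by exact: Cmod_ge_0.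
  have M1 : 1 <= disc_mass phi w r.
  { rewrite -Hmz. apply: disc_mass_mono; rewrite /r; lra. }
  (* If [rho w > r], then D(w,r) already contains D(z, rho z), of mass 1. The disc D(v,s) lies in
     D(w, rho w) to the right of the abscissa [fst w + r]; splitting the iterated integral there
     adds its positive mass, and the total exceeds 1. *)
  set s := (rho w - r) / 2. pose v : C := (fst w + (r + rho w) / 2, snd w).
  have Hs : 0 < s by rewrite /s; lra.
  have M2 := disc_mass_pos v s Hs.
  have Dv : Cmod (v - w) = (r + rho w) / 2.
  { replace (v - w)%C with (RtoC ((r + rho w) / 2)).
    - apply: Cmod_RtoC_pos. rewrite /r. lra.
    - rewrite /v /Cminus /Cplus /Copp /RtoC /=. f_equal; ring. }
  have : disc_mass phi w r + disc_mass phi v s <= disc_mass phi w (rho w).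
  { rewrite !disc_mass_slice.
    rewrite -(RInt_Chasles (V := R_CompleteNormedModule) (slice w (rho w)) (fst w - rho w) (fst w + r) (fst w + rho w));
      try exact: slice_int.
    rewrite /plus /=. apply: Rplus_le_compat.
    - apply: Rle_trans (_ : RInt (slice w (rho w)) (fst w - r) (fst w + r) <= _).
      + apply: RInt_le; [rewrite /r; lra | exact: slice_int | exact: slice_int |].
        move=> x Hx. apply: slice_le; [rewrite /r; lra | | lra].
        replace (w - w)%C with (RtoC 0) by ring. rewrite Cmod_0. lra.
      + apply: RInt_mono_interval; try (rewrite /r; lra); try lra; [move=> x; exact: slice_cont | move=> x; exact: slice_nonneg].
    - replace (fst w + (r + rho w) / 2 - s) with (fst w + r) by (rewrite /s; field).
      replace (fst w + (r + rho w) / 2 + s) with (fst w + rho w) by (rewrite /s; field).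
      apply: RInt_le; [lra | exact: slice_int | exact: slice_int |].
      move=> x Hx. apply: slice_le; [lra | rewrite Dv /s; lra | rewrite /v /s /=; lra]. }
  lra.
Qed.

End Radius.

(** * The distance induced by the radius function *)

(** [real] sends infinite values to 0; a lower bound and a member together make the infimum finite,
    so that nothing is lost. *)
Lemma Glb_real_bounds (E : R -> Prop) (m x : R) :
  (forall y, E y -> m <= y) -> E x -> m <= real (Glb_Rbar E) <= x.
Proof.
  move=> Hm Hx. have [H1 H2] := Glb_Rbar_correct E.
  have A := H1 x Hx. have B : Rbar_le m (Glb_Rbar E) by apply: H2 => y Hy; exact: Hm.
  move: A B. case: (Glb_Rbar E) => [g||] //=.
Qed.

Lemma Glb_real_approx (E : R -> Prop) (m x eps : R) :
  (forall y, E y -> m <= y) -> E x -> 0 < eps -> exists y, E y /\ y < real (Glb_Rbar E) + eps.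
Proof.
  move=> Hm Hx He. apply: NNPP => HN.
  have HL : forall y, E y -> real (Glb_Rbar E) + eps <= y.
  { move=> y Hy. case: (Rle_lt_dec (real (Glb_Rbar E) + eps) y) => // H. exfalso. apply: HN. by exists y. }
  have := Glb_real_bounds E _ x HL Hx. lra.
Qed.

Lemma sqr_sum_Cmod (z : C) : fst z * fst z + snd z * snd z = Cmod z * Cmod z.
Proof. rewrite /Cmod sqrt_sqrt /=; nra. Qed.

Section Distance.
Variables (rho : C -> R).
Hypothesis rho_pos : forall z, 0 < rho z.
Hypothesis rho_lip : forall z w, rho w <= rho z + Cmod (z - w).

Lemma rho_cont z : continuous (T := C_UniformSpace) rho z.
Proof.
  apply/filterlim_locally => eps. apply/locally_C_iff. exists eps. split; first exact: cond_pos.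
  move=> w Hw. rewrite /ball /= /AbsRing_ball /abs /minus /plus /opp /=.
  apply: Rabs_def1; have := rho_lip z w; have := rho_lip w z; rewrite (Cmod_sub_sym z); lra.
Qed.

(** A smoothing of [ln (rho p + |z - p|)], differentiable at [p] as well when [eps > 0]. Its
    gradient has size at most [1 / (rho p + |z - p|)], hence at most [1 / rho z] by the Lipschitz
    bound; so its increment along a curve never exceeds the length of the curve for |dw|/rho. *)
Let U (p : C) (eps : R) (z : C) : R :=
  ln (rho p + sqrt ((fst z - fst p) * (fst z - fst p) + (snd z - snd p) * (snd z - snd p) + eps * eps)).

Lemma arc_U_bound (gam dgam : R -> C) (p : C) (eps : R) : 0 < eps -> C1_arc gam dgam ->
  Rabs (U p eps (gam 1) - U p eps (gam 0)) <= RInt (fun s => Cmod (dgam s) / rho (gam s)) 0 1.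
Proof.
  move=> He Harc.
  have gD : forall s, 0 <= s <= 1 -> is_curve_deriv gam s (dgam s).
  { move=> s Hs. apply/is_curve_deriv_iff. exact: (proj1 (Harc s Hs)). }
  have gc : forall s, 0 <= s <= 1 -> continuous (U := C_UniformSpace) gam s.
  { move=> s Hs. exact: curve_deriv_continuous (gD s Hs). }
  have dgc : forall s, 0 <= s <= 1 -> continuous (U := C_UniformSpace) dgam s.
  { move=> s Hs. exact: (proj2 (Harc s Hs)). }
  pose x := fun s => fst (gam s) - fst p. pose y := fun s => snd (gam s) - snd p.
  pose dx := fun s => fst (dgam s). pose dy := fun s => snd (dgam s).
  pose q := fun s => sqrt (x s * x s + y s * y s + eps * eps).
  have xD : forall s, 0 <= s <= 1 -> is_derive x s (dx s).
  { move=> s Hs. have := is_derive_minus _ _ _ _ _ (curve_deriv_fst _ _ _ (gD s Hs)) (is_derive_const (V := R_NormedModule) (fst p) s).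
    by rewrite minus_zero_r. }
  have yD : forall s, 0 <= s <= 1 -> is_derive y s (dy s).
  { move=> s Hs. have := is_derive_minus _ _ _ _ _ (curve_deriv_snd _ _ _ (gD s Hs)) (is_derive_const (V := R_NormedModule) (snd p) s).
    by rewrite minus_zero_r. }
  have N0 : forall s, 0 < x s * x s + y s * y s + eps * eps.
  { move=> s. have := Rle_0_sqr (x s). have := Rle_0_sqr (y s). rewrite /Rsqr. nra. }
  have q0 : forall s, 0 < q s by move=> s; exact: sqrt_lt_R0.
  pose dU := fun s => (x s * dx s + y s * dy s) / (q s * (rho p + q s)).
  have UD : forall s, 0 <= s <= 1 -> is_derive (fun s => U p eps (gam s)) s (dU s).
  { move=> s Hs. have P := rho_pos p. have Q := q0 s. have NN := N0 s.
    have X := xD s Hs. have Y := yD s Hs.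
    apply: (is_derive_ext (fun s => ln (rho p + sqrt (x s * x s + y s * y s + eps * eps)))) => //.
    have -> : dU s = (dx s * x s + x s * dx s + (dy s * y s + y s * dy s)) / (2 * q s) * / (rho p + q s).
    { rewrite /dU. field. split; lra. }
    have D1 := is_derive_plus _ _ _ _ _ (is_derive_mult _ _ _ _ _ X X Rmult_comm) (is_derive_mult _ _ _ _ _ Y Y Rmult_comm).
    have D2 := is_derive_plus _ _ _ _ _ D1 (is_derive_const (V := R_NormedModule) (eps * eps) s).
    have D3 := is_derive_sqrt _ _ _ D2 NN.
    have D4 := is_derive_plus _ _ _ _ _ (is_derive_const (V := R_NormedModule) (rho p) s) D3.
    have D5 := is_derive_comp ln _ _ _ _ (is_derive_ln (rho p + q s) ltac:(lra)) D4.
    move: D5. rewrite /plus /zero /scal /mult /= /mult /= Rplus_0_l Rplus_0_r. by []. }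
  have cR : forall (f : R -> R) s, continuous f s -> continuity_pt f s.
  { move=> f s H. by apply/continuity_pt_filterlim. }
  have xc : forall s, 0 <= s <= 1 -> continuity_pt x s.
  { move=> s Hs. apply: cR. apply: (ex_derive_continuous (V := R_NormedModule)). eexists. exact: xD. }
  have yc : forall s, 0 <= s <= 1 -> continuity_pt y s.
  { move=> s Hs. apply: cR. apply: (ex_derive_continuous (V := R_NormedModule)). eexists. exact: yD. }
  have dxc : forall s, 0 <= s <= 1 -> continuity_pt dx s.
  { move=> s Hs. apply: cR. apply: (Ccont_fst (U := R_UniformSpace)). exact: dgc. }
  have dyc : forall s, 0 <= s <= 1 -> continuity_pt dy s.
  { move=> s Hs. apply: cR. apply: (Ccont_snd (U := R_UniformSpace)). exact: dgc. }
  have qc : forall s, 0 <= s <= 1 -> continuity_pt q s.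
  { move=> s Hs. apply: (continuity_pt_comp (fun s => x s * x s + y s * y s + eps * eps) sqrt).
    - apply: continuity_pt_plus; last exact: continuity_pt_const.
      apply: continuity_pt_plus; apply: continuity_pt_mult; by [exact: xc | exact: yc].
    - apply: continuity_pt_sqrt. exact: Rlt_le. }
  have dUc : forall s, 0 <= s <= 1 -> continuous dU s.
  { move=> s Hs. apply/continuity_pt_filterlim. apply: continuity_pt_div.
    - apply: continuity_pt_plus; apply: continuity_pt_mult; by [exact: xc | exact: yc | exact: dxc | exact: dyc].
    - apply: continuity_pt_mult; first exact: qc. apply: continuity_pt_plus; [exact: continuity_pt_const | exact: qc].
    - have P := rho_pos p. have Q := q0 s. nra. }
  have R01 : Rmin 0 1 = 0 by rewrite Rmin_left; lra.
  have R01' : Rmax 0 1 = 1 by rewrite Rmax_right; lra.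
  have I : is_RInt dU 0 1 (U p eps (gam 1) - U p eps (gam 0)).
  { apply: (is_RInt_derive (V := R_CompleteNormedModule) (fun s => U p eps (gam s))).
    - move=> s. rewrite R01 R01'. exact: UD.
    - move=> s. rewrite R01 R01'. exact: dUc. }
  apply: (norm_RInt_le (V := R_NormedModule) dU (fun s => Cmod (dgam s) / rho (gam s)) 0 1 _ _ Rle_0_1 _ I).
  - move=> s Hs. rewrite /norm /= /abs /=.
    have P := rho_pos p. have Q := q0 s. have G := rho_pos (gam s).
    set A := Cmod (gam s - p).
    have HA0 : 0 <= A by exact: Cmod_ge_0.
    have HA : A * A = x s * x s + y s * y s.
    { rewrite /A -sqr_sum_Cmod /=. rewrite /x /y. ring. }
    have Aq : A <= q s.
    { rewrite /q -(sqrt_square A) //. apply: sqrt_le_1_alt. rewrite HA. nra. }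
    have CS : Rabs (x s * dx s + y s * dy s) <= A * Cmod (dgam s).
    { have HB0 := Cmod_ge_0 (dgam s). have HB := sqr_sum_Cmod (dgam s).
      rewrite -(Rabs_pos_eq (A * Cmod (dgam s))); last exact: Rmult_le_pos.
      apply: Rsqr_le_abs_0. rewrite /Rsqr.
      replace (A * Cmod (dgam s) * (A * Cmod (dgam s))) with ((A * A) * (Cmod (dgam s) * Cmod (dgam s))) by ring.
      rewrite HA -HB -/(dx s) -/(dy s).
      have := Rle_0_sqr (x s * dy s - y s * dx s). rewrite /Rsqr. nra. }
    have rg : rho (gam s) <= rho p + A.
    { have := rho_lip p (gam s). by rewrite Cmod_sub_sym. }
    have B0 := Cmod_ge_0 (dgam s).
    rewrite /dU Rabs_div; last nra. rewrite (Rabs_pos_eq (q s * (rho p + q s))); last nra.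
    apply/(Rle_div_l _ _ _); first nra.
    have K : A * rho (gam s) <= q s * (rho p + q s) by apply: Rmult_le_compat; lra.
    replace (Cmod (dgam s) / rho (gam s) * (q s * (rho p + q s))) with ((Cmod (dgam s) / rho (gam s)) * (q s * (rho p + q s))) by ring.
    apply: Rle_trans CS _.
    apply: Rle_trans (_ : Cmod (dgam s) / rho (gam s) * (A * rho (gam s)) <= _).
    + apply: Req_le. field. lra.
    + apply: Rmult_le_compat_l => //. apply: Rdiv_le_0_compat; lra.
  - apply: (RInt_correct (V := R_CompleteNormedModule)).
    apply: (ex_RInt_continuous (V := R_CompleteNormedModule)) => s. rewrite R01 R01' => Hs.
    apply/continuity_pt_filterlim. apply: continuity_pt_div.
    + apply: cR. apply: (Ccont_Cmod (U := R_UniformSpace)). exact: dgc.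
    + apply: cR. apply: (continuous_comp (V := C_UniformSpace) gam rho); [exact: gc | exact: rho_cont].
    + have := rho_pos (gam s). lra.
Qed.

Lemma curve_U_bound (p : C) (eps : R) z w l : 0 < eps -> curve_length rho z w l ->
  Rabs (U p eps w - U p eps z) <= l.
Proof.
  move=> He. elim=> [z0|gam dgam w0 l0 Harc _ IH].
  - rewrite Rminus_diag Rabs_R0. lra.
  - have A := arc_U_bound gam dgam p eps He Harc.
    have T := Rabs_triang (U p eps w0 - U p eps (gam 1)) (U p eps (gam 1) - U p eps (gam 0)).
    replace (U p eps w0 - U p eps (gam 1) + (U p eps (gam 1) - U p eps (gam 0)))
      with (U p eps w0 - U p eps (gam 0)) in T by ring. lra.
Qed.

Lemma curve_length_ge0 z w l : curve_length rho z w l -> 0 <= l.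
Proof.
  move=> H. have := curve_U_bound 0 1 z w l Rlt_0_1 H. have := Rabs_pos (U 0 1 w - U 0 1 z). lra.
Qed.

Lemma curve_length_ln (p : C) z w l : (p = z \/ p = w) -> curve_length rho z w l ->
  ln (1 + Cmod (z - w) / rho p) <= l.
Proof.
  move=> Hp Hc. have P := rho_pos p. set A := Cmod (z - w). have HA : 0 <= A by exact: Cmod_ge_0.
  case: (Rle_lt_dec (ln (1 + A / rho p)) l) => // H. exfalso.
  have K : forall eps, 0 < eps -> (rho p + A) <= exp l * (rho p + eps).
  { move=> eps He. have B := curve_U_bound p eps z w l He Hc.
    pose F := fun d => ln (rho p + sqrt (d + eps * eps)).
    have Fself : U p eps p = ln (rho p + eps).
    { rewrite /U. replace ((fst p - fst p) * (fst p - fst p) + (snd p - snd p) * (snd p - snd p) + eps * eps) with (eps * eps) by ring.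
      by rewrite sqrt_square; last lra. }
    have Foth : forall v, Cmod (v - p) = A -> U p eps v = ln (rho p + sqrt (A * A + eps * eps)).
    { move=> v Hv. rewrite /U. do 2 f_equal. rewrite -Hv -sqr_sum_Cmod. by simpl. }
    have B2 : ln (rho p + sqrt (A * A + eps * eps)) - ln (rho p + eps) <= l.
    { case: Hp B => E; rewrite -E => B.
      - rewrite Fself (Foth w) in B; last by rewrite /A -E Cmod_sub_sym.
        have := Rle_abs (ln (rho p + sqrt (A * A + eps * eps)) - ln (rho p + eps)). lra.
      - rewrite Fself (Foth z) in B; last by rewrite /A -E.
        have := Rle_abs (ln (rho p + sqrt (A * A + eps * eps)) - ln (rho p + eps)). rewrite Rabs_minus_sym. lra. }
    have S1 : A <= sqrt (A * A + eps * eps).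
    { rewrite -{1}(sqrt_square A) //. apply: sqrt_le_1_alt. nra. }
    have B3 : ln (rho p + A) <= ln (exp l * (rho p + eps)).
    { rewrite ln_mult; [|exact: exp_pos|lra]. rewrite ln_exp.
      have : ln (rho p + A) <= ln (rho p + sqrt (A * A + eps * eps)).
      { case: S1 => [S1|<-]; last lra. apply: Rlt_le. apply: ln_increasing; lra. }
      lra. }
    apply: Rnot_lt_le => Hlt.
    have := ln_increasing (exp l * (rho p + eps)) (rho p + A) _ Hlt.
    have Hpos : 0 < exp l * (rho p + eps) by apply: Rmult_lt_0_compat; [exact: exp_pos | lra].
    move=> /(_ Hpos). lra. }
  have E1 : exp l < 1 + A / rho p.
  { rewrite -(exp_ln (1 + A / rho p)); first exact: exp_increasing.
    have : 0 <= A / rho p by apply: Rdiv_le_0_compat. lra. }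
  have Ep := exp_pos l.
  have E2 : exp l * rho p < rho p + A.
  { replace (rho p + A) with ((1 + A / rho p) * rho p) by (field; lra). exact: Rmult_lt_compat_r. }
  (* This places [exp l * (rho p + eps)] halfway between [exp l * rho p] and [rho p + A], against
     [K]. *)
  set eps := (rho p + A - exp l * rho p) / (2 * exp l).
  have He : 0 < eps by apply: Rdiv_lt_0_compat; lra.
  have := K eps He. replace (exp l * (rho p + eps)) with (exp l * rho p + (rho p + A - exp l * rho p) / 2) by (rewrite /eps; field; lra).
  lra.
Qed.

Definition segment (z w : C) (s : R) : C := (z + RtoC s * (w - z))%C.

Lemma segment_arc z w : C1_arc (segment z w) (fun _ => w - z)%C.
Proof.
  move=> s _. split; last exact: continuous_const.
  apply/is_curve_deriv_iff.
  have := deriv_plus _ _ _ _ _ _ (deriv_const RtoC z s) (deriv_mult _ RtoC_continuous _ _ _ _ _ (deriv_self RtoC s) (deriv_const RtoC (w - z)%C s)).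
  replace (0 + (1 * (w - z) + RtoC s * 0))%C with (w - z)%C by ring. by [].
Qed.

Lemma segment_length z w :
  curve_length rho z w (RInt (fun s => Cmod (w - z) / rho (segment z w s)) 0 1 + 0).
Proof.
  have H := curve_cons rho (segment z w) (fun _ => w - z)%C w 0 (segment_arc z w).
  have E0 : segment z w 0 = z by rewrite /segment; ring.
  have E1 : segment z w 1 = w by rewrite /segment; ring.
  rewrite E0 E1 in H. apply: H. exact: curve_nil.
Qed.

Lemma dist_le_length z w l : curve_length rho z w l -> Defs.dist rho z w <= l.
Proof. move=> H. exact: (proj2 (Glb_real_bounds _ 0 l (curve_length_ge0 z w) H)). Qed.

Lemma dist_ge0 z w : 0 <= Defs.dist rho z w.
Proof. exact: (proj1 (Glb_real_bounds _ 0 _ (curve_length_ge0 z w) (segment_length z w))). Qed.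

Lemma dist_ge_ln p z w : (p = z \/ p = w) -> ln (1 + Cmod (z - w) / rho p) <= Defs.dist rho z w.
Proof.
  move=> Hp. exact: (proj1 (Glb_real_bounds _ _ _ (fun l => curve_length_ln p z w l Hp) (segment_length z w))).
Qed.

(** Along the segment the Lipschitz bound keeps [rho] above [rho w / 2]. This upper bound near a
    zero is what cancels the pole in [partial_bound]. *)
Lemma dist_le_near z w : Cmod (z - w) <= rho w / 2 -> Defs.dist rho z w <= 2 * Cmod (z - w) / rho w.
Proof.
  move=> H. have P := rho_pos w.
  apply: Rle_trans (dist_le_length _ _ _ (segment_length z w)) _. rewrite Rplus_0_r.
  have A0 := Cmod_ge_0 (z - w).
  have B : forall s, 0 <= s <= 1 -> Cmod (w - z) / rho (segment z w s) <= 2 * Cmod (z - w) / rho w.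
  { move=> s Hs. have Q := rho_pos (segment z w s).
    have : rho w / 2 <= rho (segment z w s).
    { have := rho_lip (segment z w s) w.
      have -> : (segment z w s - w)%C = (RtoC (1 - s) * (z - w))%C by rewrite /segment RtoC_minus; ring.
      rewrite Cmod_mult Cmod_RtoC_pos; last lra. nra. }
    move=> Hq. rewrite Cmod_sub_sym.
    replace (2 * Cmod (z - w) / rho w) with (Cmod (z - w) * / (rho w / 2)) by (field; lra).
    apply: Rmult_le_compat_l => //. apply: Rinv_le_contravar; lra. }
  have I : is_RInt (fun s => Cmod (w - z) / rho (segment z w s)) 0 1 (RInt (fun s => Cmod (w - z) / rho (segment z w s)) 0 1).
  { apply: (RInt_correct (V := R_CompleteNormedModule)).
    apply: (ex_RInt_continuous (V := R_CompleteNormedModule)) => s _.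
    apply/continuity_pt_filterlim. apply: continuity_pt_div.
    - exact: continuity_pt_const.
    - apply/continuity_pt_filterlim.
      apply: (continuous_comp (V := C_UniformSpace) (segment z w) rho); last exact: rho_cont.
      apply: Ccont_plus; first exact: Ccont_const. apply: Ccont_mult; [exact: RtoC_continuous | exact: Ccont_const].
    - have := rho_pos (segment z w s). lra. }
  have := norm_RInt_le_const (V := R_NormedModule) _ 0 1 _ (2 * Cmod (z - w) / rho w) Rle_0_1 _ I.
  rewrite Rminus_0_r Rmult_1_l => K.
  apply: Rle_trans (Rle_abs _) (K _) => s Hs.
  rewrite /norm /= /abs /= Rabs_pos_eq; first exact: B.
  apply: Rdiv_le_0_compat; [exact: Cmod_ge_0 | exact: rho_pos].
Qed.

Section DistSet.
Variable A : C -> Prop.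

Lemma dist_set_le z w : A w -> dist_set rho z A <= Defs.dist rho z w.
Proof.
  move=> Hw. apply: (proj2 (Glb_real_bounds _ 0 _ _ _)); last by exists w.
  move=> y [s [_ ->]]. exact: dist_ge0.
Qed.

Lemma dist_set_ge z w0 m : A w0 -> (forall w, A w -> m <= Defs.dist rho z w) -> m <= dist_set rho z A.
Proof.
  move=> H0 H. apply: (proj1 (Glb_real_bounds _ m (Defs.dist rho z w0) _ _)); last by exists w0.
  move=> y [s [Hs ->]]. exact: H.
Qed.

Lemma dist_set_approx z w0 eps : A w0 -> 0 < eps ->
  exists w, A w /\ Defs.dist rho z w < dist_set rho z A + eps.
Proof.
  move=> H0 He.
  have Hlb : forall d, (exists s, A s /\ d = Defs.dist rho z s) -> 0 <= d.
  { move=> d [s [_ ->]]. exact: dist_ge0. }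
  have [y [[w [Hw ->]] Hy]] := Glb_real_approx _ 0 (Defs.dist rho z w0) eps Hlb
    (ex_intro _ w0 (conj H0 eq_refl)) He.
  exists w. by split.
Qed.

End DistSet.
End Distance.

(** * Packing and summation over a separated set *)

Definition Rsum (f : C -> R) (l : list C) : R := fold_right Rplus 0 (map f l).

Lemma Rsum_cons f a l : Rsum f (a :: l) = f a + Rsum f l. Proof. by []. Qed.

Lemma Rsum_le f g l : (forall a, In a l -> f a <= g a) -> Rsum f l <= Rsum g l.
Proof.
  elim: l => [|a l IH] H; first by apply: Rle_refl.
  rewrite !Rsum_cons. apply: Rplus_le_compat; first by apply: H; left.
  apply: IH => b Hb. apply: H. by right.
Qed.

Lemma Rsum_ext f g l : (forall a, In a l -> f a = g a) -> Rsum f l = Rsum g l.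
Proof. move=> H. apply: Rle_antisym; apply: Rsum_le => a Ha; rewrite H //; exact: Rle_refl. Qed.

Lemma Rsum_scal c f l : Rsum (fun a => c * f a) l = c * Rsum f l.
Proof. elim: l => [|a l IH]; first by rewrite /Rsum /=; ring. rewrite !Rsum_cons IH. ring. Qed.

Lemma Rsum_const_le f l c : (forall a, In a l -> c <= f a) -> c * INR (length l) <= Rsum f l.
Proof.
  elim: l => [|a l IH] H; first by rewrite /Rsum /=; lra.
  rewrite Rsum_cons. change (length (a :: l)) with (S (length l)). rewrite S_INR.
  have := H a (or_introl eq_refl). have := IH (fun b Hb => H b (or_intror Hb)). lra.
Qed.

Lemma Rsum_filter f (p : C -> bool) l :
  Rsum f l = Rsum f (filter p l) + Rsum f (filter (fun a => negb (p a)) l).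
Proof.
  elim: l => [|a l IH]; first by rewrite /Rsum /=; lra.
  rewrite Rsum_cons IH /=. case: (p a); rewrite /= Rsum_cons; lra.
Qed.

Lemma Rsum_zero f l : (forall a, In a l -> f a = 0) -> Rsum f l = 0.
Proof.
  move=> H. rewrite (Rsum_ext _ (fun a => 0 * 0)); first by rewrite Rsum_scal; ring.
  move=> a Ha. rewrite H //. ring.
Qed.

(** Meant for summands with disjoint supports: at a given point the sum inherits the bound of a
    single term. *)
Lemma Rsum_single f l : NoDup l ->
  (forall a b, In a l -> In b l -> f a <> 0 -> f b <> 0 -> a = b) ->
  Rsum f l = 0 \/ exists a, In a l /\ f a <> 0 /\ Rsum f l = f a.
Proof.
  elim: l => [|a l IH] Hn H; first by left.
  have Hn1 := NoDup_cons_iff a l. case: (proj1 Hn1 Hn) => Ha Hl.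
  rewrite Rsum_cons.
  case: (Req_dec (f a) 0) => Hf.
  - rewrite Hf Rplus_0_l. case: IH => //.
    + move=> b c Hb Hc. apply: H; by right.
    + by left.
    + case=> b [Hb HH]. right. exists b. split => //. by right.
  - right. exists a. split; first by left. split => //.
    rewrite Rsum_zero; first ring. move=> b Hb. apply: NNPP => Hfb.
    apply: Ha. by rewrite (H a b (or_introl eq_refl) (or_intror Hb) Hf Hfb).
Qed.

Lemma RInt_Rsum (f : C -> R -> R) l a b : (forall z x, continuous (f z) x) ->
  (forall x, continuous (fun x => Rsum (fun z => f z x) l) x) /\
  RInt (fun x => Rsum (fun z => f z x) l) a b = Rsum (fun z => RInt (f z) a b) l.
Proof.
  move=> Hc. elim: l => [|z l [IH1 IH2]].
  - split; first by move=> x; exact: continuous_const.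
    rewrite (RInt_const (V := R_CompleteNormedModule)) /scal /= /mult /= /Rsum /=. ring.
  - split.
    + move=> x. apply: (continuous_plus (V := R_NormedModule)); [exact: Hc | exact: IH1].
    + rewrite Rsum_cons -IH2.
      apply: (RInt_plus (V := R_CompleteNormedModule) (f z) (fun x => Rsum (fun w => f w x) l));
        exact: (ex_RInt_continuous (V := R_CompleteNormedModule)).
Qed.

(** Stands in for the indicator of the interval of radius [s] about [a], which keeps all integrands
    continuous. *)
Definition tent (a s x : R) : R := Rmax 0 (1 - Rabs (x - a) / s).

Lemma tent_cont a s x : continuous (tent a s) x.
Proof.
  apply: (continuous_ext (fun x => (1 - Rabs (x - a) / s + Rabs (1 - Rabs (x - a) / s)) / 2)).
  - move=> y. rewrite /tent. set u := 1 - Rabs (y - a) / s.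
    rewrite /Rmax /Rabs. case: Rle_dec => H; case: Rcase_abs => H2; lra.
  - have c1 : forall y, continuous (fun x => 1 - Rabs (x - a) / s) y.
    { move=> y. apply: (continuous_minus (V := R_NormedModule)); first exact: continuous_const.
      apply: (continuous_mult (K := R_AbsRing)); last exact: continuous_const.
      apply: (continuous_comp (fun x => x - a) Rabs); last exact: continuous_Rabs.
      apply: (continuous_minus (V := R_NormedModule)); [exact: continuous_id | exact: continuous_const]. }
    apply: (continuous_mult (K := R_AbsRing)); last exact: continuous_const.
    apply: (continuous_plus (V := R_NormedModule)); first exact: c1.
    apply: (continuous_comp _ Rabs); [exact: c1 | exact: continuous_Rabs].
Qed.

Lemma tent_range a s x : 0 < s -> 0 <= tent a s x <= 1.
Proof.
  move=> Hs. split; first exact: Rmax_l. apply: Rmax_lub; first lra.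
  have : 0 <= Rabs (x - a) / s by apply: Rdiv_le_0_compat => //; exact: Rabs_pos. lra.
Qed.

Lemma tent_supp a s x : 0 < s -> tent a s x <> 0 -> Rabs (x - a) < s.
Proof.
  move=> Hs H. apply: Rnot_le_lt => Hx. apply: H. apply: Rmax_left.
  have : 1 <= Rabs (x - a) / s by apply/(Rle_div_r _ _ _ Hs); lra. lra.
Qed.

(** Only the middle half is used, where the tent is at least 1/2; the interval of integration then
    has to contain no more than that half. *)
Lemma tent_int a s A B : 0 < s -> A <= a - s / 2 -> a + s / 2 <= B -> s / 2 <= RInt (tent a s) A B.
Proof.
  move=> Hs HA HB.
  have ex : forall u v, ex_RInt (tent a s) u v.
  { move=> u v. apply: (ex_RInt_continuous (V := R_CompleteNormedModule)) => x _. exact: tent_cont. }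
  apply: Rle_trans (_ : RInt (tent a s) (a - s / 2) (a + s / 2) <= _).
  - replace (s / 2) with (RInt (fun _ => / 2) (a - s / 2) (a + s / 2)) at 1;
      last by rewrite (RInt_const (V := R_CompleteNormedModule)) /scal /= /mult /=; field.
    apply: RInt_le; [lra | exact: ex_RInt_const | exact: ex |].
    move=> x Hx. apply: Rle_trans (Rmax_r _ _).
    have : Rabs (x - a) / s <= / 2.
    { apply/(Rle_div_l _ _ _ Hs). apply: Rabs_le. lra. }
    lra.
  - apply: RInt_mono_interval; try lra; first exact: tent_cont.
    move=> x. exact: (proj1 (tent_range a s x Hs)).
Qed.

Definition square_disjoint (s : C -> R) (l : list C) :=
  forall a b, In a l -> In b l -> a <> b ->
    s a + s b <= Rmax (Rabs (fst a - fst b)) (Rabs (snd a - snd b)).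

(* Disjoint squares of half-sides [s a] centred in a box of half-side [T]: the product tents
   have sum at most 1, and twice integrating bounds the total area. *)
Lemma packing (s : C -> R) (l : list C) (p : C) (T : R) : 0 < T -> NoDup l ->
  (forall a, In a l -> 0 < s a /\ s a <= T) -> (forall a, In a l -> Cmod (a - p) <= T) ->
  square_disjoint s l -> Rsum (fun a => s a ^ 2) l <= 64 * T ^ 2.
Proof.
  move=> HT Hn Hs Hp Hd.
  have C1 : forall (m : R) s0 x, continuous (tent m s0) x by move=> m s0 x; exact: tent_cont.
  have mid : forall a, In a l -> (fst p - 2 * T <= fst a - s a / 2 /\ fst a + s a / 2 <= fst p + 2 * T) /\
                                 (snd p - 2 * T <= snd a - s a / 2 /\ snd a + s a / 2 <= snd p + 2 * T).
  { move=> a Ha. have [s0 sT] := Hs a Ha.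
    have /Rabs_le_between D1 := Rle_trans _ _ _ (Rabs_fst_le_Cmod (a - p)) (Hp a Ha).
    have /Rabs_le_between D2 := Rle_trans _ _ _ (Rabs_snd_le_Cmod (a - p)) (Hp a Ha).
    simpl in D1, D2. lra. }
  have S1 : forall x y, Rsum (fun a => tent (fst a) (s a) x * tent (snd a) (s a) y) l <= 1.
  { move=> x y.
    have Hsingle := Rsum_single (fun a => tent (fst a) (s a) x * tent (snd a) (s a) y) l Hn.
    case: Hsingle => [a b Ha Hb Fa Fb|->|[a [Ha [_ ->]]]].
    - apply: NNPP => Hab. have := Hd a b Ha Hb Hab.
      have sa := proj1 (Hs a Ha). have sb := proj1 (Hs b Hb).
      have A1 : Rabs (x - fst a) < s a by apply: tent_supp => // E; apply: Fa; rewrite E; ring.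
      have A2 : Rabs (y - snd a) < s a by apply: tent_supp => // E; apply: Fa; rewrite E; ring.
      have B1 : Rabs (x - fst b) < s b by apply: tent_supp => // E; apply: Fb; rewrite E; ring.
      have B2 : Rabs (y - snd b) < s b by apply: tent_supp => // E; apply: Fb; rewrite E; ring.
      have : Rmax (Rabs (fst a - fst b)) (Rabs (snd a - snd b)) < s a + s b.
      { apply: Rmax_lub_lt.
        - move: A1 B1 => /Rabs_lt_between ? /Rabs_lt_between ?. apply: Rabs_def1; lra.
        - move: A2 B2 => /Rabs_lt_between ? /Rabs_lt_between ?. apply: Rabs_def1; lra. }
      lra.
    - lra.
    - have [sa _] := Hs a Ha. have := tent_range (fst a) (s a) x sa. have := tent_range (snd a) (s a) y sa. nra. }
  have S2 : forall x, Rsum (fun a => tent (fst a) (s a) x * (s a / 2)) l <= 4 * T.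
  { move=> x.
    have [Hc HI] := RInt_Rsum (fun a y => tent (fst a) (s a) x * tent (snd a) (s a) y) l (snd p - 2 * T) (snd p + 2 * T)
      (fun a y => continuous_scal_r (V := R_NormedModule) _ _ _ (C1 _ _ y)).
    have : RInt (fun y => Rsum (fun a => tent (fst a) (s a) x * tent (snd a) (s a) y) l) (snd p - 2 * T) (snd p + 2 * T) <= 4 * T.
    { replace (4 * T) with (RInt (fun _ => 1) (snd p - 2 * T) (snd p + 2 * T));
        last by rewrite (RInt_const (V := R_CompleteNormedModule)) /scal /= /mult /=; ring.
      apply: RInt_le; [lra | exact: (ex_RInt_continuous (V := R_CompleteNormedModule)) | exact: ex_RInt_const |].
      move=> y _. exact: S1. }
    rewrite HI => H. apply: Rle_trans _ H. apply: Rsum_le => a Ha.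
    rewrite (RInt_scal (V := R_CompleteNormedModule) (tent (snd a) (s a)));
      last by apply: (ex_RInt_continuous (V := R_CompleteNormedModule)) => y _; exact: C1.
    rewrite /scal /= /mult /=. apply: Rmult_le_compat_l; first exact: (proj1 (tent_range _ _ _ (proj1 (Hs a Ha)))).
    apply: tent_int; [exact: (proj1 (Hs a Ha)) | have := mid a Ha; lra | have := mid a Ha; lra]. }
  have [Hc HI] := RInt_Rsum (fun a x => (s a / 2) * tent (fst a) (s a) x) l (fst p - 2 * T) (fst p + 2 * T)
    (fun a x => continuous_scal_r (V := R_NormedModule) _ _ _ (C1 _ _ x)).
  have S3 : RInt (fun x => Rsum (fun a => s a / 2 * tent (fst a) (s a) x) l) (fst p - 2 * T) (fst p + 2 * T) <= 4 * T * (4 * T).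
  { replace (4 * T * (4 * T)) with (RInt (fun _ => 4 * T) (fst p - 2 * T) (fst p + 2 * T));
      last by rewrite (RInt_const (V := R_CompleteNormedModule)) /scal /= /mult /=; ring.
    apply: RInt_le; [lra | exact: (ex_RInt_continuous (V := R_CompleteNormedModule)) | exact: ex_RInt_const |].
    move=> x _. rewrite (Rsum_ext _ (fun a => tent (fst a) (s a) x * (s a / 2))); first exact: S2.
    move=> a _. ring. }
  rewrite HI in S3.
  have S4 : Rsum (fun a => / 4 * s a ^ 2) l <= 4 * T * (4 * T).
  { apply: Rle_trans S3. apply: Rsum_le => a Ha. have [sa _] := Hs a Ha.
    rewrite (RInt_scal (V := R_CompleteNormedModule) (tent (fst a) (s a)));
      last by apply: (ex_RInt_continuous (V := R_CompleteNormedModule)) => y _; exact: C1.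
    rewrite /scal /= /mult /=.
    have := tent_int (fst a) (s a) (fst p - 2 * T) (fst p + 2 * T) sa ltac:(have := mid a Ha; lra) ltac:(have := mid a Ha; lra).
    move=> H. nra. }
  rewrite Rsum_scal in S4. nra.
Qed.

(** If no list exhausted [A], every list of distinct elements could be lengthened, up to the
    forbidden length [S n]. *)
Lemma finite_enumerates (A : C -> Prop) (n : nat) :
  (forall l, NoDup l -> (forall z, In z l -> A z) -> (length l <= n)%nat) -> exists l, enumerates l A.
Proof.
  move=> H. apply: NNPP => HN.
  have K : forall k, exists l, NoDup l /\ (forall z, In z l -> A z) /\ length l = k.
  { elim=> [|k [l [Hl [HA Hk]]]].
    - exists nil. split; first exact: NoDup_nil. by split.
    - have [z Hz] : exists z, A z /\ ~ In z l.
      { apply: NNPP => HN2. apply: HN. exists l. split => // z. split; first exact: HA.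
        move=> Az. apply: NNPP => Hz. apply: HN2. by exists z. }
      exists (z :: l). split; first by apply: NoDup_cons; tauto.
      split; last by rewrite /= Hk. move=> w [<-|Hw]; [tauto | exact: HA]. }
  have [l [Hl [HA Hk]]] := K (S n). have := H l Hl HA. lia.
Qed.

(** * Lower bounds for the radius and sums over a separated set *)

Section Lattice.
Variables (rho : C -> R) (t delta : R) (Lam : C -> Prop).
Hypothesis rho_pos : forall z, 0 < rho z.
Hypothesis rho_lip : forall z w, rho w <= rho z + Cmod (z - w).
Hypothesis t_exponent : growth_exponent rho t.
Hypothesis delta_pos : 0 < delta.
Hypothesis Lam_sep : forall a b, Lam a -> Lam b -> a <> b -> delta * Rmax (rho a) (rho b) <= Cmod (a - b).

(* The growth estimate without restriction on the pair: move [l] away from [w] by [rho l]. *)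
Lemma growth_ln : exists kap, 0 <= kap /\ forall w l,
  ln (rho w) <= kap + t * ln (rho l) + (1 - t) * ln (Cmod (w - l) + rho l).
Proof.
  have [Ht [K [HK HG]]] := t_exponent.
  exists (Rabs (ln K) + t * ln 2). split.
  { have := Rabs_pos (ln K). have : 0 < ln 2 by rewrite -ln_1; apply: ln_increasing; lra. nra. }
  move=> w l. set D := Cmod (w - l) + rho l.
  have Pl := rho_pos l. have Pw := rho_pos w.
  have D0 : 0 <= Cmod (w - l) by exact: Cmod_ge_0.
  have HD : 0 < D by rewrite /D; lra.
  have [z [Hz1 Hz2]] : exists z, Cmod (z - w) = D /\ Cmod (z - l) = rho l.
  { case: (Ceq_dec w l) => [E|E].
    - exists (w + RtoC (rho l))%C. rewrite /D E.
      replace (l + RtoC (rho l) - l)%C with (RtoC (rho l)) by ring.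
      replace (l - l)%C with (RtoC 0) by ring. rewrite Cmod_0 Cmod_RtoC_pos; lra.
    - have M : 0 < Cmod (w - l) by exact: Cmod_sub_pos.
      have Mn : RtoC (Cmod (w - l)) <> 0 by move=> /RtoC_inj; lra.
      have Hq : 0 < rho l / Cmod (w - l) by exact: Rdiv_lt_0_compat.
      exists (l + RtoC (rho l / Cmod (w - l)) * (l - w))%C. split.
      + replace (l + RtoC (rho l / Cmod (w - l)) * (l - w) - w)%C with (RtoC (1 + rho l / Cmod (w - l)) * (l - w))%C
          by (rewrite RtoC_plus; ring).
        rewrite Cmod_mult Cmod_RtoC_pos; last lra.
        rewrite (Cmod_sub_sym l) /D. field. lra.
      + replace (l + RtoC (rho l / Cmod (w - l)) * (l - w) - l)%C with (RtoC (rho l / Cmod (w - l)) * (l - w))%C by ring.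
        rewrite Cmod_mult Cmod_RtoC_pos; last lra.
        rewrite (Cmod_sub_sym l). field. lra. }
  have Pz := rho_pos z.
  have Hwz : rho w <= Cmod (z - w).
  { rewrite Hz1 /D. have := rho_lip l w. rewrite Cmod_sub_sym. lra. }
  have G := HG w z Hwz. rewrite (Cmod_sub_sym w) Hz1 in G.
  have Hz3 : rho z <= 2 * rho l.
  { have := rho_lip l z. rewrite Cmod_sub_sym Hz2. lra. }
  have G1 : ln (rho w / rho z) <= ln (K * Rpower (D / rho z) (1 - t)).
  { case: G => [G|->]; last lra. apply: Rlt_le. apply: ln_increasing => //. exact: Rdiv_lt_0_compat. }
  rewrite ln_mult // in G1; last exact: exp_pos.
  rewrite /Rpower ln_exp !ln_div // in G1.
  have G2 : ln (rho z) <= ln 2 + ln (rho l).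
  { rewrite -ln_mult //; last lra. case: Hz3 => [H|->]; last lra. apply: Rlt_le. exact: ln_increasing. }
  have := Rle_abs (ln K). nra.
Qed.

Lemma ln_le_mono x y : 0 < x -> x <= y -> ln x <= ln y.
Proof. move=> Hx [H|->]; last lra. apply: Rlt_le. exact: ln_increasing. Qed.

(* Comparability of radii at bounded relative distance. *)
Lemma rho_comparable (B : R) : 0 <= B -> exists B', 0 < B' /\ forall z l, Cmod (z - l) <= B * rho z -> rho z <= B' * rho l.
Proof.
  move=> HB. have [kap [Hk HG]] := growth_ln. have [[Ht0 Ht1] _] := t_exponent.
  set E := exp ((kap + (1 - t) * ln (B + 1)) / t).
  exists (Rmax 1 E). split; first by have := Rmax_l 1 E; lra.
  move=> z l H. have Pl := rho_pos l. have Pz := rho_pos z.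
  case: (Rle_lt_dec (rho z) (rho l)) => Hc.
  { have := Rmax_l 1 E. nra. }
  apply: Rle_trans (_ : E * rho l <= _); last by apply: Rmult_le_compat_r; [lra | exact: Rmax_r].
  have G := HG z l.
  have L1 : ln (Cmod (z - l) + rho l) <= ln (B + 1) + ln (rho z).
  { rewrite -ln_mult; [|lra|lra]. apply: ln_le_mono; first by have := Cmod_ge_0 (z - l); lra. lra. }
  have L2 : ln (rho z) <= (kap + (1 - t) * ln (B + 1)) / t + ln (rho l).
  { apply: (Rmult_le_reg_l t) => //.
    replace (t * ((kap + (1 - t) * ln (B + 1)) / t + ln (rho l))) with (kap + (1 - t) * ln (B + 1) + t * ln (rho l)) by (field; lra).
    nra. }
  rewrite -(exp_ln (rho z)) // -(exp_ln (rho l)) // /E -exp_plus.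
  case: L2 => [L2|->]; [apply: Rlt_le; exact: exp_increasing | lra].
Qed.

Lemma rho_le_sep a b : Lam a -> Lam b -> a <> b -> delta * rho a <= Cmod (a - b) /\ delta * rho b <= Cmod (a - b).
Proof.
  move=> Ha Hb Hab. have H := Lam_sep a b Ha Hb Hab.
  have := Rmax_l (rho a) (rho b). have := Rmax_r (rho a) (rho b). nra.
Qed.

(** The growth estimate at [w = p], solved for [rho l]: the bound is a multiple of
    [|l - p| ^ (1/t - 1) * rho p ^ (- 1/t)], written with [exp] and [ln] because the exponents are
    real. Separation replaces [|l - p| + rho l] by [(1 + / delta) * |l - p|], whence [c]. *)
Lemma inv_rho_bound : exists A, 0 < A /\ forall p l, Lam p -> Lam l -> l <> p ->
  / rho l <= A * exp (((1 - t) * ln (Cmod (l - p)) - ln (rho p)) / t).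
Proof.
  have [kap [Hk HG]] := growth_ln. have [[Ht0 Ht1] _] := t_exponent.
  set c := ln (1 + / delta).
  exists (exp ((kap + (1 - t) * c) / t)). split; first exact: exp_pos.
  move=> p l Hp Hl Hlp. have Pl := rho_pos l. have Pp := rho_pos p.
  have [S1 S2] := rho_le_sep l p Hl Hp Hlp.
  have M : 0 < Cmod (l - p) by exact: Cmod_sub_pos.
  have G := HG p l. rewrite (Cmod_sub_sym p) in G.
  have L1 : ln (Cmod (l - p) + rho l) <= c + ln (Cmod (l - p)).
  { have Hi : 0 < / delta by exact: Rinv_0_lt_compat.
    rewrite /c -ln_mult //; last lra. apply: ln_le_mono; first lra.
    have : rho l <= / delta * Cmod (l - p).
    { apply: (Rmult_le_reg_l delta) => //. rewrite -Rmult_assoc Rinv_r; lra. }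
    lra. }
  rewrite -exp_plus -(exp_ln (/ rho l)); last exact: Rinv_0_lt_compat.
  rewrite ln_Rinv //.
  have L2 : - ln (rho l) <= (kap + (1 - t) * c) / t + ((1 - t) * ln (Cmod (l - p)) - ln (rho p)) / t.
  { apply: (Rmult_le_reg_l t) => //.
    replace (t * ((kap + (1 - t) * c) / t + ((1 - t) * ln (Cmod (l - p)) - ln (rho p)) / t))
      with (kap + (1 - t) * c + (1 - t) * ln (Cmod (l - p)) - ln (rho p)) by (field; lra).
    nra. }
  case: L2 => [L2|->]; [apply: Rlt_le; exact: exp_increasing | lra].
Qed.

(** Packing with half-sides [delta / 4 * rho a]: separation gives [delta / 4 * (rho a + rho b) <= |a
    - b| / 2], and this is at most the larger coordinate difference. The constant is
    [64 / (delta / 4) ^ 2]. *)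
Lemma sum_rho_sq (l : list C) (p : C) (T : R) : 0 < T -> NoDup l -> Lam p ->
  (forall a, In a l -> Lam a /\ a <> p /\ Cmod (a - p) <= T) ->
  Rsum (fun a => rho a ^ 2) l <= 1024 / delta ^ 2 * T ^ 2.
Proof.
  move=> HT Hn Hp Hl.
  have P : Rsum (fun a => (delta / 4 * rho a) ^ 2) l <= 64 * T ^ 2.
  { apply: (packing (fun a => delta / 4 * rho a) l p) => //.
    - move=> a Ha. have [La [Nap Da]] := Hl a Ha. have := rho_pos a.
      have [S1 S2] := rho_le_sep a p La Hp Nap. move=> R0. split; nra.
    - move=> a Ha. by have [_ [_ Da]] := Hl a Ha.
    - move=> a b Ha Hb Hab. have [La _] := Hl a Ha. have [Lb _] := Hl b Hb.
      have [S1 S2] := rho_le_sep a b La Lb Hab.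
      have := Cmod_Re_Im (a - b). simpl.
      have := Rmax_l (Rabs (fst a - fst b)) (Rabs (snd a - snd b)).
      have := Rmax_r (Rabs (fst a - fst b)) (Rabs (snd a - snd b)). rewrite /Rminus. lra. }
  rewrite (Rsum_ext _ (fun a => (delta / 4) ^ 2 * rho a ^ 2)) in P; last by move=> a _; ring.
  rewrite Rsum_scal in P.
  apply: (Rmult_le_reg_l ((delta / 4) ^ 2)); first by apply: pow_lt; lra.
  apply: Rle_trans P _. apply: Req_le. field. lra.
Qed.

(** The growth estimate at [w = 0] bounds [ln (rho l)] from below. Together with the packing bound
    this makes the lattice locally finite. *)
Lemma rho_lower_ball (r : R) : exists m, 0 < m /\ forall l, Cmod l <= r -> m <= rho l.
Proof.
  have [kap [Hk HG]] := growth_ln. have [[Ht0 Ht1] _] := t_exponent.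
  have P0 := rho_pos 0.
  set D := Rabs r + (rho 0 + Rabs r).
  exists (exp ((ln (rho 0) - kap - (1 - t) * ln D) / t)). split; first exact: exp_pos.
  move=> l Hl. have Pl := rho_pos l. have G := HG 0%C l.
  have A : rho l <= rho 0 + Rabs r.
  { have := rho_lip 0%C l. replace (0 - l)%C with (- l)%C by ring. rewrite Cmod_opp. have := Rle_abs r. lra. }
  have L1 : ln (Cmod (0 - l) + rho l) <= ln D.
  { apply: ln_le_mono; first by have := Cmod_ge_0 (0 - l)%C; lra.
    replace (0 - l)%C with (- l)%C by ring. rewrite Cmod_opp /D. have := Rle_abs r. lra. }
  rewrite -(exp_ln (rho l)) //.
  have L2 : (ln (rho 0) - kap - (1 - t) * ln D) / t <= ln (rho l).
  { apply/(Rle_div_l _ _ _ Ht0). nra. }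
  case: L2 => [L2|->]; [apply: Rlt_le; exact: exp_increasing | lra].
Qed.

Lemma lattice_enumerates : Lam 0%C -> forall r, exists l, enumerates l (fun z => Lam z /\ Cmod z < r).
Proof.
  move=> L0 r. have [m [Hm Hlow]] := rho_lower_ball r.
  set T := Rabs r + 1. have HT : 0 < T by rewrite /T; have := Rabs_pos r; lra.
  have Hd2 : 0 < delta ^ 2 by exact: pow_lt.
  set B := 1024 / delta ^ 2 * T ^ 2 / m ^ 2.
  have [n Hn] := INR_unbounded B.
  have K : forall l, NoDup l -> (forall z, In z l -> Lam z /\ Cmod z < r /\ z <> 0%C) -> (length l <= n)%nat.
  { move=> l Hl HA.
    have S1 := sum_rho_sq l 0%C T HT Hl L0.
    have S2 : Rsum (fun a => rho a ^ 2) l <= 1024 / delta ^ 2 * T ^ 2.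
    { apply: S1 => a Ha. have [La [Ma Na]] := HA a Ha. split => //. split => //.
      replace (a - 0)%C with a by ring. rewrite /T. have := Rle_abs r. lra. }
    have S3 : m ^ 2 * INR (length l) <= Rsum (fun a => rho a ^ 2) l.
    { apply: Rsum_const_le => a Ha. have [La [Ma Na]] := HA a Ha. apply: pow_incr. split; first lra. apply: Hlow. lra. }
    have Hm2 : 0 < m ^ 2 by exact: pow_lt.
    apply: INR_le. apply: Rlt_le. apply: Rle_lt_trans Hn.
    rewrite /B. apply/(Rle_div_r _ _ _ Hm2). lra. }
  (* One more than [n]: the count was made around the base point 0, which the packing bound leaves
     out. *)
  apply: (finite_enumerates _ (S n)) => l Hl HA.
  case: (in_dec Ceq_dec 0%C l) => H0.
  - have [l1 [l2 E]] := in_split _ _ H0.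
    have Hl3 := Hl. rewrite E in Hl3.
    have Hl' := NoDup_remove_1 _ _ _ Hl3. have N0 := NoDup_remove_2 _ _ _ Hl3.
    have := K (l1 ++ l2) Hl'. rewrite E !length_app /= => H.
    have : (length l1 + length l2 <= n)%nat; last lia.
    apply: H => z Hz. have [Lz Mz] : Lam z /\ Cmod z < r.
    { apply: HA. rewrite E. apply/in_app_iff. case/in_app_iff: Hz; [by left | by right; right]. }
    split => //. split => // Ez. apply: N0. by rewrite -Ez.
  - apply: Nat.le_trans (K l Hl _) _; last lia.
    move=> z Hz. have [Lz Mz] := HA z Hz. split => //. split => // Ez. apply: H0. by rewrite -Ez.
Qed.

(* Dyadic summation: [e > 0] makes the annuli sum geometrically. *)
Lemma sum_dyadic (e : R) : 0 < e -> exists A, 0 < A /\ forall p l, Lam p -> NoDup l ->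
  (forall a, In a l -> Lam a /\ a <> p) ->
  Rsum (fun a => rho a ^ 2 * exp (- (2 + e) * ln (Cmod (a - p)))) l <= A * exp (- e * ln (rho p)).
Proof.
  move=> He.
  set q := exp (- e * ln 2).
  have ln2 : 0 < ln 2 by rewrite -ln_1; apply: ln_increasing; lra.
  have q0 : 0 < q by exact: exp_pos.
  have q1 : q < 1 by rewrite /q -exp_0; apply: exp_increasing; nra.
  set Cp := 1024 / delta ^ 2.
  have HCp : 0 < Cp by apply: Rdiv_lt_0_compat; [lra | exact: pow_lt].
  (* Induction on the number [J] of annuli about [p], with inner radii [2 ^ j * (delta * rho p)].
     Separation empties the disc inside the first one; passing from outer to inner radius costs the
     factor 4, and each annulus gains the ratio [q], which is [2 ^ (- e)]. *)
  have K : forall p l J, Lam p -> NoDup l -> (forall a, In a l -> Lam a /\ a <> p) ->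
    (forall a, In a l -> Cmod (a - p) < 2 ^ J * (delta * rho p)) ->
    Rsum (fun a => rho a ^ 2 * exp (- (2 + e) * ln (Cmod (a - p)))) l
      <= 4 * Cp * exp (- e * ln (delta * rho p)) * ((1 - q ^ J) / (1 - q)).
  { move=> p l J Hp Hn Hl. set r0 := delta * rho p.
    have Hr0 : 0 < r0 by apply: Rmult_lt_0_compat.
    elim: J l Hn Hl => [|J IH] l Hn Hl Hlt.
    - have -> : l = nil.
      { case: l Hn Hl Hlt => // a l _ Hl Hlt. exfalso.
        have [La Nap] := Hl a (or_introl eq_refl). have := proj2 (rho_le_sep a p La Hp Nap).
        have := Hlt a (or_introl eq_refl). rewrite /r0 /=. lra. }
      rewrite /Rsum /=. apply: Req_le. field. lra.
    - set f := fun a => rho a ^ 2 * exp (- (2 + e) * ln (Cmod (a - p))).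
      pose pr := fun a => if Rlt_dec (Cmod (a - p)) (2 ^ J * r0) then true else false.
      rewrite (Rsum_filter f pr).
      have I1 : Rsum f (filter pr l) <= 4 * Cp * exp (- e * ln r0) * ((1 - q ^ J) / (1 - q)).
      { apply: IH.
        - exact: NoDup_filter.
        - move=> a /filter_In [Ha _]. exact: Hl.
        - move=> a /filter_In [_]. rewrite /pr. by case: Rlt_dec. }
      set l2 := filter (fun a => negb (pr a)) l.
      have P2 : 0 < 2 ^ J by apply: pow_lt; lra.
      have HT : 0 < 2 ^ J * r0 by exact: Rmult_lt_0_compat.
      have Hl2 : forall a, In a l2 -> In a l /\ 2 ^ J * r0 <= Cmod (a - p).
      { move=> a /filter_In [Ha Hb]. split; first by []. move: Hb. rewrite /pr. case: Rlt_dec => [_|H _] //. exact: Rnot_lt_le. }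
      have I2 : Rsum f l2 <= 4 * Cp * exp (- e * ln r0) * q ^ J.
      { apply: Rle_trans (_ : Rsum (fun a => exp (- (2 + e) * ln (2 ^ J * r0)) * rho a ^ 2) l2 <= _).
        - apply: Rsum_le => a Ha. have [_ Hge] := Hl2 a Ha. rewrite /f Rmult_comm.
          apply: Rmult_le_compat_r; first exact: pow2_ge_0.
          have : ln (2 ^ J * r0) <= ln (Cmod (a - p)) by exact: ln_le_mono.
          move=> HH. have : - (2 + e) * ln (Cmod (a - p)) <= - (2 + e) * ln (2 ^ J * r0) by apply: Rmult_le_compat_neg_l => //; lra.
          case=> [H3|->]; [apply: Rlt_le; exact: exp_increasing | exact: Rle_refl].
        - rewrite Rsum_scal.
          have SS := sum_rho_sq l2 p (2 ^ S J * r0).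
          have S' : Rsum (fun a => rho a ^ 2) l2 <= Cp * (2 ^ S J * r0) ^ 2.
          { apply: SS => //.
            - simpl; nra.
            - exact: NoDup_filter.
            - move=> a Ha. have [Hin _] := Hl2 a Ha. have [La Na] := Hl a Hin. split => //. split => //.
              apply: Rlt_le. exact: Hlt. }
          apply: Rle_trans (Rmult_le_compat_l _ _ _ (Rlt_le _ _ (exp_pos _)) S') _.
          apply: Req_le.
          have E1 : exp (- (2 + e) * ln (2 ^ J * r0)) = exp (- e * ln r0) * q ^ J * / ((2 ^ J * r0) ^ 2).
          { have EL : ln (2 ^ J * r0) = INR J * ln 2 + ln r0.
            { rewrite ln_mult // ln_pow //. lra. }
            have -> : / (2 ^ J * r0) ^ 2 = exp (- 2 * ln (2 ^ J * r0)).
            { rewrite -{1}(exp_ln (2 ^ J * r0)) //.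
              replace (- 2 * ln (2 ^ J * r0)) with (- (ln (2 ^ J * r0) + ln (2 ^ J * r0))) by ring.
              rewrite exp_Ropp exp_plus. f_equal. ring. }
            have -> : q ^ J = exp (- e * ln 2 * INR J).
            { rewrite /q -Rpower_pow; last exact: exp_pos. by rewrite /Rpower ln_exp Rmult_comm. }
            rewrite -!exp_plus. f_equal. rewrite EL. ring. }
          rewrite E1. simpl. field. lra. }
      apply: Rle_trans (Rplus_le_compat _ _ _ _ I1 I2) _.
      apply: Req_le. simpl. field. lra. }
  exists (4 * Cp * exp (- e * ln delta) * / (1 - q)).
  have Hi : 0 < / (1 - q) by apply: Rinv_0_lt_compat; lra.
  have E0 := exp_pos (- e * ln delta).
  split; first by apply: Rmult_lt_0_compat => //; apply: Rmult_lt_0_compat => //; lra.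
  move=> p l Hp Hn Hl.
  have Pp := rho_pos p. have Hr0 : 0 < delta * rho p by exact: Rmult_lt_0_compat.
  have [J HJ] : exists J, forall a, In a l -> Cmod (a - p) < 2 ^ J * (delta * rho p).
  { clear Hn Hl. elim: l => [|a l [J HJ]]; first by exists O.
    have [n Hn] := pow2_unbounded (Cmod (a - p) / (delta * rho p)).
    exists (J + n)%nat => b Hb. rewrite pow_add.
    have X : 1 <= 2 ^ J by apply: pow_R1_Rle; lra. have Y : 1 <= 2 ^ n by apply: pow_R1_Rle; lra.
    case: Hb => [<-|Hb].
    - move/(Rlt_div_l _ _ _ Hr0): Hn => Hn. apply: Rlt_le_trans Hn _. apply: Rmult_le_compat_r; nra.
    - apply: Rlt_le_trans (HJ b Hb) _. apply: Rmult_le_compat_r; nra. }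
  apply: Rle_trans (K p l J Hp Hn Hl HJ) _.
  rewrite ln_mult // Rmult_plus_distr_l exp_plus.
  have qJ : 0 < q ^ J by exact: pow_lt.
  have : (1 - q ^ J) / (1 - q) <= / (1 - q).
  { rewrite /Rdiv -{2}(Rmult_1_l (/ (1 - q))). apply: Rmult_le_compat_r; lra. }
  have E3 := exp_pos (- e * ln (rho p)).
  move=> H. apply: Rle_trans (Rmult_le_compat_l _ _ _ _ H) _.
  - apply: Rmult_le_pos; first lra. apply: Rlt_le. exact: Rmult_lt_0_compat.
  - apply: Req_le. ring.
Qed.

(** With [rho a] written as [rho a ^ 2 / rho a], the exponent of [|a - p|] becomes
    [(1/t - 1) - (N + 1) = - (2 + e)] for [e = N - 1/t], as dyadic summation requires. The powers of
    [rho p] add up to [- 1/t - e = - N]. *)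
Theorem sum_rho_pow (N : nat) : 1 / t < INR N -> exists A, 0 < A /\ forall p l, Lam p -> NoDup l ->
  (forall a, In a l -> Lam a /\ a <> p) ->
  Rsum (fun a => rho a / Cmod (a - p) ^ (N + 1)) l <= A / rho p ^ N.
Proof.
  move=> HN. have [[Ht0 Ht1] _] := t_exponent.
  set e := INR N - 1 / t. have He : 0 < e by rewrite /e; lra.
  have [A1 [HA1 I1]] := sum_dyadic e He. have [A2 [HA2 I2]] := inv_rho_bound.
  exists (A1 * A2). split; first exact: Rmult_lt_0_compat.
  move=> p l Hp Hn Hl. have Pp := rho_pos p.
  apply: Rle_trans (_ : Rsum (fun a => A2 * exp (- ln (rho p) / t) * (rho a ^ 2 * exp (- (2 + e) * ln (Cmod (a - p))))) l <= _).
  - apply: Rsum_le => a Ha. have [La Nap] := Hl a Ha. have Pa := rho_pos a.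
    have M : 0 < Cmod (a - p) by exact: Cmod_sub_pos.
    have B := I2 p a Hp La Nap.
    have -> : rho a / Cmod (a - p) ^ (N + 1) = rho a ^ 2 * (/ rho a * exp (- (INR N + 1) * ln (Cmod (a - p)))).
    { have -> : exp (- (INR N + 1) * ln (Cmod (a - p))) = / Cmod (a - p) ^ (N + 1).
      { replace (- (INR N + 1) * ln (Cmod (a - p))) with (- ((INR N + 1) * ln (Cmod (a - p)))) by ring.
        rewrite exp_Ropp. f_equal. rewrite -[INR N + 1]/(INR N + INR 1) -plus_INR -ln_pow // exp_ln //. exact: pow_lt. }
      field. split; last lra. apply: pow_nonzero. lra. }
    replace (A2 * exp (- ln (rho p) / t) * (rho a ^ 2 * exp (- (2 + e) * ln (Cmod (a - p)))))
      with (rho a ^ 2 * (A2 * (exp (- ln (rho p) / t) * exp (- (2 + e) * ln (Cmod (a - p)))))) by ring.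
    apply: Rmult_le_compat_l; first exact: pow2_ge_0.
    apply: Rle_trans (Rmult_le_compat_r _ _ _ (Rlt_le _ _ (exp_pos _)) B) _.
    rewrite Rmult_assoc -!exp_plus. apply: Req_le. do 2 f_equal. rewrite /e. field. lra.
  - rewrite Rsum_scal. have := I1 p l Hp Hn Hl => H.
    have E1 := exp_pos (- ln (rho p) / t).
    apply: Rle_trans (Rmult_le_compat_l _ _ _ _ H) _; first by apply: Rmult_le_pos; lra.
    replace (A2 * exp (- ln (rho p) / t) * (A1 * exp (- e * ln (rho p))))
      with (A1 * A2 * (exp (- ln (rho p) / t) * exp (- e * ln (rho p)))) by ring.
    rewrite -exp_plus. apply: Req_le. rewrite /Rdiv. f_equal.
    rewrite -(exp_ln (rho p ^ N)); last exact: pow_lt. rewrite -exp_Ropp ln_pow //. f_equal. rewrite /e. field. lra.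
Qed.

End Lattice.

(** * Finite sums and the multiplier *)

Lemma Csum_cons (u : C -> C) a l : Csum u (a :: l) = (u a + Csum u l)%C.
Proof. by []. Qed.

Lemma Csum_nil (u : C -> C) : Csum u nil = 0%C.
Proof. by []. Qed.

Lemma Csum_ext (u v : C -> C) l : (forall a, In a l -> u a = v a) -> Csum u l = Csum v l.
Proof.
  elim: l => [|a l IH] H //. rewrite !Csum_cons H; last by left.
  by rewrite IH // => b Hb; apply: H; right.
Qed.

Lemma Csum_plus (u v : C -> C) l : Csum (fun a => u a + v a)%C l = (Csum u l + Csum v l)%C.
Proof. elim: l => [|a l IH]; first by rewrite !Csum_nil; ring. rewrite !Csum_cons IH. ring. Qed.

Lemma Csum_scal k (u : C -> C) l : Csum (fun a => k * u a)%C l = (k * Csum u l)%C.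
Proof. elim: l => [|a l IH]; first by rewrite !Csum_nil; ring. rewrite !Csum_cons IH. ring. Qed.

Lemma Csum_minus (u v : C -> C) l : Csum (fun a => u a - v a)%C l = (Csum u l - Csum v l)%C.
Proof. elim: l => [|a l IH]; first by rewrite !Csum_nil; ring. rewrite !Csum_cons IH. ring. Qed.

Lemma Csum_zero (u : C -> C) l : (forall a, In a l -> u a = 0) -> Csum u l = 0%C.
Proof.
  elim: l => [|a l IH] H //. rewrite Csum_cons H; last by left.
  rewrite IH; first ring. move=> b Hb. apply: H. by right.
Qed.

Lemma Csum_app (u : C -> C) l1 l2 : Csum u (l1 ++ l2) = (Csum u l1 + Csum u l2)%C.
Proof.
  elim: l1 => [|a l IH]; first by rewrite Csum_nil /=; ring.
  rewrite /= !Csum_cons IH. ring.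
Qed.

Lemma Csum_perm (u : C -> C) l1 l2 : Permutation l1 l2 -> Csum u l1 = Csum u l2.
Proof.
  elim=> //.
  - move=> a k1 k2 _ IH. by rewrite !Csum_cons IH.
  - move=> a b k. rewrite !Csum_cons. ring.
  - by move=> k1 k2 k3 _ -> _ ->.
Qed.

Lemma Csum_enumerates (u : C -> C) l1 l2 A : enumerates l1 A -> enumerates l2 A -> Csum u l1 = Csum u l2.
Proof.
  move=> [N1 H1] [N2 H2]. apply: Csum_perm. apply: NoDup_Permutation => // z.
  rewrite H1 H2. by [].
Qed.

Lemma Cmod_Csum_le (u : C -> C) (f : C -> R) l : (forall a, In a l -> Cmod (u a) <= f a) ->
  Cmod (Csum u l) <= Rsum f l.
Proof.
  elim: l => [|a l IH] H; first by rewrite Csum_nil Cmod_0 /Rsum /=; lra.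
  rewrite Csum_cons Rsum_cons. apply: Rle_trans (Cmod_triangle _ _) _.
  apply: Rplus_le_compat; first by apply: H; left. apply: IH => b Hb. apply: H. by right.
Qed.

Lemma Csum_single (u : C -> C) l b : NoDup l -> In b l -> (forall a, In a l -> a <> b -> u a = 0) ->
  Csum u l = u b.
Proof.
  move=> Hn Hb H. have [l1 [l2 E]] := in_split _ _ Hb. rewrite E in Hn H *.
  have N := NoDup_remove_2 _ _ _ Hn.
  rewrite Csum_app Csum_cons !Csum_zero; first ring.
  - move=> a Ha. apply: H; first by apply/in_app_iff; right; right.
    move=> Eab. apply: N. apply/in_app_iff. right. by rewrite -Eab.
  - move=> a Ha. apply: H; first by apply/in_app_iff; left.
    move=> Eab. apply: N. apply/in_app_iff. left. by rewrite -Eab.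
Qed.

Definition decb (P : Prop) : bool := if excluded_middle_informative P then true else false.

Lemma decbP (P : Prop) : decb P = true <-> P.
Proof. rewrite /decb. by case: excluded_middle_informative. Qed.

Lemma enumerates_filter l A B : enumerates l A -> enumerates (filter (fun z => decb (B z)) l) (fun z => A z /\ B z).
Proof.
  move=> [Hn H]. split; first exact: NoDup_filter.
  move=> z. rewrite filter_In decbP H. by [].
Qed.

Lemma enumerates_iff l A B : (forall z, A z <-> B z) -> enumerates l A -> enumerates l B.
Proof. move=> H [Hn HA]. split => // z. by rewrite HA H. Qed.

Lemma Csum_filter_if (u : C -> C) l (B : C -> Prop) :
  Csum (fun z => if excluded_middle_informative (B z) then u z else 0%C) l = Csum u (filter (fun z => decb (B z)) l).
Proof.
  elim: l => [|a l IH] //. rewrite Csum_cons IH /= /decb.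
  case: excluded_middle_informative => H; rewrite ?Csum_cons //. ring.
Qed.

Lemma Csum_split (u : C -> C) l (B : C -> Prop) :
  Csum u l = (Csum u (filter (fun z => decb (B z)) l) + Csum u (filter (fun z => decb (~ B z)) l))%C.
Proof.
  rewrite -!Csum_filter_if -Csum_plus. apply: Csum_ext => a _.
  case: excluded_middle_informative => H; case: excluded_middle_informative => H2; try tauto; ring.
Qed.

(** Two enumerations of the same set are permutations of each other, so any of them may replace
    those hidden in [is_pv]. *)
Lemma is_pv_limit A u s : is_pv A u s -> forall eps, 0 < eps -> exists R0, forall r l, R0 < r ->
  enumerates l (fun z => A z /\ Cmod z < r) -> Cmod (Csum u l - s) < eps.
Proof.
  move=> [L [HL Hlim]] eps He.
  have : Rbar_locally p_infty (fun r => Cmod (Csum u (L r) - s) < eps).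
  { apply: (Hlim (fun w => Cmod (w - s) < eps)). apply/locally_C_iff. by exists eps. }
  case=> R0 HR. exists R0 => r l Hr Hl. rewrite (Csum_enumerates u l (L r) _ Hl (HL r)). exact: HR.
Qed.

Lemma is_pv_intro (A : C -> Prop) u s (L : R -> list C) :
  (forall r, enumerates (L r) (fun z => A z /\ Cmod z < r)) ->
  (forall eps, 0 < eps -> exists R0, forall r, R0 < r -> Cmod (Csum u (L r) - s) < eps) -> is_pv A u s.
Proof.
  move=> HL H. exists L. split => // P /locally_C_iff [d [Hd HP]].
  have [R0 HR] := H d Hd. exists R0 => r Hr. apply: HP. exact: HR.
Qed.

Fixpoint nsum (m : nat) (u : nat -> C) : C :=
  match m with O => 0%C | S k => (nsum k u + u k)%C end.

Lemma nsum_Csum m (u : nat -> C -> C) l : nsum m (fun k => Csum (u k) l) = Csum (fun a => nsum m (fun k => u k a)) l.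
Proof.
  elim: m => [|m IH] /=; first by rewrite Csum_zero.
  by rewrite IH -Csum_plus.
Qed.

Lemma nsum_ext m u v : (forall k, (k < m)%nat -> u k = v k) -> nsum m u = nsum m v.
Proof.
  elim: m => [|m IH] H //=. rewrite IH; last by move=> k Hk; apply: H; lia. by rewrite H; last lia.
Qed.

Lemma nsum_scal m k0 u : nsum m (fun k => k0 * u k)%C = (k0 * nsum m u)%C.
Proof. elim: m => [|m IH] /=; first ring. rewrite IH. ring. Qed.

Fixpoint nsumR (m : nat) (u : nat -> R) : R :=
  match m with O => 0 | S k => nsumR k u + u k end.

Lemma Cmod_nsum_le m u v : (forall k, (k < m)%nat -> Cmod (u k) <= v k) -> Cmod (nsum m u) <= nsumR m v.
Proof.
  elim: m => [|m IH] H /=; first by rewrite Cmod_0; lra.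
  apply: Rle_trans (Cmod_triangle _ _) _. apply: Rplus_le_compat; last by apply: H; lia.
  apply: IH => k Hk. apply: H. lia.
Qed.

(** Finite geometric expansion with exact remainder. The term [- / y] is kept apart because it pairs
    with the compensating [1/l] to form the first principal value; the index [k] stands for the
    exponent [n = k + 2]. *)
Lemma inv_sub_expand (x y : C) m : y <> 0 -> x <> y ->
  (/ (x - y))%C = (- / y - nsum m (fun k => x ^ (k + 1) / y ^ (k + 2)) + x ^ (m + 1) / (y ^ (m + 1) * (x - y)))%C.
Proof.
  move=> Hy Hxy. have D : (x - y)%C <> 0 by exact: Cminus_eq_contra.
  elim: m => [|m IH].
  - simpl. field. by split.
  - rewrite {1}IH /=. have P := Cpow_nz y m Hy. rewrite !Cpow_add_r /=. field. repeat split => //.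
Qed.

(** Cauchy's formula on the circle of radius [|B| + 1], at distance at least 1 from the disc,
    reduces the bound to compactness of the parameter interval. *)
Lemma entire_bounded (f : C -> C) (B : R) : entire f -> exists M, 0 <= M /\ forall z, Cmod z <= B -> Cmod (f z) <= M.
Proof.
  move=> Hf. set r := Rabs B + 1. have Hr : 0 < r by rewrite /r; have := Rabs_pos B; lra.
  have P2 := two_PI_pos.
  have fc : forall z, Ccont f z by move=> z; exact: entire_continuous.
  have cc := cc_gcont _ _ (circle_curve 0 r). have dc := cc_cont _ _ (circle_curve 0 r).
  have c1 : forall th, Rcont (fun th => f (circle 0 r th)) th.
  { move=> th. apply: (continuous_comp (V := C_UniformSpace) (circle 0 r) f); [exact: cc | exact: fc]. }
  have [M [HM0 HM]] := Rcont_bounded _ 0 (2 * PI) (Rlt_le _ _ P2) c1.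
  exists (M * r). split; first nra. move=> w Hw.
  have Hwr : Cmod w < r - 1 + 1 by rewrite /r; have := Rle_abs B; lra.
  have far : forall th, 1 <= Cmod (circle 0 r th - w).
  { move=> th. have := Cmod_triangle_sub (circle 0 r th) w.
    have := Cmod_circle 0 r th (Rlt_le _ _ Hr). replace (circle 0 r th - 0)%C with (circle 0 r th) by ring.
    have := Rle_abs B. rewrite /r. lra. }
  have Hne : forall th, circle 0 r th <> w by move=> th; apply: Cmod_pos_neq; have := far th; lra.
  have := cauchy_C1 _ _ (circle_curve 0 r) f (C_derive f) w (proj1 (entire_Cderiv f) Hf) (fun z => entire_C_derive_cont f z Hf) Hne.
  rewrite circle_winding; last lra. move=> E.
  have B1 : Cmod (CInt (fun th => f (circle 0 r th) * (dcircle r th / (circle 0 r th - w)))%C 0 (2 * PI)) <= (2 * PI - 0) * (M * r).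
  { apply: CInt_norm_le; first lra.
    - move=> th _. apply: Ccont_mult => //. apply: Ccont_div; [exact: Cminus_eq_contra | exact: dc |].
      apply: Ccont_minus; [exact: cc | exact: Ccont_const].
    - move=> th Hth. rewrite Cmod_mult. apply: Rmult_le_compat; try exact: Cmod_ge_0; first exact: HM.
      have F := far th.
      rewrite Cmod_div; last exact: Cminus_eq_contra.
      rewrite /dcircle !Cmod_mult Cmod_Ci Cmod_cis Cmod_RtoC_pos; last lra.
      apply/(Rle_div_l _ _ _); first lra. nra. }
  rewrite E !Cmod_mult Cmod_Ci !Cmod_R in B1.
  rewrite (Rabs_pos_eq 2) in B1; last lra. rewrite (Rabs_pos_eq PI) in B1; last by have := PI_RGT_0; lra.
  apply: (Rmult_le_reg_r (2 * PI)) => //. lra.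
Qed.

(** * The multiplier near its zeros *)

Section Multiplier.
Variables (phi rho : C -> R) (g : C -> C) (delta dmax ga gb : R).
Hypothesis phi_cont : forall z, continuous (T := C_UniformSpace) phi z.
Hypothesis rho_pos : forall z, 0 < rho z.
Hypothesis rho_lip : forall z w, rho w <= rho z + Cmod (z - w).
Hypothesis g_entire : entire g.
Hypothesis delta_pos : 0 < delta.
Hypothesis g_sep : forall a b, zeros g a -> zeros g b -> a <> b -> delta * Rmax (rho a) (rho b) <= Cmod (a - b).
Hypothesis ga_pos : 0 < ga.
Hypothesis g_lower : forall z, ga * (exp (phi z) * dist_set rho z (zeros g)) <= Cmod (g z).
Hypothesis g_zero : zeros g 0%C.

(** In the logarithmic bound the radius is taken at the zero [m], the end point at which separation
    measures distances. *)
Lemma dist_zeros_ge z kap : 0 <= kap -> (forall m, zeros g m -> kap * rho m <= Cmod (z - m)) ->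
  ln (1 + kap) <= dist_set rho z (zeros g).
Proof.
  move=> Hk H. apply: (dist_set_ge rho (zeros g) z 0%C) => // m Hm.
  apply: Rle_trans (dist_ge_ln rho rho_pos rho_lip m z m (or_intror eq_refl)).
  have P := rho_pos m. apply: ln_le_mono; first lra.
  have : kap <= Cmod (z - m) / rho m; last lra.
  apply/(Rle_div_r _ _ _ P). exact: H.
Qed.

Lemma ln_1p_half x : 0 <= x <= 1 -> x / 2 <= ln (1 + x).
Proof.
  move=> Hx. apply: Rnot_lt_le => H.
  have := exp_increasing _ _ H. rewrite exp_ln; last lra.
  have H2 := exp_ineq1_le (- (x / 2)). rewrite exp_Ropp in H2.
  have E := exp_pos (x / 2).
  have : exp (x / 2) * (1 - x / 2) <= 1.
  { apply: Rle_trans (Rmult_le_compat_l _ _ _ (Rlt_le _ _ E) _) _; last by apply: Req_le; apply: Rinv_r; lra. lra. }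
  nra.
Qed.

(** At [z = l + h] the lower estimate for [|g|] is compared with the linear part of [g]. For small
    [h] every zero [mu] satisfies [|z - mu| >= (h / rho l) * rho mu], so the distance to the zero
    set is at least [h / (2 * rho l)]. *)
Lemma g_deriv_lower l : zeros g l -> ga / 2 * (exp (phi l) / rho l) <= Cmod (C_derive g l).
Proof.
  move=> Hl. have P := rho_pos l. apply: Rnot_lt_le => H.
  set m := ga / 2 * (exp (phi l) / rho l) in H *.
  set kap := (Cmod (C_derive g l) + m) / 2.
  have Hk : 0 < kap - Cmod (C_derive g l) by rewrite /kap; lra.
  have D := proj1 (entire_Cderiv g) g_entire l _ Hk.
  have HC : locally (T := C_UniformSpace) l (fun z => kap < ga / 2 * (exp (phi z) / rho l)).
  { have cont : continuous (T := C_UniformSpace) (fun z => ga / 2 * (exp (phi z) / rho l)) l.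
    { apply: (continuous_mult (K := R_AbsRing)); first exact: continuous_const.
      apply: (continuous_mult (K := R_AbsRing)); last exact: continuous_const.
      apply: (continuous_comp phi exp); [exact: phi_cont |].
      apply: (ex_derive_continuous (V := R_NormedModule)). eexists. exact: is_derive_exp. }
    apply: (cont (fun v => kap < v)). apply: open_gt. rewrite -/m /kap. lra. }
  have /locally_C_iff [d1 [Hd1 D1]] := D. have /locally_C_iff [d2 [Hd2 D2]] := HC.
  (* Small enough for four purposes: the linearization of [g], the continuity of [phi], [h <= rho l]
     for the bound on the logarithm, and [h <= delta / 2 * rho l] so that no other zero is
     relatively closer than [l]. *)
  set h := Rmin (Rmin d1 d2 / 2) (Rmin 1 (delta / 2) * rho l).
  have Hm0 : 0 < Rmin d1 d2 by exact: Rmin_glb_lt.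
  have Hm1 : 0 < Rmin 1 (delta / 2) by apply: Rmin_glb_lt; lra.
  have Hh : 0 < h by apply: Rmin_glb_lt; [lra | exact: Rmult_lt_0_compat].
  have Hh1 : h < d1. { have : h <= Rmin d1 d2 / 2 by exact: Rmin_l. have := Rmin_l d1 d2. lra. }
  have Hh2 : h < d2. { have : h <= Rmin d1 d2 / 2 by exact: Rmin_l. have := Rmin_r d1 d2. lra. }
  have Hh3 : h <= rho l. { have : h <= Rmin 1 (delta / 2) * rho l by exact: Rmin_r. have := Rmin_l 1 (delta / 2). nra. }
  have Hh4 : h <= delta / 2 * rho l. { have : h <= Rmin 1 (delta / 2) * rho l by exact: Rmin_r. have := Rmin_r 1 (delta / 2). nra. }
  pose z := (l + RtoC h)%C.
  have Dz : Cmod (z - l) = h.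
  { replace (z - l)%C with (RtoC h) by (rewrite /z; ring). apply: Cmod_RtoC_pos. lra. }
  have B1 := D1 z ltac:(rewrite Dz; lra). have B2 := D2 z ltac:(rewrite Dz; lra).
  have gl0 : g l = 0 := Hl. cbv beta in B1.
  rewrite gl0 Dz in B1.
  have B3 : Cmod (g z) <= kap * h.
  { replace (g z) with ((g z - 0 - C_derive g l * (z - l)) + C_derive g l * (z - l))%C by ring.
    apply: Rle_trans (Cmod_triangle _ _) _. rewrite Cmod_mult Dz. lra. }
  have B4 : h / rho l / 2 <= dist_set rho z (zeros g).
  { apply: Rle_trans (ln_1p_half (h / rho l) _) _.
    - split; first by apply: Rdiv_le_0_compat; lra. apply/(Rle_div_l _ _ _ P). lra.
    - apply: dist_zeros_ge; first by apply: Rdiv_le_0_compat; lra.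
      move=> mu Hmu. have Pm := rho_pos mu. case: (Ceq_dec mu l) => [->|Hne].
      + rewrite Dz. apply: Req_le. field. lra.
      + have S1 := g_sep mu l Hmu Hl Hne. have M1 := Rmax_l (rho mu) (rho l). have M2 := Rmax_r (rho mu) (rho l).
        have T := Cmod_triangle3 mu z l. rewrite Dz (Cmod_sub_sym mu z) in T.
        have X : h / rho l <= delta / 2 by apply/(Rle_div_l _ _ _ P).
        have : h / rho l * rho mu <= delta / 2 * rho mu by apply: Rmult_le_compat_r; lra.
        nra. }
  have B5 := g_lower z. have E := exp_pos (phi z).
  have B6 : ga * (exp (phi z) * (h / rho l / 2)) <= kap * h.
  { apply: Rle_trans B3. apply: Rle_trans B5. apply: Rmult_le_compat_l; first lra. apply: Rmult_le_compat_l => //. lra. }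
  have B7 : ga * (exp (phi z) * (h / rho l / 2)) = (ga / 2 * (exp (phi z) / rho l)) * h by field; lra.
  nra.
Qed.

Lemma g_deriv_neq_0 l : zeros g l -> C_derive g l <> 0%C.
Proof.
  move=> Hl. apply/Cmod_gt_0. apply: Rlt_le_trans (g_deriv_lower l Hl).
  apply: Rmult_lt_0_compat; first lra. apply: Rdiv_lt_0_compat; [exact: exp_pos | exact: rho_pos].
Qed.

Lemma coef_bound (c : C -> C) (M : R) : (forall l, zeros g l -> Cmod (c l) * exp (- phi l) <= M) ->
  forall l, zeros g l -> Cmod (c l / C_derive g l) <= 2 * M / ga * rho l.
Proof.
  move=> HM l Hl. have P := rho_pos l. have E := exp_pos (phi l).
  have N := g_deriv_neq_0 l Hl. have D := g_deriv_lower l Hl.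
  rewrite Cmod_div //. apply/(Rle_div_l _ _ _); first by apply/Cmod_gt_0.
  have := HM l Hl. rewrite exp_Ropp => H.
  have H2 : Cmod (c l) <= M * exp (phi l) by apply/(Rle_div_l _ _ _ E).
  have M0 : 0 <= M.
  { apply: Rle_trans H. apply: Rmult_le_pos; first exact: Cmod_ge_0. apply: Rlt_le. exact: Rinv_0_lt_compat. }
  apply: Rle_trans H2 _.
  apply: Rle_trans (Rmult_le_compat_l _ _ _ _ D); last first.
  { apply: Rmult_le_pos; last lra. apply: Rdiv_le_0_compat; lra. }
  apply: Req_le. field. lra.
Qed.

(** The factor [exp (phi z)] cancels between the growth of [f] and the lower estimate for [g],
    leaving a constant that depends on the relative distance [kap] only. *)
Lemma quotient_bound (f : C -> C) (M kap : R) z : 0 < kap ->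
  (forall z, Cmod (f z) * exp (- phi z) <= M) -> (forall m, zeros g m -> kap * rho m <= Cmod (z - m)) ->
  g z <> 0%C /\ Cmod (f z / g z) <= M / (ga * ln (1 + kap)).
Proof.
  move=> Hk Hf Hz. have E := exp_pos (phi z).
  have L : 0 < ln (1 + kap) by rewrite -ln_1; apply: ln_increasing; lra.
  have D := dist_zeros_ge z kap (Rlt_le _ _ Hk) Hz.
  have Hg : ga * (exp (phi z) * ln (1 + kap)) <= Cmod (g z).
  { apply: Rle_trans (g_lower z). apply: Rmult_le_compat_l; first lra. apply: Rmult_le_compat_l; lra. }
  have gl : 0 < ga * ln (1 + kap) by exact: Rmult_lt_0_compat.
  have Hg0 : 0 < ga * (exp (phi z) * ln (1 + kap)) by apply: Rmult_lt_0_compat => //; exact: Rmult_lt_0_compat.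
  have N : g z <> 0%C by apply/Cmod_gt_0; lra.
  split => //. rewrite Cmod_div //. apply/(Rle_div_l _ _ _); first lra.
  have := Hf z. rewrite exp_Ropp => H.
  have H2 : Cmod (f z) <= M * exp (phi z) by apply/(Rle_div_l _ _ _ E).
  have M0 : 0 <= M.
  { apply: Rle_trans H. apply: Rmult_le_pos; first exact: Cmod_ge_0. apply: Rlt_le. exact: Rinv_0_lt_compat. }
  apply: Rle_trans H2 _.
  apply: Rle_trans (Rmult_le_compat_l _ _ _ _ Hg); last by apply: Rdiv_le_0_compat.
  apply: Req_le. field. lra.
Qed.

End Multiplier.

(** * Interpolation from bounded principal values *)

Notation em := excluded_middle_informative.

Lemma nsum_zero m (u : nat -> C) : (forall k, (k < m)%nat -> u k = 0) -> nsum m u = 0%C.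
Proof.
  elim: m => [|m IH] H //=. rewrite IH; last by move=> k Hk; apply: H; lia.
  rewrite H; last lia. ring.
Qed.

Lemma nsumR_const_le m u b : (forall k, (k < m)%nat -> u k <= b) -> nsumR m u <= INR m * b.
Proof.
  elim: m => [|m IH] H; first by simpl; lra.
  rewrite S_INR. simpl nsumR. have := IH (fun k Hk => H k ltac:(lia)). have := H m ltac:(lia). lra.
Qed.

Lemma eventually_forall_lt (m : nat) (P : nat -> R -> Prop) :
  (forall k, (k < m)%nat -> exists R0, forall r, R0 < r -> P k r) ->
  exists R0, forall r, R0 < r -> forall k, (k < m)%nat -> P k r.
Proof.
  elim: m => [|m IH] H; first by exists 0 => r _ k Hk; lia.
  have [R1 H1] := IH (fun k Hk => H k ltac:(lia)). have [R2 H2] := H m ltac:(lia).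
  exists (Rmax R1 R2) => r Hr k Hk.
  have A := Rmax_l R1 R2. have B := Rmax_r R1 R2.
  case: (Nat.eq_dec k m) => [->|Hne]; [apply: H2; lra | apply: H1; [lra | lia]].
Qed.

Lemma list_Cmod_bound (l : list C) : exists B, forall a, In a l -> Cmod a <= B.
Proof.
  elim: l => [|a l [B HB]]; first by exists 0.
  exists (Rmax (Cmod a) B) => b [<-|Hb]; first exact: Rmax_l. apply: Rle_trans (HB b Hb) _. exact: Rmax_r.
Qed.

Lemma list_argmin (f : C -> R) (l : list C) a0 : exists b, In b (a0 :: l) /\ forall a, In a (a0 :: l) -> f b <= f a.
Proof.
  elim: l a0 => [|a l IH] a0.
  - exists a0. split; first by left. move=> b [<-|[]]. lra.
  - have [b [Hb H]] := IH a.
    case: (Rle_lt_dec (f a0) (f b)) => Hc.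
    + exists a0. split; first by left. move=> x [<-|Hx]; first lra. have := H x Hx. lra.
    + exists b. split; first by right. move=> x [<-|Hx]; first lra. exact: H.
Qed.

Lemma C_seq_limit (u : nat -> C) : (forall eps, 0 < eps -> exists n0, forall n k, (n0 <= n)%nat -> (n0 <= k)%nat -> Cmod (u n - u k) < eps) ->
  exists l, forall eps, 0 < eps -> exists n0, forall n, (n0 <= n)%nat -> Cmod (u n - l) < eps.
Proof.
  move=> H.
  have C1 : ex_finite_lim_seq (fun n => fst (u n)).
  { apply/ex_lim_seq_cauchy_corr => eps. have [n0 Hn] := H eps (cond_pos eps). exists n0 => n k A B.
    apply: Rle_lt_trans (Hn n k A B). exact: (Rabs_fst_le_Cmod (u n - u k)). }
  have C2 : ex_finite_lim_seq (fun n => snd (u n)).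
  { apply/ex_lim_seq_cauchy_corr => eps. have [n0 Hn] := H eps (cond_pos eps). exists n0 => n k A B.
    apply: Rle_lt_trans (Hn n k A B). exact: (Rabs_snd_le_Cmod (u n - u k)). }
  case: C1 => x Hx. case: C2 => y Hy. exists (x, y) => eps He.
  have He2 : 0 < eps / 2 by lra.
  have [n1 H1] := proj2 (is_lim_seq_spec _ _) Hx (mkposreal _ He2).
  have [n2 H2] := proj2 (is_lim_seq_spec _ _) Hy (mkposreal _ He2).
  exists (Nat.max n1 n2) => n Hn. apply: Rle_lt_trans (Cmod_Re_Im _) _. simpl.
  have A := H1 n ltac:(lia). have B := H2 n ltac:(lia). simpl in A, B. rewrite /Rminus in A B. lra.
Qed.

Lemma entire_scal_fun (k : C) f : entire f -> entire (fun z => k * f z)%C.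
Proof.
  move=> /entire_Cderiv H. apply: (entire_intro _ (fun z => k * C_derive f z)%C) => z. exact: deriv_scal.
Qed.

Lemma entire_plus_fun f h : entire f -> entire h -> entire (fun z => f z + h z)%C.
Proof.
  move=> /entire_Cderiv Hf /entire_Cderiv Hh.
  apply: (entire_intro _ (fun z => C_derive f z + C_derive h z)%C) => z. exact: deriv_plus.
Qed.

Lemma entire_Csum (u : C -> C -> C) l : (forall a, In a l -> entire (u a)) -> entire (fun z => Csum (fun a => u a z) l).
Proof.
  elim: l => [|a l IH] H.
  - apply: (entire_intro _ (fun _ => RtoC 0)) => z. exact: deriv_const.
  - apply: entire_plus_fun; first by apply: H; left. apply: IH => b Hb. apply: H. by right.
Qed.

Section Converse.
Variables (phi rho : C -> R) (g : C -> C) (t delta dmax ga gb : R).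
Hypothesis phi_cont : forall z, continuous (T := C_UniformSpace) phi z.
Hypothesis rho_pos : forall z, 0 < rho z.
Hypothesis rho_lip : forall z w, rho w <= rho z + Cmod (z - w).
Hypothesis t_exponent : growth_exponent rho t.
Hypothesis g_entire : entire g.
Hypothesis delta_pos : 0 < delta.
Hypothesis g_sep : forall a b, zeros g a -> zeros g b -> a <> b -> delta * Rmax (rho a) (rho b) <= Cmod (a - b).
Hypothesis d_max : forall z, dist_set rho z (zeros g) <= dmax.
Hypothesis ga_pos : 0 < ga.
Hypothesis gb_pos : 0 < gb.
Hypothesis g_lower : forall z, ga * (exp (phi z) * dist_set rho z (zeros g)) <= Cmod (g z).
Hypothesis g_upper : forall z, Cmod (g z) <= gb * (exp (phi z) * dist_set rho z (zeros g)).
Hypothesis g_zero : zeros g 0%C.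

Variables (L : R -> list C).
Hypothesis HL : forall r, enumerates (L r) (fun z => zeros g z /\ Cmod z < r).

Lemma L_in r z : In z (L r) <-> zeros g z /\ Cmod z < r.
Proof. exact: (proj2 (HL r) z). Qed.

(** A sum over part of the zeros becomes a sum over all of [L r] whose terms are 0 outside that
    part; sums over different parts can then be added term by term. *)
Lemma pv_limit_if (B : C -> Prop) (u v : C -> C) s :
  is_pv (fun l => zeros g l /\ B l) u s -> (forall l, zeros g l -> B l -> u l = v l) ->
  forall eps, 0 < eps -> exists R0, forall r, R0 < r ->
    Cmod (Csum (fun z => if em (B z) then v z else 0%C) (L r) - s) < eps.
Proof.
  move=> H Huv eps He. have [R0 HR] := is_pv_limit _ _ _ H eps He.
  exists R0 => r Hr. rewrite Csum_filter_if.
  rewrite -(Csum_ext u).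
  - apply: (HR r) => //. apply: enumerates_iff (enumerates_filter _ _ B (HL r)) => z. tauto.
  - move=> z /filter_In [/L_in [Hz _] /decbP Hb]. exact: Huv.
Qed.

Definition tail (r r' : R) := filter (fun z => decb (~ Cmod z < r)) (L r').

Lemma tail_in r r' z : In z (tail r r') <-> zeros g z /\ Cmod z < r' /\ r <= Cmod z.
Proof.
  rewrite /tail filter_In decbP L_in. split.
  - case=> [[A B] H]. repeat split => //. lra.
  - case=> A [B H]. repeat split => //. lra.
Qed.

Lemma Csum_tail u r r' : r <= r' -> Csum u (L r') = (Csum u (L r) + Csum u (tail r r'))%C.
Proof.
  move=> Hr. rewrite (Csum_split u (L r') (fun z => Cmod z < r)). f_equal.
  apply: Csum_enumerates (HL r).
  apply: enumerates_iff (enumerates_filter _ _ (fun z => Cmod z < r) (HL r')) => z. split.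
  - tauto.
  - move=> [A B]. repeat split => //. lra.
Qed.

(** Finite sums over the nonzero zeros are bounded, hence have a supremum. A finite list coming
    within [eps] of it leaves at most [eps] to any list disjoint from it, in particular to zeros
    outside a large disc. *)
Lemma tail_sum_small (N : nat) : 1 / t < INR N -> forall eps, 0 < eps -> exists R0, 0 < R0 /\ forall r r', R0 < r ->
  Rsum (fun a => rho a / Cmod a ^ (N + 1)) (tail r r') <= eps.
Proof.
  move=> HN eps He.
  have [A [HA Hsum]] := sum_rho_pow rho t delta (zeros g) rho_pos rho_lip t_exponent delta_pos g_sep N HN.
  set w := fun a => rho a / Cmod a ^ (N + 1).
  pose E := fun x => exists l, NoDup l /\ (forall a, In a l -> zeros g a /\ a <> 0%C) /\ x = Rsum w l.
  have bE : bound E.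
  { exists (A / rho 0 ^ N). move=> x [l [Hn [Hl ->]]].
    have := Hsum 0%C l g_zero Hn Hl. rewrite (Rsum_ext _ w) //.
    move=> a _. rewrite /w. by replace (a - 0)%C with a by ring. }
  have [S [HS1 HS2]] := completeness E bE (ex_intro _ (Rsum w nil) (ex_intro _ nil (conj (NoDup_nil _) (conj (fun a Ha => False_ind _ Ha) eq_refl)))).
  have [l0 [Hn0 [Hl0 Hs0]]] : exists l, NoDup l /\ (forall a, In a l -> zeros g a /\ a <> 0%C) /\ S - eps < Rsum w l.
  { apply: NNPP => HNot. have : S <= S - eps; last lra.
    apply: HS2 => x [l [Hn [Hl ->]]]. apply: Rnot_lt_le => Hlt. apply: HNot. by exists l. }
  have [B HB] := list_Cmod_bound l0.
  exists (Rmax B 1). split; first by have := Rmax_r B 1; lra.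
  move=> r r' Hr. have B1 := Rmax_l B 1. have B2 := Rmax_r B 1.
  have disj : forall a, In a (tail r r') -> ~ In a l0.
  { move=> a /tail_in [_ [_ Ha]] Hin. have := HB a Hin. lra. }
  have Rapp : forall l1 l2, Rsum w (l1 ++ l2) = Rsum w l1 + Rsum w l2.
  { elim=> [|a l1 IH] l2; first by rewrite /Rsum /=; lra. rewrite /= !Rsum_cons IH. lra. }
  have : Rsum w (l0 ++ tail r r') <= S.
  { apply: HS1. exists (l0 ++ tail r r'). split; last split => //.
    - apply: NoDup_app => //; first by apply: NoDup_filter; exact: (proj1 (HL r')).
      move=> a Ha Ht. exact: (disj a Ht).
    - move=> a /in_app_iff [Ha|/tail_in [Hz [_ Ha]]]; first exact: Hl0.
      split => // Ea. move: Ha. rewrite Ea Cmod_0. lra. }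
  rewrite Rapp. lra.
Qed.

(** The entire function [g(z) / (z - l)], with value [g'(l)] at [l]. Through it the partial sums of
    the series are entire and can be evaluated at the zeros themselves. *)
Definition gq (l : C) : C -> C :=
  epsilon (inhabits g) (fun q => entire q /\ (forall z, g z = ((z - l) * q z)%C) /\ q l = C_derive g l).

Lemma gq_spec l : zeros g l -> entire (gq l) /\ (forall z, g z = ((z - l) * gq l z)%C) /\ gq l l = C_derive g l.
Proof.
  move=> Hl. apply: (epsilon_spec (inhabits g) (fun q => entire q /\ (forall z, g z = ((z - l) * q z)%C) /\ q l = C_derive g l)).
  exact: entire_divide.
Qed.

Lemma gq_div l z : zeros g l -> z <> l -> gq l z = (g z * / (z - l))%C.
Proof.
  move=> Hl Hz. have [_ [E _]] := gq_spec l Hl. rewrite E. field. exact: Cminus_eq_contra.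
Qed.

Variables (c : C -> C) (Mc : R).
Hypothesis Hc1 : forall l, zeros g l -> Cmod (c l) * exp (- phi l) <= Mc.
Let a (l : C) : C := (c l / C_derive g l)%C.
Let A := 2 * Mc / ga.

Lemma a_bound l : zeros g l -> Cmod (a l) <= A * rho l.
Proof. exact: (coef_bound phi rho g delta ga). Qed.

Lemma A_ge0 : 0 <= A.
Proof.
  have := a_bound 0%C g_zero. have := Cmod_ge_0 (a 0%C). have := rho_pos 0%C. nra.
Qed.

(** The compensating term [1/l] of the series, omitted for the zero at 0. *)
Definition inv_nz (l : C) : C := if em (l <> 0%C) then (/ l)%C else 0%C.

Definition partial (r : R) (z : C) : C := Csum (fun l => a l * (gq l z + g z * inv_nz l))%C (L r).

Lemma partial_entire r : entire (partial r).
Proof.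
  apply: (entire_Csum (fun l z => a l * (gq l z + g z * inv_nz l))%C) => l /L_in [Hl _].
  apply: entire_scal_fun. apply: entire_plus_fun; first exact: (proj1 (gq_spec l Hl)).
  have := entire_scal_fun (inv_nz l) g g_entire. move=> H z.
  have [d Hd] := H z. exists d. apply: is_derive_ext Hd => w. exact: Cmult_comm.
Qed.

Lemma partial_value r l : zeros g l -> Cmod l < r -> partial r l = c l.
Proof.
  move=> Hl Hr. have gl : g l = 0 := Hl.
  rewrite /partial (Csum_single _ _ l).
  - have [_ [_ ->]] := gq_spec l Hl. rewrite gl /a. field.
    exact: (g_deriv_neq_0 phi rho g delta ga).
  - exact: (proj1 (HL r)).
  - by apply/L_in.
  - move=> m /L_in [Hm _] Hne. rewrite gq_div //; last by move=> E; apply: Hne; rewrite E.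
    rewrite gl. ring.
Qed.

Variables (m : nat).
Hypothesis Hm : 1 / t < INR (S m).
Hypothesis Hc3 : forall k, (k < m)%nat -> exists M, forall l', zeros g l' -> exists s,
  is_pv (fun l => zeros g l /\ l <> l') (fun l => (c l / (C_derive g l * (l - l') ^ (k + 2)))%C) s /\
  Cmod (RtoC (rho l' ^ (k + 1)) * s)%C <= M.

(** Set to 0 at [l = l'] so that every sum runs over [L r]. With [N = m + 1], the indices [k < m]
    cover the exponents [k + 2] from 2 to [N]. *)
Definition T1 (l' : C) (k : nat) (l : C) : C := if em (l <> l') then (a l / (l - l') ^ (k + 2))%C else 0%C.

Lemma T1_limit k : (k < m)%nat -> exists M, forall l', zeros g l' -> exists s,
  (forall eps, 0 < eps -> exists R0, forall r, R0 < r -> Cmod (Csum (T1 l' k) (L r) - s) < eps) /\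
  Cmod (RtoC (rho l' ^ (k + 1)) * s)%C <= M.
Proof.
  move=> Hk. have [M HM] := Hc3 k Hk. exists M => l' Hl'. have [s [Hs1 Hs2]] := HM l' Hl'.
  exists s. split => //. apply: (pv_limit_if (fun l => l <> l')) Hs1 _ => l Hl Hne.
  rewrite /a. field.
  split; first [exact: (g_deriv_neq_0 phi rho g delta ga) | apply: Cpow_nz; exact: Cminus_eq_contra].
Qed.

(** Expansion about 0: the compensating [1/l] cancels the term of order 0, and the next ones belong
    to the principal values at 0. *)
Lemma partial_tail_term l z : zeros g l -> l <> 0%C -> z <> l ->
  (a l * (gq l z + g z * inv_nz l))%C =
  (g z * (a l * (z ^ (m + 1) / (l ^ (m + 1) * (z - l))) - nsum m (fun k => z ^ (k + 1) * T1 0 k l)))%C.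
Proof.
  move=> Hl H0 Hz. rewrite gq_div // /inv_nz. case: em => // _.
  rewrite (inv_sub_expand z l m H0 Hz).
  rewrite (nsum_ext m (fun k => z ^ (k + 1) * T1 0 k l)%C (fun k => a l * (z ^ (k + 1) / l ^ (k + 2)))%C).
  - rewrite nsum_scal. ring.
  - move=> k _. rewrite /T1. case: em => // _. replace (l - 0)%C with l by ring. field. exact: Cpow_nz.
Qed.

(** A piece of the tail splits into [m] differences of partial sums of the principal values at 0,
    small because these converge, and a remainder summed absolutely. Both estimates are uniform for
    bounded [z]. *)
Lemma partial_cauchy (B eps : R) : 0 < eps -> exists R0, forall r r' z, R0 < r -> r <= r' -> Cmod z <= B ->
  Cmod (partial r' z - partial r z) <= eps.
Proof.
  move=> He. have [G [HG0 HG]] := entire_bounded g B g_entire.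
  have A0 := A_ge0.
  set X := (Rabs B + 1) ^ (m + 1). have HB1 : 1 <= Rabs B + 1 by have := Rabs_pos B; lra.
  have HX : 1 <= X by exact: pow_R1_Rle.
  set D := (G + 1) * (INR m * X + 2 * A * X + 1).
  have HmX : 0 <= INR m * X by apply: Rmult_le_pos; [exact: pos_INR | lra].
  have HAX : 0 <= 2 * A * X by apply: Rmult_le_pos; lra.
  have HD : 0 < D by apply: Rmult_lt_0_compat; lra.
  set eta := eps / D. have Heta : 0 < eta by exact: Rdiv_lt_0_compat.
  have [R1 [HR1 H1]] := tail_sum_small (S m) Hm eta Heta.
  have [R2 H2] : exists R0, forall r, R0 < r -> forall k, (k < m)%nat ->
      exists s, forall r', r <= r' -> Cmod (Csum (T1 0 k) (L r') - s) < eta / 2 /\ Cmod (Csum (T1 0 k) (L r) - s) < eta / 2.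
  { apply: (eventually_forall_lt m (fun k r => exists s, forall r', r <= r' -> Cmod (Csum (T1 0 k) (L r') - s) < eta / 2 /\ Cmod (Csum (T1 0 k) (L r) - s) < eta / 2)).
    move=> k Hk. have [M HM] := T1_limit k Hk. have [s [Hs _]] := HM 0%C g_zero.
    have [R0 HR] := Hs (eta / 2) ltac:(lra). exists R0 => r Hr. exists s => r' Hr'. split; apply: HR; lra. }
  (* [2 * |B| + 1] forces [|l| >= 2 * |z|] on the tail, hence [|z - l| >= |l| / 2]. *)
  exists (Rmax (Rmax R1 R2) (2 * Rabs B + 1)) => r r' z Hr Hrr Hz.
  have Q1 := Rmax_l (Rmax R1 R2) (2 * Rabs B + 1). have Q2 := Rmax_r (Rmax R1 R2) (2 * Rabs B + 1).
  have Q3 := Rmax_l R1 R2. have Q4 := Rmax_r R1 R2.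
  have absB := Rle_abs B. have absB0 := Rabs_pos B.
  have far : forall l, In l (tail r r') -> zeros g l /\ l <> 0%C /\ z <> l /\ Cmod l / 2 <= Cmod (z - l) /\ 0 < Cmod l.
  { move=> l /tail_in [Hl [_ Hle]].
    have P : Cmod l / 2 <= Cmod (z - l) by have := Cmod_triangle_sub l z; rewrite Cmod_sub_sym; lra.
    have P0 : 0 < Cmod l by lra.
    repeat split => //; first by apply/Cmod_gt_0. apply: Cmod_pos_neq. lra. }
  rewrite /partial (Csum_tail _ r r' Hrr).
  set S0 := Csum _ (L r). replace (S0 + Csum _ (tail r r') - S0)%C with (Csum (fun l => a l * (gq l z + g z * inv_nz l))%C (tail r r')) by ring.
  rewrite (Csum_ext _ (fun l => g z * (a l * (z ^ (m + 1) / (l ^ (m + 1) * (z - l))) - nsum m (fun k => z ^ (k + 1) * T1 0 k l)))%C);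
    last by move=> l Hl; have [F1 [F2 [F3 _]]] := far l Hl; exact: partial_tail_term.
  rewrite Csum_scal Csum_minus -(nsum_Csum m (fun k l => z ^ (k + 1) * T1 0 k l)%C) Cmod_mult.
  have Zp : forall k, (k <= m)%nat -> Cmod z ^ (k + 1) <= X.
  { move=> k Hk. apply: Rle_trans (_ : (Rabs B + 1) ^ (k + 1) <= _).
    - apply: pow_incr. split; [exact: Cmod_ge_0 | lra].
    - apply: Rle_pow => //. lia. }
  have E1 : Cmod (Csum (fun l => a l * (z ^ (m + 1) / (l ^ (m + 1) * (z - l))))%C (tail r r')) <= 2 * A * X * eta.
  { apply: Rle_trans (_ : Rsum (fun l => 2 * A * X * (rho l / Cmod l ^ (S m + 1))) (tail r r') <= _).
    - apply: Cmod_Csum_le => l Hl. have [F1 [F2 [F3 [F4 F5]]]] := far l Hl.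
      have Dn : (l ^ (m + 1) * (z - l))%C <> 0 by apply: Cmult_neq_0; [exact: Cpow_nz | exact: Cminus_eq_contra].
      rewrite Cmod_mult Cmod_div // Cmod_mult !Cmod_pow.
      have Pl : 0 < Cmod l ^ (m + 1) by exact: pow_lt.
      apply: Rle_trans (_ : (A * rho l) * (X / (Cmod l ^ (m + 1) * (Cmod l / 2))) <= _).
      + apply: Rmult_le_compat; [exact: Cmod_ge_0 | | exact: a_bound |].
        * apply: Rdiv_le_0_compat; first by apply: pow_le; exact: Cmod_ge_0. apply: Rmult_lt_0_compat => //. lra.
        * apply: Rmult_le_compat.
          -- apply: pow_le. exact: Cmod_ge_0.
          -- apply: Rlt_le. apply: Rinv_0_lt_compat. apply: Rmult_lt_0_compat => //. lra.
          -- exact: Zp.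
          -- apply: Rinv_le_contravar; first by apply: Rmult_lt_0_compat => //; lra. apply: Rmult_le_compat_l => //. lra.
      + apply: Req_le. simpl. field. split; lra.
    - rewrite Rsum_scal. apply: Rmult_le_compat_l => //. apply: H1. lra. }
  have E2 : Cmod (nsum m (fun k => Csum (fun l => z ^ (k + 1) * T1 0 k l)%C (tail r r'))) <= INR m * (X * eta).
  { apply: Rle_trans (nsumR_const_le m (fun _ => X * eta) (X * eta) (fun _ _ => Rle_refl _)).
    apply: Cmod_nsum_le => k Hk. rewrite Csum_scal Cmod_mult Cmod_pow.
    apply: Rmult_le_compat; [apply: pow_le; exact: Cmod_ge_0 | exact: Cmod_ge_0 | by apply: Zp; lia |].
    have [s Hs] := H2 r ltac:(lra) k Hk. have [Z1 Z2] := Hs r' Hrr.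
    have -> : Csum (T1 0 k) (tail r r') = (Csum (T1 0 k) (L r') - Csum (T1 0 k) (L r))%C by rewrite (Csum_tail _ r r' Hrr); ring.
    have := Cmod_triangle3 (Csum (T1 0 k) (L r')) s (Csum (T1 0 k) (L r)). rewrite (Cmod_sub_sym s). lra. }
  set Y1 := Csum _ _ in E1 *. set Y2 := nsum _ _ in E2 *.
  have T := Cmod_triangle Y1 (- Y2). rewrite Cmod_opp in T.
  have HGz := HG z Hz.
  apply: Rle_trans (_ : (G + 1) * ((INR m * X + 2 * A * X + 1) * eta) <= _).
  - apply: Rmult_le_compat; [exact: Cmod_ge_0 | exact: Cmod_ge_0 | lra |]. rewrite /Cminus. lra.
  - apply: Req_le. rewrite /eta /D. field. split; lra.
Qed.

(** * Growth of the interpolating function *)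

Hypothesis Hc2 : exists M, forall l', zeros g l' -> l' <> 0%C -> exists s,
  is_pv (fun l => zeros g l /\ l <> l' /\ l <> 0%C) (fun l => (a l * (1 / (l - l') - 1 / l))%C) s /\
  Cmod (- (c 0 / (C_derive g 0 * l')) + s)%C <= M.

(** 0 is a zero, and those of modulus at least [2 * |z| + 1] are farther from [z] than 0 is; a
    finite list remains to be searched. *)
Lemma closest_zero z : exists l', zeros g l' /\ forall l, zeros g l -> Cmod (z - l') <= Cmod (z - l).
Proof.
  set r := 2 * Cmod z + 1. have Z0 := Cmod_ge_0 z.
  have [b [Hb H]] := list_argmin (fun l => Cmod (z - l)) (L r) 0%C.
  exists b. split.
  - case: Hb => [<-|/L_in [Hb _]] //.
  - move=> l Hl. case: (Rlt_le_dec (Cmod l) r) => Hr.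
    + apply: H. right. by apply/L_in.
    + apply: Rle_trans (H 0%C (or_introl eq_refl)) _. replace (z - 0)%C with z by ring.
      have := Cmod_triangle_sub l z. rewrite (Cmod_sub_sym l). rewrite /r in Hr. lra.
Qed.

(** Bounded distance to the zero set gives a zero [l] with [ln (1 + |z - l| / rho z) < dmax + 1],
    the 1 paying for an infimum that need not be attained. The nearest zero is no farther, and at
    bounded relative distance [rho z] is controlled by [rho l']. *)
Lemma closest_zero_bound : exists B, 0 < B /\ forall z l', (forall l, zeros g l -> Cmod (z - l') <= Cmod (z - l)) ->
  Cmod (z - l') <= B * rho l'.
Proof.
  set B0 := exp (dmax + 1). have HB0 : 0 < B0 by exact: exp_pos.
  have [B' [HB' HH]] := rho_comparable rho t rho_pos rho_lip t_exponent B0 (Rlt_le _ _ HB0).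
  exists (B0 * B'). split; first exact: Rmult_lt_0_compat.
  move=> z l' Hmin. have Pz := rho_pos z. have Pl := rho_pos l'.
  have [l [Hl Hd]] := dist_set_approx rho rho_pos rho_lip (zeros g) z 0%C 1 g_zero Rlt_0_1.
  have X := dist_ge_ln rho rho_pos rho_lip z z l (or_introl eq_refl).
  have Y := d_max z.
  have W : ln (1 + Cmod (z - l) / rho z) < dmax + 1 by lra.
  have Z : Cmod (z - l) <= B0 * rho z.
  { have H0 : 0 <= Cmod (z - l) / rho z by apply: Rdiv_le_0_compat => //; exact: Cmod_ge_0.
    have := exp_increasing _ _ W. rewrite exp_ln; last lra. rewrite -/B0 => E.
    apply/(Rle_div_l _ _ _ Pz). lra. }
  have Z2 : Cmod (z - l') <= B0 * rho z by apply: Rle_trans (Hmin l Hl) Z.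
  have := HH z l' Z2. nra.
Qed.

(** Pieces of [a l * (1/(z - l) + 1/l)] expanded about [l']: [T2] is the remainder, [T3] the term of
    the first principal value, [T4a] the unexpanded term of [l = l']. [T4b] is what [l = 0],
    excluded from [T3], contributes at order 0, namely [a 0 / l']; this is the origin of the
    isolated term in the second condition. *)
Definition T2 (l' z l : C) : C :=
  if em (l <> l') then (a l * ((z - l') ^ (m + 1) / ((l - l') ^ (m + 1) * (z - l))))%C else 0%C.
Definition T3 (l' l : C) : C :=
  if em (l <> l' /\ l <> 0%C) then (a l * (1 / (l - l') - 1 / l))%C else 0%C.
Definition T4a (l' z l : C) : C :=
  if em (l <> l') then 0%C else (a l * (/ (z - l') + inv_nz l))%C.
Definition T4b (l' l : C) : C :=
  if em (l <> l') then (if em (l <> 0%C) then 0%C else (a l / l')%C) else 0%C.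

Lemma partial_term l l' z : zeros g l -> zeros g l' -> g z <> 0%C ->
  (a l * (gq l z + g z * inv_nz l))%C =
  (g z * (T4a l' z l + T4b l' l - T3 l' l + T2 l' z l - nsum m (fun k => (z - l') ^ (k + 1) * T1 l' k l)))%C.
Proof.
  move=> Hl Hl' Hz.
  have Hzl : z <> l by move=> E; apply: Hz; rewrite E.
  have Hzl' : z <> l' by move=> E; apply: Hz; rewrite E.
  rewrite gq_div // /T4a /T4b /T3 /T2.
  case: em => [Hne|Heq].
  - have Hy : (l - l')%C <> 0 by exact: Cminus_eq_contra.
    have Exp := inv_sub_expand (z - l') (l - l') m Hy.
    replace (z - l' - (l - l'))%C with (z - l)%C in Exp by ring.
    rewrite Exp; last by move=> E; apply: Hzl; replace z with (z - l' + l')%C by ring; rewrite E; ring.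
    rewrite (nsum_ext m (fun k => (z - l') ^ (k + 1) * T1 l' k l)%C (fun k => a l * ((z - l') ^ (k + 1) / (l - l') ^ (k + 2)))%C).
    + rewrite nsum_scal /inv_nz.
      case: (em (l <> 0%C)) => [H0|H0].
      * case: em => [_|H]; last by exfalso; apply: H. rewrite /Cdiv. ring.
      * have El : l = 0%C by apply: NNPP.
        case: em => [[_ H]|_] //. rewrite El. rewrite El in Hne.
        have Hl0 : l' <> 0%C by move=> E; apply: Hne; rewrite E.
        replace (0 - l')%C with (- l')%C by ring.
        set NS := nsum _ _. set Q := ((z - l') ^ (m + 1) / _)%C.
        replace (/ (- l'))%C with (- / l')%C by (field => //). rewrite /Cdiv. ring.
    + move=> k _. rewrite /T1. case: em => // _. field. exact: Cpow_nz.
  - have El : l = l' by apply: NNPP.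
    rewrite nsum_zero; last by move=> k _; rewrite /T1; case: em => // _; ring.
    case: em => [[H _]|_] //. rewrite El. ring.
Qed.

(** Apart from the pole [a l' / (z - l')] there remain, for [l' <> 0], [a l' / l'], bounded by
    separation from 0, and the negative of the quantity in the second condition, up to an error 1
    once [r] is large. *)
Lemma near_part_bound : exists Q, 0 <= Q /\ forall z l', zeros g l' -> g z <> 0%C -> exists R0, forall r, R0 < r ->
  Cmod (Csum (T4a l' z) (L r) + Csum (T4b l') (L r) - Csum (T3 l') (L r)) <= A * rho l' / Cmod (z - l') + Q.
Proof.
  have [M2 H2] := Hc2. have A0 := A_ge0.
  have Q0 : 0 <= A / delta by apply: Rdiv_le_0_compat.
  exists (A / delta + (Rabs M2 + 1)). split; first by have := Rabs_pos M2; lra.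
  move=> z l' Hl' Hz.
  have Hzl' : z <> l' by move=> E; apply: Hz; rewrite E.
  have Hzm : 0 < Cmod (z - l') by exact: Cmod_sub_pos.
  have S4a : forall r, Cmod l' < r -> Csum (T4a l' z) (L r) = (a l' * (/ (z - l') + inv_nz l'))%C.
  { move=> r Hr. rewrite (Csum_single _ _ l').
    - rewrite /T4a. case: em => //.
    - exact: (proj1 (HL r)).
    - by apply/L_in.
    - move=> l _ Hne. rewrite /T4a. by case: em. }
  have S4b : forall r, 0 < r -> Csum (T4b l') (L r) = T4b l' 0%C.
  { move=> r Hr. rewrite (Csum_single _ _ 0%C) //.
    - exact: (proj1 (HL r)).
    - apply/L_in. by rewrite Cmod_0.
    - move=> l _ Hne. rewrite /T4b. case: em => // _. by case: em. }
  have B1 : Cmod (a l' * / (z - l'))%C <= A * rho l' / Cmod (z - l').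
  { rewrite Cmod_mult Cmod_inv; last exact: Cminus_eq_contra.
    apply: Rmult_le_compat_r; last exact: a_bound. apply: Rlt_le. exact: Rinv_0_lt_compat. }
  case: (Ceq_dec l' 0%C) => [E0|N0].
  - exists (Rmax 0 (Cmod l')) => r Hr. have := Rmax_l 0 (Cmod l'). have := Rmax_r 0 (Cmod l') => X1 X2.
    rewrite S4a; last lra. rewrite S4b; last lra.
    have -> : T4b l' 0%C = 0%C by rewrite /T4b E0; case: em.
    rewrite (Csum_zero (T3 l')).
    + have -> : inv_nz l' = 0%C by rewrite /inv_nz E0; case: em.
      replace (a l' * (/ (z - l') + 0) + 0 - 0)%C with (a l' * / (z - l'))%C by ring.
      have := Rabs_pos M2. lra.
    + move=> l _. rewrite /T3. case: em => // [[_ H]]. rewrite E0.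
      replace (l - 0)%C with l by ring. ring.
  - have [s [Hs1 Hs2]] := H2 l' Hl' N0.
    have [R0 HR0] := pv_limit_if (fun l => l <> l' /\ l <> 0%C) _ (fun l => (a l * (1 / (l - l') - 1 / l))%C) s Hs1 (fun l _ _ => eq_refl) 1 Rlt_0_1.
    exists (Rmax R0 (Rmax 0 (Cmod l'))) => r Hr.
    have X1 := Rmax_l R0 (Rmax 0 (Cmod l')). have X2 := Rmax_r R0 (Rmax 0 (Cmod l')).
    have X3 := Rmax_l 0 (Cmod l'). have X4 := Rmax_r 0 (Cmod l').
    rewrite S4a; last lra. rewrite S4b; last lra.
    have := HR0 r ltac:(lra). rewrite -/(T3 l') => S3.
    have -> : T4b l' 0%C = (c 0 / (C_derive g 0 * l'))%C.
    { rewrite /T4b. case: em => [_|H]; last by exfalso; apply: H => E; apply: N0; rewrite E.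
      case: em => [H|_]; first by exfalso; apply: H.
      rewrite /a. field. split => //. exact: (g_deriv_neq_0 phi rho g delta ga). }
    have -> : inv_nz l' = (/ l')%C by rewrite /inv_nz; case: em.
    set K := (c 0 / (C_derive g 0 * l'))%C in Hs2 *.
    change (fun z0 : C => if em (z0 <> l' /\ z0 <> 0) then (a z0 * (1 / (z0 - l') - 1 / z0))%C else 0%C) with (T3 l') in S3.
    set V := Csum (T3 l') (L r) in S3 *.
    replace (a l' * (/ (z - l') + / l') + K - V)%C with (a l' * / (z - l') + (a l' * / l' - ((- K + s) + (V - s))))%C by ring.
    apply: Rle_trans (Cmod_triangle _ _) _.
    have B2 : Cmod (a l' * / l')%C <= A / delta.
    { rewrite Cmod_mult Cmod_inv //. have Pl : 0 < Cmod l' by apply/Cmod_gt_0.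
      have Sp := proj1 (rho_le_sep rho delta (zeros g) delta_pos g_sep l' 0%C Hl' g_zero N0).
      replace (l' - 0)%C with l' in Sp by ring.
      apply: Rle_trans (Rmult_le_compat_r _ _ _ _ (a_bound l' Hl')) _; first by apply: Rlt_le; exact: Rinv_0_lt_compat.
      apply/(Rle_div_l _ _ _ Pl). apply: (Rmult_le_reg_l delta) => //.
      replace (delta * (A / delta * Cmod l')) with (A * Cmod l') by (field; lra). nra. }
    have T1' := Cmod_minus_le (a l' * / l') ((- K + s) + (V - s)).
    have T2' := Cmod_triangle (- K + s) (V - s).
    have := Rle_abs M2. lra.
Qed.

(** [R0] depends on [z] but [K] does not, which is enough for the pointwise limit. The factor
    [dist_set] in the upper estimate for [|g|] absorbs the pole at the nearest zero. *)
Lemma partial_bound : exists K, forall z, g z <> 0%C -> exists R0, forall r, R0 < r ->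
  Cmod (partial r z) <= K * exp (phi z).
Proof.
  have [B [HB0 HB]] := closest_zero_bound.
  have [Q [HQ0 HQ]] := near_part_bound.
  have A0 := A_ge0.
  have [W [HW0 HW]] := sum_rho_pow rho t delta (zeros g) rho_pos rho_lip t_exponent delta_pos g_sep (S m) Hm.
  have [M1 HM1] : exists M, 0 <= M /\ forall k, (k < m)%nat -> forall l', zeros g l' -> exists s,
     (forall eps, 0 < eps -> exists R0, forall r, R0 < r -> Cmod (Csum (T1 l' k) (L r) - s) < eps) /\ Cmod (RtoC (rho l' ^ (k + 1)) * s)%C <= M.
  { have gen : forall j, (j <= m)%nat -> exists M, 0 <= M /\ forall k, (k < j)%nat -> forall l', zeros g l' -> exists s,
     (forall eps, 0 < eps -> exists R0, forall r, R0 < r -> Cmod (Csum (T1 l' k) (L r) - s) < eps) /\ Cmod (RtoC (rho l' ^ (k + 1)) * s)%C <= M.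
    { elim=> [|j IH] Hj; first by exists 0; split; [lra | move=> k Hk; lia].
      have [M [HM0 HM]] := IH ltac:(lia). have [M' HM'] := T1_limit j ltac:(lia).
      exists (Rmax M M'). have X1 := Rmax_l M M'. have X2 := Rmax_r M M'. split; first lra.
      move=> k Hk l' Hl'. case: (Nat.eq_dec k j) => [->|Hne].
      - have [s [Hs1 Hs2]] := HM' l' Hl'. exists s. split => //. lra.
      - have [s [Hs1 Hs2]] := HM k ltac:(lia) l' Hl'. exists s. split => //. lra. }
    exact: (gen m (Nat.le_refl _)). }
  case: HM1 => HM10 HM1.
  set Bm := (B + 1) ^ (m + 1).
  have HBm : 1 <= Bm by apply: pow_R1_Rle; lra.
  set K1 := INR m * (Bm * (M1 + 1)) + 2 * A * Bm * W.
  have HK1 : 0 <= K1.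
  { apply: Rplus_le_le_0_compat.
    - apply: Rmult_le_pos; [exact: pos_INR | apply: Rmult_le_pos; lra].
    - apply: Rmult_le_pos; last lra. apply: Rmult_le_pos; lra. }
  have D0 : 0 <= dmax.
  { apply: Rle_trans (d_max 0%C). apply: (dist_set_ge rho (zeros g) 0%C 0%C) => // w _. exact: dist_ge0. }
  exists (gb * (2 * A * (dmax + 1) + dmax * (Q + K1))).
  move=> z Hz. have [l' [Hl' Hmin]] := closest_zero z.
  have HBz := HB z l' Hmin. have Pl := rho_pos l'.
  have Hzl' : z <> l' by move=> E; apply: Hz; rewrite E.
  have Hzm : 0 < Cmod (z - l') by exact: Cmod_sub_pos.
  have [R1 H1] := HQ z l' Hl' Hz.
  have [R2 H2] : exists R0, forall r, R0 < r -> forall k, (k < m)%nat -> rho l' ^ (k + 1) * Cmod (Csum (T1 l' k) (L r)) <= M1 + 1.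
  { apply: (eventually_forall_lt m (fun k r => rho l' ^ (k + 1) * Cmod (Csum (T1 l' k) (L r)) <= M1 + 1)) => k Hk.
    have Pk : 0 < rho l' ^ (k + 1) by exact: pow_lt.
    have [s [Hs1 Hs2]] := HM1 k Hk l' Hl'. have [R0 HR0] := Hs1 (/ rho l' ^ (k + 1)) (Rinv_0_lt_compat _ Pk).
    exists R0 => r Hr. have := HR0 r Hr. set V := Csum _ _. move=> HV.
    have T := Cmod_triangle_sub V s. rewrite Cmod_mult Cmod_RtoC_pos in Hs2; last lra.
    have : rho l' ^ (k + 1) * Cmod (V - s) <= 1.
    { apply: Rle_trans (Rmult_le_compat_l _ _ _ (Rlt_le _ _ Pk) (Rlt_le _ _ HV)) _. apply: Req_le. field. lra. }
    nra. }
  exists (Rmax R1 R2) => r Hr. have X1 := Rmax_l R1 R2. have X2 := Rmax_r R1 R2.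
  rewrite /partial.
  rewrite (Csum_ext _ (fun l => g z * (T4a l' z l + T4b l' l - T3 l' l + T2 l' z l - nsum m (fun k => (z - l') ^ (k + 1) * T1 l' k l)))%C);
    last by move=> l /L_in [Hl _]; exact: partial_term.
  rewrite Csum_scal Csum_minus Csum_plus Csum_minus Csum_plus -(nsum_Csum m (fun k l => (z - l') ^ (k + 1) * T1 l' k l)%C) Cmod_mult.
  have N1 := H1 r ltac:(lra).
  have Zp : forall k, (k <= m)%nat -> Cmod (z - l') ^ (k + 1) <= Bm * rho l' ^ (k + 1).
  { move=> k Hk. apply: Rle_trans (_ : ((B + 1) * rho l') ^ (k + 1) <= _).
    - apply: pow_incr. split; [exact: Cmod_ge_0 | nra].
    - rewrite Rpow_mult_distr. apply: Rmult_le_compat_r; first by apply: Rlt_le; exact: pow_lt.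
      apply: Rle_pow; [lra | lia]. }
  have N2 : Cmod (nsum m (fun k => Csum (fun l => (z - l') ^ (k + 1) * T1 l' k l)%C (L r))) <= INR m * (Bm * (M1 + 1)).
  { apply: Rle_trans (nsumR_const_le m (fun _ => Bm * (M1 + 1)) (Bm * (M1 + 1)) (fun _ _ => Rle_refl _)).
    apply: Cmod_nsum_le => k Hk. rewrite Csum_scal Cmod_mult Cmod_pow.
    apply: Rle_trans (Rmult_le_compat_r _ _ _ (Cmod_ge_0 _) (Zp k ltac:(lia))) _.
    rewrite Rmult_assoc. apply: Rmult_le_compat_l; first lra. apply: H2 => //. lra. }
  have N3 : Cmod (Csum (T2 l' z) (L r)) <= 2 * A * Bm * W.
  { have -> : Csum (T2 l' z) (L r) = Csum (fun l => (a l * ((z - l') ^ (m + 1) / ((l - l') ^ (m + 1) * (z - l))))%C) (filter (fun l => decb (l <> l')) (L r)).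
    { exact: (Csum_filter_if (fun l => (a l * ((z - l') ^ (m + 1) / ((l - l') ^ (m + 1) * (z - l))))%C)). }
    set l2 := filter _ _.
    have Hl2 : forall l, In l l2 -> zeros g l /\ l <> l'.
    { move=> l /filter_In [/L_in [Hl _] /decbP Hne]. by split. }
    have Pm : 0 < rho l' ^ (m + 1) by exact: pow_lt.
    apply: Rle_trans (_ : Rsum (fun l => 2 * A * (Bm * rho l' ^ (m + 1)) * (rho l / Cmod (l - l') ^ (S m + 1))) l2 <= _).
    - apply: Cmod_Csum_le => l Hl. have [Zl Nl] := Hl2 l Hl.
      have Hzl : z <> l by move=> E; apply: Hz; rewrite E.
      have Ml : 0 < Cmod (l - l') by exact: Cmod_sub_pos.
      (* As [l'] is nearest to [z], [|l - l'| <= |l - z| + |z - l'| <= 2 * |z - l|]; the remainder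
         is thus measured from [l']. *)
      have Half : Cmod (l - l') / 2 <= Cmod (z - l).
      { have := Hmin l Zl. have := Cmod_triangle3 l z l'. rewrite (Cmod_sub_sym l z). lra. }
      have Dn : ((l - l') ^ (m + 1) * (z - l))%C <> 0.
      { apply: Cmult_neq_0; last exact: Cminus_eq_contra. apply: Cpow_nz. exact: Cminus_eq_contra. }
      rewrite Cmod_mult Cmod_div // Cmod_mult !Cmod_pow.
      have Pp : 0 < Cmod (l - l') ^ (m + 1) by exact: pow_lt.
      apply: Rle_trans (_ : (A * rho l) * ((Bm * rho l' ^ (m + 1)) / (Cmod (l - l') ^ (m + 1) * (Cmod (l - l') / 2))) <= _).
      + apply: Rmult_le_compat; [exact: Cmod_ge_0 | | exact: a_bound |].
        * apply: Rdiv_le_0_compat; first by apply: pow_le; exact: Cmod_ge_0. apply: Rmult_lt_0_compat => //. lra.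
        * apply: Rmult_le_compat.
          -- apply: pow_le. exact: Cmod_ge_0.
          -- apply: Rlt_le. apply: Rinv_0_lt_compat. apply: Rmult_lt_0_compat => //. lra.
          -- exact: Zp.
          -- apply: Rinv_le_contravar; first by apply: Rmult_lt_0_compat => //; lra. apply: Rmult_le_compat_l; lra.
      + apply: Req_le. simpl. field. split; lra.
    - rewrite Rsum_scal.
      have H := HW l' l2 Hl' (NoDup_filter _ (proj1 (HL r))) Hl2.
      apply: Rle_trans (Rmult_le_compat_l _ _ _ _ H) _.
      + apply: Rmult_le_pos; [lra | apply: Rmult_le_pos; lra].
      + apply: Req_le. replace (m + 1)%nat with (S m) by lia. field. replace (S m) with (m + 1)%nat by lia. lra. }
  set V1 := (Csum (T4a l' z) (L r) + Csum (T4b l') (L r) - Csum (T3 l') (L r))%C in N1 *.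
  set V2 := Csum (T2 l' z) (L r) in N3 *. set V3 := nsum _ _ in N2 *.
  have T : Cmod (V1 + V2 - V3) <= A * rho l' / Cmod (z - l') + Q + K1.
  { have U1 := Cmod_minus_le (V1 + V2) V3. have U2 := Cmod_triangle V1 V2.
    rewrite /K1. lra. }
  set dz := dist_set rho z (zeros g).
  have dz0 : 0 <= dz by apply: (dist_set_ge rho (zeros g) z 0%C) => // w _; exact: dist_ge0.
  have dz1 : dz <= dmax by exact: d_max.
  (* Within [rho l' / 2] of the zero the distance is at most [2 * |z - l'| / rho l'], which cancels
     the pole; farther away the pole term itself is at most [2 * A]. *)
  have dz2 : dz * (A * rho l' / Cmod (z - l')) <= 2 * A * (dmax + 1).
  { case: (Rle_lt_dec (Cmod (z - l')) (rho l' / 2)) => Hn.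
    - have D1 := Rle_trans _ _ _ (dist_set_le rho rho_pos rho_lip (zeros g) z l' Hl') (dist_le_near rho rho_pos rho_lip z l' Hn).
      apply: Rle_trans (Rmult_le_compat_r _ _ _ _ D1) _.
      + apply: Rdiv_le_0_compat => //. apply: Rmult_le_pos; lra.
      + replace (2 * Cmod (z - l') / rho l' * (A * rho l' / Cmod (z - l'))) with (2 * A) by (field; lra). nra.
    - have : A * rho l' / Cmod (z - l') <= 2 * A.
      { apply/(Rle_div_l _ _ _ Hzm). nra. }
      move=> HH. have HA2 : 0 <= A * rho l' / Cmod (z - l') by apply: Rdiv_le_0_compat => //; apply: Rmult_le_pos; lra.
      apply: Rle_trans (Rmult_le_compat _ _ _ _ dz0 HA2 dz1 HH) _. nra. }
  have E := exp_pos (phi z).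
  apply: Rle_trans (Rmult_le_compat _ _ _ _ (Cmod_ge_0 _) (Cmod_ge_0 _) (g_upper z) T) _.
  rewrite -/dz.
  replace (gb * (exp (phi z) * dz) * (A * rho l' / Cmod (z - l') + Q + K1))
    with (gb * (dz * (A * rho l' / Cmod (z - l')) + dz * (Q + K1)) * exp (phi z)) by ring.
  apply: Rmult_le_compat_r; first lra. apply: Rmult_le_compat_l; first lra.
  apply: Rplus_le_compat => //. apply: Rmult_le_compat_r; lra.
Qed.

Theorem interpolation_exists : exists f, Fock_infty phi f /\ forall l, zeros g l -> f l = c l.
Proof.
  have Lim : forall z, exists w, forall eps, 0 < eps -> exists n0, forall n, (n0 <= n)%nat -> Cmod (partial (INR n) z - w) < eps.
  { move=> z. apply: C_seq_limit => eps He.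
    have [R0 HR] := partial_cauchy (Cmod z) (eps / 2) ltac:(lra).
    have [n0 Hn0] := INR_unbounded R0.
    exists n0 => n k Hn Hk.
    have In' : R0 < INR n by apply: Rlt_le_trans Hn0 _; exact: le_INR.
    have Ik' : R0 < INR k by apply: Rlt_le_trans Hn0 _; exact: le_INR.
    case: (Nat.le_ge_cases n k) => Hnk.
    - have := HR (INR n) (INR k) z In' (le_INR _ _ Hnk) (Rle_refl _). rewrite Cmod_sub_sym. lra.
    - have := HR (INR k) (INR n) z Ik' (le_INR _ _ Hnk) (Rle_refl _). lra. }
  pose f := fun z => epsilon (inhabits (RtoC 0)) (fun w => forall eps, 0 < eps -> exists n0, forall n, (n0 <= n)%nat -> Cmod (partial (INR n) z - w) < eps).
  have Hf : forall z eps, 0 < eps -> exists n0, forall n, (n0 <= n)%nat -> Cmod (partial (INR n) z - f z) < eps.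
  { move=> z. exact: (epsilon_spec (inhabits (RtoC 0)) _ (Lim z)). }
  (* The second radius in [partial_cauchy] may depend on [z]: it is taken large enough for the
     pointwise limit, while the first one stays uniform. *)
  have Huni : forall B eps, 0 < eps -> exists n, forall z, Cmod z <= B -> Cmod (partial (INR n) z - f z) <= eps.
  { move=> B eps He. have [R0 HR] := partial_cauchy B (eps / 2) ltac:(lra).
    have [n Hn] := INR_unbounded R0. exists n => z Hz.
    have [n1 Hn1] := Hf z (eps / 2) ltac:(lra).
    set k := Nat.max n n1.
    have Y := Hn1 k ltac:(lia). have X := HR (INR n) (INR k) z Hn (le_INR _ _ (Nat.le_max_l _ _)) Hz.
    have T := Cmod_triangle3 (partial (INR n) z) (partial (INR k) z) (f z).
    rewrite (Cmod_sub_sym (partial (INR n) z) (partial (INR k) z)) in T. lra. }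
  have fval : forall l, zeros g l -> f l = c l.
  { move=> l Hl. apply/Ceq_minus. apply: Cmod_eq_0. apply: Rle_antisym; last exact: Cmod_ge_0.
    apply: Rnot_lt_le => Hlt.
    have [n0 Hn0] := Hf l _ Hlt. have [n1 Hn1] := INR_unbounded (Cmod l).
    have := Hn0 (Nat.max n0 n1) (Nat.le_max_l _ _).
    rewrite partial_value //; first by rewrite (Cmod_sub_sym (c l)); lra.
    apply: Rlt_le_trans Hn1 _. apply: le_INR. exact: Nat.le_max_r. }
  exists f. split; last exact: fval. split.
  - apply: entire_unif_limit Huni => n. exact: partial_entire.
  - have [K HK] := partial_bound.
    (* [Mc] serves at the zeros of [g], where [f] takes the values [c] and [partial_bound] is
       silent. *)
    exists (Rmax K Mc) => z.
    have [M1 M2] := (Rmax_l K Mc, Rmax_r K Mc).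
    case: (Ceq_dec (g z) 0%C) => Hz.
    + rewrite fval //. apply: Rle_trans (Hc1 z Hz) M2.
    + have E := exp_pos (phi z). rewrite exp_Ropp. apply/(Rle_div_l _ _ _ E).
      apply: Rle_trans (_ : K * exp (phi z) <= _); last by apply: Rmult_le_compat_r; lra.
      have [R0 HR] := HK z Hz.
      apply: Rnot_lt_le => Hlt.
      have Hgap : 0 < Cmod (f z) - K * exp (phi z) by lra.
      have [n0 Hn0] := Hf z _ Hgap. have [n1 Hn1] := INR_unbounded R0.
      set n := Nat.max n0 n1.
      have X := Hn0 n (Nat.le_max_l _ _).
      have Y := HR (INR n) (Rlt_le_trans _ _ _ Hn1 (le_INR _ _ (Nat.le_max_r _ _))).
      have := Cmod_triangle_sub (f z) (partial (INR n) z). rewrite (Cmod_sub_sym (f z) (partial (INR n) z)). lra.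
Qed.

End Converse.

(** * A contour around the zeros in a disc *)

Lemma Rsum_single_at f l b : NoDup l -> In b l -> (forall a, In a l -> a <> b -> f a = 0) -> Rsum f l = f b.
Proof.
  elim: l => [|a l IH] Hn Hb H //. rewrite Rsum_cons.
  case: (proj1 (NoDup_cons_iff a l) Hn) => Ha Hl.
  case: (Ceq_dec a b) => [E|E].
  - rewrite -E Rsum_zero; first ring. move=> d Hd. apply: H; first by right.
    move=> Ed. apply: Ha. by rewrite E -Ed.
  - rewrite (H a (or_introl eq_refl) E) IH //; first ring.
    + by case: Hb.
    + move=> d Hd. apply: H. by right.
Qed.

(** Its square is of class C^1 and vanishes on the negative half-line, which yields localized bumps
    smooth enough for a closed curve. *)
Definition pos_part (x : R) : R := Rmax 0 x.

Lemma pos_part_cont x : continuous pos_part x.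
Proof.
  apply: (continuous_ext (fun x => (x + Rabs x) / 2)).
  - move=> y. rewrite /pos_part /Rmax /Rabs. case: Rle_dec => H; case: Rcase_abs => H2; lra.
  - apply: (continuous_mult (K := R_AbsRing)); last exact: continuous_const.
    apply: (continuous_plus (V := R_NormedModule)); [exact: continuous_id | exact: continuous_Rabs].
Qed.

Lemma pos_part_sq_deriv x : is_derive (fun x => pos_part x ^ 2) x (2 * pos_part x).
Proof.
  split; first exact: is_linear_scal_l.
  move=> y Hy. have <- := is_filter_lim_locally_unique _ _ Hy. move=> eps.
  have He := cond_pos eps.
  apply/locally_R_iff. exists eps. split => // w Hw.
  rewrite /norm /= /abs /= /minus /plus /opp /scal /= /mult /=.
  replace (pos_part w * (pos_part w * 1) + - (pos_part x * (pos_part x * 1)) + - ((w + - x) * (2 * pos_part x)))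
    with (pos_part w ^ 2 - pos_part x ^ 2 - 2 * pos_part x * (w - x)) by ring.
  replace (w + - x) with (w - x) by ring.
  have K : Rabs (pos_part w ^ 2 - pos_part x ^ 2 - 2 * pos_part x * (w - x)) <= (w - x) ^ 2.
  { have h1 := pow2_ge_0 (w - x). have h2 := pow2_ge_0 x. have h3 := pow2_ge_0 w.
    have h4 : 0 <= w -> ~ 0 <= x -> 0 <= w * - x by move=> A B; apply: Rmult_le_pos; lra.
    have h5 : ~ 0 <= w -> 0 <= x -> 0 <= - w * x by move=> A B; apply: Rmult_le_pos; lra.
    rewrite /pos_part /Rmax. case: Rle_dec => H1; case: Rle_dec => H2; apply: Rabs_le; split; try nra.
    all: try (have := h4 H1 H2; nra). all: have := h5 H1 H2; nra. }
  apply: Rle_trans K _. rewrite -(pow2_abs (w - x)).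
  have := Rabs_pos (w - x). nra.
Qed.

Section Contour.
Variables (rho : C -> R) (Z : C -> Prop) (delta rad : R) (l : list C).
Hypothesis rho_pos : forall z, 0 < rho z.
Hypothesis delta_pos : 0 < delta.
Hypothesis Z_sep : forall a b, Z a -> Z b -> a <> b -> delta * Rmax (rho a) (rho b) <= Cmod (a - b).
Hypothesis Z0 : Z 0%C.
Hypothesis R_pos : 0 < rad.
Hypothesis R_large : delta / 4 * rho 0%C <= rad.
Hypothesis l_enum : enumerates l (fun z => Z z /\ Cmod z < 2 * rad).

Let s (z : C) : R := delta / 4 * rho z.
(* Zeros in the open disc are kept inside the contour, the others outside. *)
Let sgn (z : C) : R := if Rlt_dec (Cmod z) rad then 1 else -1.
Let p (th : R) : C := (RtoC rad * cis th)%C.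
Let u (z : C) (th : R) : R := ((rad * cos th - fst z) ^ 2 + (rad * sin th - snd z) ^ 2) / s z ^ 2.
Let du (z : C) (th : R) : R := (2 * (rad * cos th - fst z) * (- (rad * sin th)) + 2 * (rad * sin th - snd z) * (rad * cos th)) / s z ^ 2.
(** [u z th] is the squared distance from the circle point [p th] to [z] in units of [s z], so the
    bump acts only where that distance is below [s z]. Its height [s z / 4] suffices to get clear of
    [z] and is small against the gap of at least [4 * s z] to the other zeros. *)
Let bump (z : C) (th : R) : R := sgn z * (s z / 4) * pos_part (1 - u z th) ^ 2.
Let dbump (z : C) (th : R) : R := sgn z * (s z / 4) * (- du z th * (2 * pos_part (1 - u z th))).

Definition radius (th : R) : R := rad + Rsum (fun z => bump z th) l.
Definition dradius (th : R) : R := Rsum (fun z => dbump z th) l.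
Definition contour (th : R) : C := (RtoC (radius th) * cis th)%C.
Definition dcontour (th : R) : C := (RtoC (dradius th) * cis th + RtoC (radius th) * (Ci * cis th))%C.

Lemma s_pos z : 0 < s z.
Proof. apply: Rmult_lt_0_compat => //. lra. Qed.

Lemma u_deriv z th : is_derive (u z) th (du z th).
Proof. have := s_pos z => Hs. rewrite /u /du. auto_derive => //. field. lra. Qed.

Lemma bump_deriv z th : is_derive (bump z) th (dbump z th).
Proof.
  rewrite /bump /dbump.
  apply: (is_derive_scal (fun th => pos_part (1 - u z th) ^ 2)).
  have D : is_derive (fun th => 1 - u z th) th (- du z th).
  { have := is_derive_minus (V := R_NormedModule) _ _ _ _ _ (is_derive_const (V := R_NormedModule) 1 th) (u_deriv z th).
    by rewrite /minus plus_zero_l. }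
  exact: (is_derive_comp (fun x => pos_part x ^ 2) (fun th => 1 - u z th) th _ _ (pos_part_sq_deriv _) D).
Qed.

Lemma dbump_cont z th : continuous (dbump z) th.
Proof.
  have Hs := s_pos z.
  apply: (continuous_mult (K := R_AbsRing)); first exact: continuous_const.
  apply: (continuous_mult (K := R_AbsRing)).
  - apply: (ex_derive_continuous (V := R_NormedModule)). rewrite /du. auto_derive. by [].
  - apply: (continuous_mult (K := R_AbsRing)); first exact: continuous_const.
    apply: (continuous_comp (fun th => 1 - u z th) pos_part); last exact: pos_part_cont.
    apply: (continuous_minus (V := R_NormedModule)); first exact: continuous_const.
    apply: (ex_derive_continuous (V := R_NormedModule)). eexists. exact: u_deriv.
Qed.

Lemma Rsum_deriv (f df : C -> R -> R) k th : (forall z, is_derive (f z) th (df z th)) ->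
  is_derive (fun th => Rsum (fun z => f z th) k) th (Rsum (fun z => df z th) k).
Proof.
  move=> H. elim: k => [|z k IH].
  - exact: (is_derive_const (V := R_NormedModule)).
  - exact: (is_derive_plus (V := R_NormedModule)).
Qed.

Lemma radius_deriv th : is_derive radius th (dradius th).
Proof.
  have := is_derive_plus (V := R_NormedModule) _ _ _ _ _ (is_derive_const (V := R_NormedModule) rad th) (Rsum_deriv bump dbump l th (fun z => bump_deriv z th)).
  by rewrite plus_zero_l.
Qed.

Lemma dradius_cont th : continuous dradius th.
Proof. exact: (proj1 (RInt_Rsum dbump l 0 0 dbump_cont)). Qed.

Lemma radius_closed : radius (2 * PI) = radius 0.
Proof.
  rewrite /radius. f_equal. apply: Rsum_ext => z _. rewrite /bump /u cos_2PI sin_2PI cos_0 sin_0. by [].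
Qed.

Lemma contour_curve : closed_curve contour dcontour.
Proof.
  split.
  - move=> th. apply: (deriv_mult _ RtoC_continuous (fun th => RtoC (radius th)) cis); last exact: cis_deriv.
    apply: curve_deriv_RtoC. exact: radius_deriv.
  - move=> th. apply: Ccont_plus; apply: Ccont_mult.
    + apply: Ccont_RtoC. exact: dradius_cont.
    + exact: cis_cont.
    + apply: Ccont_RtoC. apply: (ex_derive_continuous (V := R_NormedModule)). eexists. exact: radius_deriv.
    + apply: Ccont_mult; [exact: Ccont_const | exact: cis_cont].
  - by rewrite /contour radius_closed cis_2PI.
Qed.

Lemma u_Cmod z th : u z th = (Cmod (p th - z) / s z) ^ 2.
Proof.
  have Hs := s_pos z. rewrite /u /p.
  replace ((Cmod (RtoC rad * cis th - z) / s z) ^ 2) with (Cmod (RtoC rad * cis th - z) * Cmod (RtoC rad * cis th - z) / s z ^ 2) by (field; lra).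
  rewrite -sqr_sum_Cmod /=. field. lra.
Qed.

Lemma Cmod_p th : Cmod (p th) = rad.
Proof. rewrite /p Cmod_mult Cmod_cis Cmod_RtoC_pos; lra. Qed.

Lemma inactive z th : s z <= Cmod (p th - z) -> pos_part (1 - u z th) = 0.
Proof.
  move=> H. rewrite u_Cmod. have Hs := s_pos z. apply: Rmax_left.
  have : 1 <= Cmod (p th - z) / s z by apply/(Rle_div_r _ _ _ Hs); lra. nra.
Qed.

Lemma sep_s a b : Z a -> Z b -> a <> b -> 4 * s a <= Cmod (a - b) /\ 4 * s b <= Cmod (a - b).
Proof.
  move=> Ha Hb Hab. have [A B] := rho_le_sep rho delta Z delta_pos Z_sep a b Ha Hb Hab. rewrite /s. lra.
Qed.

(** A zero active on the circle satisfies [4 * s z <= |z| < rad + s z], by separation from 0; hence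
    [s z <= rad / 3] and [|z| < 2 * rad]. The size condition on [rad] keeps 0 inactive. *)
Lemma active_in z th : Z z -> Cmod (p th - z) < s z -> In z l /\ z <> 0%C /\ s z <= rad / 3.
Proof.
  move=> Hz Ha.
  have Hz0 : z <> 0%C.
  { move=> E. move: Ha. rewrite E. replace (p th - 0)%C with (p th) by ring. rewrite Cmod_p /s. lra. }
  have [S1 _] := sep_s z 0%C Hz Z0 Hz0. replace (z - 0)%C with z in S1 by ring.
  have T := Cmod_triangle_sub z (p th). rewrite Cmod_p Cmod_sub_sym in T.
  split; last by split => //; lra.
  apply/(proj2 l_enum). split => //. lra.
Qed.

(** Zeros are at least [4 * s] apart, for the [s] of either one, while a bump reaches no farther
    than [s]; so at most one bump acts at each angle. *)
Lemma contour_cases th :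
  ((forall z, Z z -> s z <= Cmod (p th - z)) /\ radius th = rad /\ dradius th = 0) \/
  (exists z, Z z /\ Cmod (p th - z) < s z /\ s z <= rad / 3 /\ radius th = rad + bump z th /\ dradius th = dbump z th /\
     forall m, Z m -> m <> z -> 3 * s z <= Cmod (p th - m) /\ 3 * s m <= Cmod (p th - m)).
Proof.
  case: (classic (exists z, Z z /\ Cmod (p th - z) < s z)) => [[z [Hz Ha]]|HN].
  - right. exists z. have [Hin [Hz0 HsR]] := active_in z th Hz Ha.
    have far : forall m, Z m -> m <> z -> 3 * s z <= Cmod (p th - m) /\ 3 * s m <= Cmod (p th - m).
    { move=> m Hm Hne. have [S1 S2] := sep_s m z Hm Hz Hne.
      have T := Cmod_triangle3 m (p th) z. rewrite (Cmod_sub_sym m (p th)) in T.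
      have := s_pos z. have := s_pos m. split; lra. }
    have other : forall m, In m l -> m <> z -> pos_part (1 - u m th) = 0.
    { move=> m Hm Hne. apply: inactive. have [Zm _] := proj1 (proj2 l_enum m) Hm.
      have [_ S2] := far m Zm Hne. have := s_pos m. lra. }
    split => //. split => //. split => //. split; last split => //.
    + rewrite /radius (Rsum_single_at _ l z) //; first exact: (proj1 l_enum).
      move=> m Hm Hne. rewrite /bump other //. ring.
    + rewrite /dradius (Rsum_single_at _ l z) //; first exact: (proj1 l_enum).
      move=> m Hm Hne. rewrite /dbump other //. ring.
  - left.
    have no : forall z, Z z -> s z <= Cmod (p th - z).
    { move=> z Hz. apply: Rnot_lt_le => H. apply: HN. by exists z. }
    have other : forall m, In m l -> pos_part (1 - u m th) = 0.
    { move=> m Hm. apply: inactive. apply: no. exact: (proj1 (proj1 (proj2 l_enum m) Hm)). }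
    split => //. split.
    + rewrite /radius Rsum_zero; first ring. move=> m Hm. rewrite /bump other //. ring.
    + rewrite /dradius Rsum_zero //. move=> m Hm. rewrite /dbump other //. ring.
Qed.

Lemma sgn_cases z : (sgn z = 1 /\ Cmod z < rad) \/ (sgn z = -1 /\ rad <= Cmod z).
Proof. rewrite /sgn. case: Rlt_dec => H; [left | right]; split => //. lra. Qed.

Lemma active_pos z th : Cmod (p th - z) < s z -> 0 < pos_part (1 - u z th) <= 1.
Proof.
  move=> H. have Hs := s_pos z. have H0 := Cmod_ge_0 (p th - z).
  have Q : 0 <= Cmod (p th - z) / s z < 1.
  { split; first exact: Rdiv_le_0_compat. apply/(Rlt_div_l _ _ _ Hs). lra. }
  rewrite /pos_part Rmax_right u_Cmod; nra.
Qed.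

Lemma bump_size z th : Cmod (p th - z) < s z -> 0 < sgn z * bump z th <= s z / 4.
Proof.
  move=> H. have [P1 P2] := active_pos z th H. have Hs := s_pos z.
  have Q : 0 < pos_part (1 - u z th) ^ 2 <= 1 by split; nra.
  rewrite /bump. case: (sgn_cases z) => [[-> _]|[-> _]]; nra.
Qed.

Lemma radius_bounds th : rad / 2 <= radius th <= 2 * rad.
Proof.
  case: (contour_cases th) => [[_ [-> _]]|[z [Hz [Ha [HsR [-> _]]]]]]; first lra.
  have := bump_size z th Ha. case: (sgn_cases z) => [[-> _]|[-> _]]; lra.
Qed.

Lemma contour_Cmod th : Cmod (contour th) = radius th.
Proof. rewrite /contour Cmod_mult Cmod_cis Cmod_RtoC_pos; have := radius_bounds th; lra. Qed.

(** The slope of [u], at most [2 * rad / s z] by Cauchy-Schwarz, is balanced by the height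
    [s z / 4]: a bump changes the radius at a rate of at most [rad], however small [rho z] is. *)
Lemma dcontour_bound th : Cmod (dcontour th) <= 3 * rad.
Proof.
  have HR := radius_bounds th.
  have D : Rabs (dradius th) <= rad.
  { case: (contour_cases th) => [[_ [_ ->]]|[z [Hz [Ha [HsR [_ [-> _]]]]]]]; first by rewrite Rabs_R0; lra.
    have Hs := s_pos z. have [P1 P2] := active_pos z th Ha.
    have U : Rabs (du z th) <= 2 * rad / s z.
    { rewrite /du Rabs_div; last by apply: pow_nonzero; lra. rewrite (Rabs_pos_eq (s z ^ 2)); last exact: pow2_ge_0.
      apply/(Rle_div_l _ _ _); first exact: pow_lt.
      replace (2 * rad / s z * s z ^ 2) with (2 * rad * s z) by (field; lra).
      apply: Rle_trans (_ : 2 * rad * Cmod (p th - z) <= _); last by apply: Rmult_le_compat_l; lra.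
      have M0 := Cmod_ge_0 (p th - z).
      rewrite -(Rabs_pos_eq (2 * rad * Cmod (p th - z))); last nra.
      apply: Rsqr_le_abs_0. rewrite /Rsqr.
      replace (2 * rad * Cmod (p th - z) * (2 * rad * Cmod (p th - z))) with (4 * rad ^ 2 * (Cmod (p th - z) * Cmod (p th - z))) by ring.
      rewrite -sqr_sum_Cmod.
      have -> : fst (p th - z)%C = rad * cos th - fst z by rewrite /p /=; ring.
      have -> : snd (p th - z)%C = rad * sin th - snd z by rewrite /p /=; ring.
      set x := rad * cos th - fst z. set y := rad * sin th - snd z.
      have SC := sin2_cos2 th. rewrite /Rsqr in SC.
      have := Rle_0_sqr (x * cos th + y * sin th). rewrite /Rsqr.
      replace ((2 * x * - (rad * sin th) + 2 * y * (rad * cos th)) * (2 * x * - (rad * sin th) + 2 * y * (rad * cos th)))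
        with (4 * rad ^ 2 * ((x * x + y * y) * (sin th * sin th + cos th * cos th) - (x * cos th + y * sin th) * (x * cos th + y * sin th))) by ring.
      rewrite SC. have := pow2_ge_0 rad. nra. }
    have -> : dbump z th = sgn z * ((s z / 4) * (- du z th * (2 * pos_part (1 - u z th)))) by rewrite /dbump; ring.
    rewrite Rabs_mult (Rabs_mult (s z / 4)) (Rabs_mult (- du z th)) Rabs_Ropp (Rabs_pos_eq (2 * _)); last lra.
    have -> : Rabs (sgn z) = 1.
    { case: (sgn_cases z) => [[-> _]|[-> _]]; [exact: Rabs_R1 | by rewrite Rabs_Ropp Rabs_R1]. }
    rewrite (Rabs_pos_eq (s z / 4)); last lra. rewrite -Rmult_assoc.
    apply: Rle_trans (_ : 1 * (s z / 4) * (2 * rad / s z * (2 * 1)) <= _).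
    - apply: Rmult_le_compat_l; first lra. apply: Rmult_le_compat; [exact: Rabs_pos | lra | exact: U | lra].
    - apply: Req_le. field. lra. }
  apply: Rle_trans (Cmod_triangle _ _) _.
  rewrite !Cmod_mult !Cmod_cis Cmod_Ci !Cmod_R (Rabs_pos_eq (radius th)); lra.
Qed.

Lemma contour_p th : Cmod (contour th - p th) = Rabs (radius th - rad).
Proof.
  have -> : (contour th - p th)%C = (RtoC (radius th - rad) * cis th)%C by rewrite /contour /p RtoC_minus; ring.
  by rewrite Cmod_mult Cmod_cis Cmod_R Rmult_1_r.
Qed.

(** The bound is [s m / 8]. An active zero at distance at least [s / 2] from the circle point loses
    at most [s / 4]. A closer one meets a bump of at least [9/16 * s / 4], directed away from it,
    and comparing moduli suffices. Any other zero is at least [3 * s] from the circle point. *)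
Lemma contour_far th m : Z m -> delta / 32 * rho m <= Cmod (contour th - m).
Proof.
  move=> Hm. have Sm := s_pos m.
  replace (delta / 32 * rho m) with (s m / 8) by (rewrite /s; field).
  have T := Cmod_triangle3 (p th) (contour th) m.
  rewrite (Cmod_sub_sym (p th) (contour th)) contour_p in T.
  case: (contour_cases th) => [[Hno [Hr _]]|[z [Hz [Ha [HsR [Hr [_ Hfar]]]]]]].
  - have := Hno m Hm. rewrite Hr Rminus_diag Rabs_R0 in T. lra.
  - have B := bump_size z th Ha. have Sz := s_pos z.
    have AB : Rabs (radius th - rad) <= s z / 4.
    { rewrite Hr. replace (rad + bump z th - rad) with (bump z th) by ring.
      case: (sgn_cases z) => [[E _]|[E _]]; rewrite E in B; apply: Rabs_le; lra. }
    case: (Ceq_dec m z) => [E|Hne].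
    + rewrite E in T *. case: (Rle_lt_dec (s z / 2) (Cmod (p th - z))) => Hc; first lra.
      have H0 := Cmod_ge_0 (p th - z).
      have PP : 3 / 4 <= pos_part (1 - u z th).
      { apply: Rle_trans (Rmax_r _ _). rewrite u_Cmod.
        have : 0 <= Cmod (p th - z) / s z <= / 2.
        { split; first exact: Rdiv_le_0_compat. apply/(Rle_div_l _ _ _ Sz). lra. }
        nra. }
      have P2 : 9 / 16 <= pos_part (1 - u z th) ^ 2 by nra.
      have C1 := Cmod_triangle_sub (contour th) z. have C2 := Cmod_triangle_sub z (contour th).
      rewrite (Cmod_sub_sym z) in C2. rewrite !contour_Cmod Hr /bump in C1 C2.
      case: (sgn_cases z) => [[E1 E2]|[E1 E2]]; rewrite E1 in C1 C2; nra.
    + have [F1 F2] := Hfar m Hm Hne.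
      lra.
Qed.

(** A ray reaching such an [m] would need an outward bump at its angle, belonging to a zero [z] of
    modulus below [rad]; but that bump is at most [s z / 4] high, and [m] is at least [3 * s z] from
    the circle point. The denominator [G] of the regular part vanishes only at such [m], so
    [star_cauchy] applies to quotients by it. *)
Lemma contour_outside th m x : Z m -> rad <= Cmod m -> 0 <= x <= 1 -> (RtoC x * contour th)%C <> m.
Proof.
  move=> Hm HmR Hx E. have HR := radius_bounds th.
  have Em : Cmod m = x * radius th by rewrite -E Cmod_mult contour_Cmod Cmod_RtoC_pos; lra.
  have Hrr : rad <= radius th by nra.
  have Dist : Cmod (p th - m) <= radius th - rad.
  { rewrite -E. have -> : (p th - RtoC x * contour th)%C = (RtoC (rad - x * radius th) * cis th)%C.
    { rewrite /p /contour RtoC_minus RtoC_mult. ring. }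
    rewrite Cmod_mult Cmod_cis Cmod_R Rabs_left1; nra. }
  case: (contour_cases th) => [[Hno [Hr _]]|[z [Hz [Ha [HsR [Hr [_ Hfar]]]]]]].
  - have := Hno m Hm. have := s_pos m. lra.
  - have B := bump_size z th Ha. have Sz := s_pos z.
    case: (sgn_cases z) => [[E1 E2]|[E1 E2]]; rewrite E1 in B; last lra.
    have Hne : m <> z by move=> Emz; rewrite Emz in HmR; lra.
    have [F1 _] := Hfar m Hm Hne. lra.
Qed.

(** Mirror image of the preceding argument, with an inward bump. It keeps the curve off the segment
    along which [winding_move] transports an inner pole. *)
Lemma contour_inside th m x : Z m -> Cmod m < rad -> 0 <= x <= 1 -> contour th <> (RtoC x * m)%C.
Proof.
  move=> Hm HmR Hx E. have HR := radius_bounds th.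
  have Em : radius th = x * Cmod m by rewrite -contour_Cmod E Cmod_mult Cmod_RtoC_pos; lra.
  have M0 := Cmod_ge_0 m.
  have Hrm : radius th <= Cmod m by nra.
  have Mp : 0 < Cmod m by lra.
  have Hx0 : 0 < x. { case: (Rle_lt_dec x 0) => // H. have : x = 0 by lra. move=> Ex. rewrite Ex in Em. lra. }
  have Em2 : m = (RtoC (Cmod m) * cis th)%C.
  { have Xn : RtoC x <> 0 by move=> /RtoC_inj; lra.
    have : (RtoC x * m)%C = (RtoC x * (RtoC (Cmod m) * cis th))%C.
    { rewrite -E /contour Em RtoC_mult. ring. }
    move=> H. replace m with (/ RtoC x * (RtoC x * m))%C at 1 by (field; exact: Xn). rewrite H. field. exact: Xn. }
  have Dist : Cmod (p th - m) <= rad - radius th.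
  { rewrite Em2. have -> : (p th - RtoC (Cmod m) * cis th)%C = (RtoC (rad - Cmod m) * cis th)%C.
    { rewrite /p RtoC_minus. ring. }
    rewrite Cmod_mult Cmod_cis Cmod_R Rabs_pos_eq; lra. }
  case: (contour_cases th) => [[Hno [Hr _]]|[z [Hz [Ha [HsR [Hr [_ Hfar]]]]]]]; first lra.
  have B := bump_size z th Ha. have Sz := s_pos z.
  case: (sgn_cases z) => [[E1 E2]|[E1 E2]]; rewrite E1 in B; first lra.
  have Hne : m <> z by move=> Emz; rewrite Emz in HmR; lra.
  have [F1 _] := Hfar m Hm Hne. lra.
Qed.

Lemma contour_winding w : (forall x th, 0 <= x <= 1 -> contour th <> (RtoC x * w)%C) ->
  CInt (fun th => dcontour th / (contour th - w))%C 0 (2 * PI) = (2 * PI * Ci)%C.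
Proof.
  move=> H. rewrite (winding_move _ _ contour_curve w); last exact: H.
  apply: winding_polar.
  - exact: radius_deriv.
  - exact: dradius_cont.
  - move=> th. have := radius_bounds th. lra.
  - exact: radius_closed.
Qed.

End Contour.

(** * The Mittag-Leffler expansion of a quotient *)

Definition root_prod (l : list C) (z : C) : C := fold_right Cmult (RtoC 1) (map (fun a => z - a)%C l).

Lemma root_prod_cons a l z : root_prod (a :: l) z = ((z - a) * root_prod l z)%C.
Proof. by []. Qed.

Lemma root_prod_neq_0 l z : ~ In z l -> root_prod l z <> 0.
Proof.
  elim: l => [|a l IH] H; first exact: C1_nz.
  rewrite root_prod_cons. apply: Cmult_neq_0.
  - apply: Cminus_eq_contra => E. apply: H. left. by rewrite E.
  - apply: IH => Hin. apply: H. by right.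
Qed.

Lemma root_prod_eq_0 l z : In z l -> root_prod l z = 0.
Proof.
  elim: l => [|a l IH] //. rewrite root_prod_cons => [[->|H]]; first ring. rewrite (IH H). ring.
Qed.

Lemma entire_mult_fun f h : entire f -> entire h -> entire (fun z => f z * h z)%C.
Proof.
  move=> /entire_Cderiv Hf /entire_Cderiv Hh.
  apply: (entire_intro _ (fun z => C_derive f z * h z + f z * C_derive h z)%C) => z.
  exact: (deriv_mult _ id_continuous_C).
Qed.

Lemma entire_minus_fun f h : entire f -> entire h -> entire (fun z => f z - h z)%C.
Proof.
  move=> /entire_Cderiv Hf /entire_Cderiv Hh.
  apply: (entire_intro _ (fun z => C_derive f z - C_derive h z)%C) => z. exact: deriv_minus.
Qed.

Lemma root_prod_entire l : entire (root_prod l).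
Proof.
  elim: l => [|a l IH].
  - apply: (entire_intro _ (fun _ => RtoC 0)) => z. exact: deriv_const.
  - apply: entire_mult_fun => //.
    apply: (entire_intro _ (fun _ => 1 - 0)%C) => z. apply: deriv_minus; [exact: deriv_self | exact: deriv_const].
Qed.

Lemma factor_deriv (h : C -> C) (p : C) : entire h -> is_Cderiv (fun z => (z - p) * h z)%C p (h p).
Proof.
  move=> /entire_Cderiv Hh.
  have D1 := deriv_minus _ _ _ _ _ _ (deriv_self (fun z : C_UniformSpace => z) p) (deriv_const (fun z : C_UniformSpace => z) p p).
  have D2 := deriv_mult _ id_continuous_C _ _ _ _ _ D1 (Hh p).
  match type of D2 with deriv_along _ _ _ ?x => replace (h p) with x; first exact: D2 end. ring.
Qed.

(** At [p] itself the factors are recovered as derivatives of the products. *)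
Lemma factor_unique (h1 h2 : C -> C) (p : C) : entire h1 -> entire h2 ->
  (forall z, ((z - p) * h1 z = (z - p) * h2 z)%C) -> forall z, h1 z = h2 z.
Proof.
  move=> E1 E2 H z. case: (Ceq_dec z p) => [->|Hz].
  - apply: (Cderiv_unique (fun z => (z - p) * h1 z)%C p); first exact: factor_deriv.
    apply: (deriv_ext _ (fun z => (z - p) * h2 z)%C); first by move=> v; rewrite H. exact: factor_deriv.
  - have D : (z - p)%C <> 0 by exact: Cminus_eq_contra.
    have := H z => E. replace (h1 z) with (/ (z - p) * ((z - p) * h1 z))%C by (field; exact: D).
    rewrite E. field. exact: D.
Qed.

Lemma CInt_Csum (F : C -> R -> C) l a b : (forall z, In z l -> forall x, Rcont (F z) x) ->
  (forall x, Rcont (fun x => Csum (fun z => F z x) l) x) /\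
  CInt (fun x => Csum (fun z => F z x) l) a b = Csum (fun z => CInt (F z) a b) l.
Proof.
  elim: l => [|z l IH] H.
  - split; first by move=> x; exact: Ccont_const.
    rewrite CInt_const Csum_nil. ring.
  - have [I1 I2] := IH (fun w Hw => H w (or_intror Hw)). have Hz := H z (or_introl eq_refl). split.
    + move=> x. apply: Ccont_plus; [exact: Hz | exact: I1].
    + rewrite Csum_cons -I2. rewrite -CInt_plus //; by move=> x _.
Qed.

(** * The quotient of [f] by [g] and Cauchy's formula on the contour *)

Section Forward.
Variables (phi rho : C -> R) (g : C -> C) (t delta ga : R).
Hypothesis phi_cont : forall z, continuous (T := C_UniformSpace) phi z.
Hypothesis rho_pos : forall z, 0 < rho z.
Hypothesis rho_lip : forall z w, rho w <= rho z + Cmod (z - w).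
Hypothesis g_entire : entire g.
Hypothesis delta_pos : 0 < delta.
Hypothesis g_sep : forall a b, zeros g a -> zeros g b -> a <> b -> delta * Rmax (rho a) (rho b) <= Cmod (a - b).
Hypothesis ga_pos : 0 < ga.
Hypothesis g_lower : forall z, ga * (exp (phi z) * dist_set rho z (zeros g)) <= Cmod (g z).
Hypothesis g_zero : zeros g 0%C.
Variables (L : R -> list C).
Hypothesis HL : forall r, enumerates (L r) (fun z => zeros g z /\ Cmod z < r).
Variables (f c : C -> C) (Mf : R).
Hypothesis f_entire : entire f.
Hypothesis f_bound : forall z, Cmod (f z) * exp (- phi z) <= Mf.
Hypothesis f_val : forall l, zeros g l -> f l = c l.

Let a (l : C) : C := (c l / C_derive g l)%C.

Lemma simple_zero l : zeros g l -> C_derive g l <> 0%C.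
Proof. exact: (g_deriv_neq_0 phi rho g delta ga). Qed.

(** [N / G] is [f / g] minus its principal parts, with the common zeros divided out one at a time.
    Numerator and denominator stay entire throughout, so no removable singularity is left to
    treat. *)
Lemma pole_removal l : NoDup l -> (forall z, In z l -> zeros g z) ->
  exists N G, entire N /\ entire G /\ (forall z, g z = (root_prod l z * G z)%C) /\
    (forall z, (f z - Csum (fun p => a p * gq g p z) l = root_prod l z * N z)%C).
Proof.
  elim: l => [|p l IH] Hn Hz.
  - exists f, g. split => //. split => //. split; move=> z; rewrite /root_prod /= ?Csum_nil; ring.
  - case: (proj1 (NoDup_cons_iff p l) Hn) => Hp Hl.
    have [N [G [HN [HG [Eg Ef]]]]] := IH Hl (fun z Hz' => Hz z (or_intror Hz')).
    have Zp := Hz p (or_introl eq_refl). have gp : g p = 0 := Zp.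
    have Pp := root_prod_neq_0 l p Hp.
    have Gp : G p = 0.
    { have := Eg p. rewrite gp => E. replace (G p) with (/ root_prod l p * (root_prod l p * G p))%C by (field; exact: Pp).
      rewrite -E. ring. }
    have [G1 [HG1 [EG1 _]]] := entire_divide G p HG Gp.
    have [Hq [Eq Eqp]] := gq_spec g g_entire p Zp.
    have Eq2 : forall z, gq g p z = (root_prod l z * G1 z)%C.
    { apply: (factor_unique _ _ p) => //.
      - apply: entire_mult_fun => //. exact: root_prod_entire.
      - move=> z. rewrite -Eq Eg EG1. ring. }
    (* At [p] the earlier terms [a m * gq g m] vanish, [f p = c p], and
       [C_derive g p = root_prod l p * G1 p]: choosing [a p] as the residue is what makes the new
       numerator divisible by [z - p]. *)
    have vanish : (N p - a p * G1 p)%C = 0.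
    { have E1 := Ef p. rewrite Csum_zero in E1.
      - have E2 : C_derive g p = (root_prod l p * G1 p)%C by rewrite -Eqp Eq2.
        have Dg := simple_zero p Zp. rewrite E2 in Dg.
        have G1p : G1 p <> 0%C by move=> E; apply: Dg; rewrite E; ring.
        rewrite f_val // in E1.
        have -> : a p = (root_prod l p * N p / (root_prod l p * G1 p))%C by rewrite /a E2 -E1; f_equal; ring.
        field. by split.
      - move=> m Hm. rewrite gq_div //.
        + rewrite gp. ring.
        + apply: Hz. by right.
        + move=> E. apply: Hp. by rewrite E. }
    have [N1 [HN1 [EN1 _]]] := entire_divide (fun z => N z - a p * G1 z)%C p
       (entire_minus_fun _ _ HN (entire_scal_fun (a p) G1 HG1)) vanish.
    exists N1, G1. split => //. split => //. split.
    + move=> z. rewrite root_prod_cons Eg EG1. ring.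
    + move=> z. rewrite root_prod_cons Csum_cons Eq2.
      replace (f z - (a p * (root_prod l z * G1 z) + Csum (fun p0 => a p0 * gq g p0 z) l))%C
        with ((f z - Csum (fun p0 => a p0 * gq g p0 z) l) - a p * (root_prod l z * G1 z))%C by ring.
      rewrite Ef. replace ((z - p) * root_prod l z * N1 z)%C with (root_prod l z * ((z - p) * N1 z))%C by ring.
      rewrite -EN1. ring.
Qed.

Definition F (z : C) : C := (f z / g z)%C.
Definition pole_sum (r : R) (z : C) : C := Csum (fun p => a p / (z - p))%C (L r).

Lemma regular_part r : exists N G, entire N /\ entire G /\
  (forall z, G z = 0 -> zeros g z /\ r <= Cmod z) /\
  (forall z, g z <> 0%C -> (F z - pole_sum r z)%C = (N z / G z)%C).
Proof.
  have Hin : forall z, In z (L r) -> zeros g z by move=> z /(proj2 (HL r)) [].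
  have [N [G [HN [HG [Eg Ef]]]]] := pole_removal (L r) (proj1 (HL r)) Hin.
  exists N, G. split => //. split => //. split.
  - move=> z Hz. have Zz : zeros g z by rewrite /zeros Eg Hz; ring.
    split => //. apply: Rnot_lt_le => Hlt.
    have Iz : In z (L r) by apply/(proj2 (HL r)).
    (* A zero of [G] in the list would be a double zero of [g]. *)
    apply: (simple_zero z Zz). apply: is_Cderiv_C_derive.
    apply: (deriv_ext _ (fun z => root_prod (L r) z * G z)%C); first by move=> v; rewrite -Eg.
    have := deriv_mult _ id_continuous_C _ _ _ _ _ (proj1 (entire_Cderiv _) (root_prod_entire (L r)) z) (proj1 (entire_Cderiv _) HG z).
    rewrite Hz root_prod_eq_0 //.
    match goal with |- deriv_along _ _ _ ?x -> _ => replace x with (RtoC 0) by ring end. by [].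
  - move=> z Hz.
    have [Pz Gz] : root_prod (L r) z <> 0%C /\ G z <> 0%C.
    { split => E; apply: Hz; rewrite Eg E; ring. }
    have E : (f z - g z * pole_sum r z)%C = (root_prod (L r) z * N z)%C.
    { rewrite -Ef /pole_sum -Csum_scal. f_equal. apply: Csum_ext => p Hp.
      rewrite gq_div //; [rewrite /Cdiv; ring | exact: Hin | move=> Ez; apply: Hz; rewrite Ez; exact: Hin]. }
    have -> : (F z - pole_sum r z)%C = ((f z - g z * pole_sum r z) / g z)%C by rewrite /F; field.
    rewrite E Eg. field. by split.
Qed.

Definition CF : R := Mf / (ga * ln (1 + delta / 32)).

Lemma F_bound z : (forall m, zeros g m -> delta / 32 * rho m <= Cmod (z - m)) -> g z <> 0%C /\ Cmod (F z) <= CF.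
Proof. apply: (quotient_bound phi rho g ga) => //. lra. Qed.

Lemma CF_ge0 : 0 <= CF.
Proof.
  have L0 : 0 < ln (1 + delta / 32) by rewrite -ln_1; apply: ln_increasing; lra.
  apply: Rdiv_le_0_compat; last exact: Rmult_lt_0_compat.
  apply: Rle_trans (f_bound 0%C). apply: Rmult_le_pos; [exact: Cmod_ge_0 | apply: Rlt_le; exact: exp_pos].
Qed.

Section Radius.
Variable r : R.
Hypothesis r_pos : 0 < r.
Hypothesis r_large : delta / 4 * rho 0%C <= r.

Let gam := contour rho delta r (L (2 * r)).
Let dgam := dcontour rho delta r (L (2 * r)).

Lemma gam_curve : closed_curve gam dgam.
Proof. exact: contour_curve. Qed.

Lemma gam_F th : g (gam th) <> 0%C /\ Cmod (F (gam th)) <= CF.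
Proof.
  apply: F_bound => m Hm. exact: (contour_far rho (zeros g) delta r (L (2 * r)) rho_pos delta_pos g_sep g_zero r_pos r_large (HL (2 * r))).
Qed.

Lemma gam_Cmod th : r / 2 <= Cmod (gam th) <= 2 * r.
Proof.
  rewrite (contour_Cmod rho (zeros g) delta r (L (2 * r)) rho_pos delta_pos g_sep g_zero r_pos r_large (HL (2 * r))).
  exact: (radius_bounds rho (zeros g) delta r (L (2 * r)) rho_pos delta_pos g_sep g_zero r_pos r_large (HL (2 * r))).
Qed.

Lemma dgam_bound th : Cmod (dgam th) <= 3 * r.
Proof. exact: (dcontour_bound rho (zeros g) delta r (L (2 * r)) rho_pos delta_pos g_sep g_zero r_pos r_large (HL (2 * r))). Qed.

Lemma gam_winding_zero p : In p (L r) -> CInt (fun th => dgam th / (gam th - p))%C 0 (2 * PI) = (2 * PI * Ci)%C.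
Proof.
  move=> /(proj2 (HL r)) [Hp Hr].
  apply: (contour_winding rho (zeros g) delta r (L (2 * r)) rho_pos delta_pos g_sep g_zero r_pos r_large (HL (2 * r))) => x th Hx.
  exact: (contour_inside rho (zeros g) delta r (L (2 * r)) rho_pos delta_pos g_sep g_zero r_pos r_large (HL (2 * r))).
Qed.

Lemma gam_winding_small w : Cmod w < r / 2 -> CInt (fun th => dgam th / (gam th - w))%C 0 (2 * PI) = (2 * PI * Ci)%C.
Proof.
  move=> Hw.
  apply: (contour_winding rho (zeros g) delta r (L (2 * r)) rho_pos delta_pos g_sep g_zero r_pos r_large (HL (2 * r))) => x th Hx E.
  have := gam_Cmod th. rewrite /gam E Cmod_mult Cmod_RtoC_pos; last lra. have := Cmod_ge_0 w. nra.
Qed.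

Lemma gam_neq_zero th p : zeros g p -> gam th <> p.
Proof. move=> Hp E. apply: (proj1 (gam_F th)). rewrite E. exact: Hp. Qed.

Lemma gam_neq_small th w : Cmod w < r / 2 -> gam th <> w.
Proof. move=> Hw E. have := gam_Cmod th. rewrite E. lra. Qed.

Lemma kernel_cont w x : (forall th, gam th <> w) -> Rcont (fun th => dgam th / (gam th - w))%C x.
Proof.
  move=> H. apply: Ccont_div.
  - apply: Cminus_eq_contra. exact: H.
  - exact: (cc_cont _ _ gam_curve).
  - apply: Ccont_minus; [exact: (cc_gcont _ _ gam_curve) | exact: Ccont_const].
Qed.

Lemma F_gam_cont x : Rcont (fun th => F (gam th)) x.
Proof.
  apply: Ccont_div; first exact: (proj1 (gam_F x)).
  - apply: (continuous_comp (V := C_UniformSpace) gam f); [exact: (cc_gcont _ _ gam_curve) | exact: entire_continuous].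
  - apply: (continuous_comp (V := C_UniformSpace) gam g); [exact: (cc_gcont _ _ gam_curve) | exact: entire_continuous].
Qed.

(* Cauchy's formula on the contour for the regular part of [f / g]: the poles inside
   contribute nothing, since [1 / ((zeta - p) (zeta - z))] has residue sum 0. *)
Lemma regular_part_cauchy z : g z <> 0%C -> Cmod z < r / 2 ->
  CInt (fun th => F (gam th) * (dgam th / (gam th - z)))%C 0 (2 * PI) = (2 * PI * Ci * (F z - pole_sum r z))%C.
Proof.
  move=> Hz Hzr.
  have [N [G [HN [HG [G0 E]]]]] := regular_part r.
  have Gz : G z <> 0%C by move=> E0; apply: Hz; exact: (proj1 (G0 z E0)).
  set H := (N z / G z)%C.
  have van : (N z - H * G z)%C = 0 by rewrite /H; field.
  (* Subtracting [H * G] makes the numerator divisible by [w - z]. Then [Q / G] integrates to 0 by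
     [star_cauchy], and only [H] times a winding integral survives. *)
  have [Q [HQ [EQ _]]] := entire_divide (fun w => N w - H * G w)%C z (entire_minus_fun _ _ HN (entire_scal_fun H G HG)) van.
  have gz := fun th => gam_neq_small th z Hzr.
  have Gstar : forall s th, 0 <= s <= 1 -> G (RtoC s * gam th)%C <> 0%C.
  { move=> s th Hs E0. have [Hm HmR] := G0 _ E0.
    exact: (contour_outside rho (zeros g) delta r (L (2 * r)) rho_pos delta_pos g_sep g_zero r_pos r_large (HL (2 * r)) th _ s Hm HmR Hs). }
  have SC : CInt (fun th => Q (gam th) / G (gam th) * dgam th)%C 0 (2 * PI) = 0.
  { apply: (star_cauchy gam dgam gam_curve (fun w => Q w / G w)%C
       (fun w => (C_derive Q w * G w - Q w * C_derive G w) / (G w * G w))%C) => s th Hs.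
    have Gn := Gstar s th Hs. set w := (RtoC s * gam th)%C in Gn *.
    have QD := proj1 (entire_Cderiv _) HQ w. have GD := proj1 (entire_Cderiv _) HG w.
    split.
    - have D := deriv_mult _ id_continuous_C _ _ _ _ _ QD (deriv_comp _ Cinv G w _ _ (Cderiv_inv _ Gn) (Cderiv_continuous _ _ _ GD) GD).
      match type of D with deriv_along _ _ _ ?x => replace (_ / _)%C with x; first exact: D end.
      field. exact: Gn.
    - apply: Ccont_div; first exact: Cmult_neq_0.
      + apply: Ccont_minus; apply: Ccont_mult; by [exact: entire_continuous | exact: entire_C_derive_cont].
      + apply: Ccont_mult; exact: entire_continuous. }
  have gamc := cc_gcont _ _ gam_curve. have dgamc := cc_cont _ _ gam_curve.
  have kz : forall x, Rcont (fun th => dgam th / (gam th - z))%C x by move=> x; exact: kernel_cont.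
  have kp : forall p, In p (L r) -> forall x, Rcont (fun th => dgam th / (gam th - p))%C x.
  { move=> p /(proj2 (HL r)) [Hp _] x. apply: kernel_cont => th. exact: gam_neq_zero. }
  have zp : forall p, In p (L r) -> (p - z)%C <> 0.
  { move=> p /(proj2 (HL r)) [Hp _]. apply: Cminus_eq_contra => E0. apply: Hz. rewrite -E0. exact: Hp. }
  pose B := fun p th => (a p / (p - z) * (dgam th / (gam th - p) - dgam th / (gam th - z)))%C.
  have Bc : forall p, In p (L r) -> forall x, Rcont (B p) x.
  { move=> p Hp x. apply: Ccont_mult; first exact: Ccont_const. apply: Ccont_minus; [exact: kp | exact: kz]. }
  have [Bsc BI] := CInt_Csum B (L r) 0 (2 * PI) Bc.
  have Bz : Csum (fun p => CInt (B p) 0 (2 * PI)) (L r) = 0%C.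
  { apply: Csum_zero => p Hp. rewrite /B CInt_Cscal; last by move=> x _; apply: Ccont_minus; [exact: kp | exact: kz].
    rewrite CInt_minus; [|by move=> x _; exact: kp | by move=> x _; exact: kz].
    rewrite gam_winding_zero // gam_winding_small //. ring. }
  rewrite (CInt_ext _ (fun th => (Q (gam th) / G (gam th) * dgam th + H * (dgam th / (gam th - z))) + Csum (fun p => B p th) (L r))%C).
  - have Qc : forall x, Rcont (fun th => Q (gam th) / G (gam th) * dgam th)%C x.
    { move=> x. apply: Ccont_mult => //. apply: Ccont_div.
      - have := Gstar 1 x ltac:(lra). by replace (1 * gam x)%C with (gam x) by ring.
      - apply: (continuous_comp (V := C_UniformSpace) gam Q); [exact: gamc | exact: entire_continuous].
      - apply: (continuous_comp (V := C_UniformSpace) gam G); [exact: gamc | exact: entire_continuous]. }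
    have Hk : forall x, Rcont (fun th => H * (dgam th / (gam th - z)))%C x.
    { move=> x. apply: Ccont_mult; [exact: Ccont_const | exact: kz]. }
    rewrite CInt_plus; [|by move=> x _; apply: Ccont_plus; [exact: Qc | exact: Hk] | by move=> x _; exact: Bsc].
    rewrite CInt_plus; [|by move=> x _; exact: Qc | by move=> x _; exact: Hk].
    rewrite SC BI Bz CInt_Cscal; last by move=> x _; exact: kz.
    rewrite gam_winding_small // (E z Hz) -/H. ring.
  - move=> th _. have [gn _] := gam_F th.
    have Gg : G (gam th) <> 0%C by move=> E0; apply: gn; exact: (proj1 (G0 _ E0)).
    have Dz : (gam th - z)%C <> 0 by exact: Cminus_eq_contra.
    have E1 : F (gam th) = (N (gam th) / G (gam th) + pole_sum r (gam th))%C by rewrite -E //; ring.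
    have E2 : N (gam th) = ((gam th - z) * Q (gam th) + H * G (gam th))%C by rewrite -EQ; ring.
    have E3 : Csum (fun p => B p th) (L r) = (pole_sum r (gam th) * (dgam th / (gam th - z)))%C.
    { rewrite /pole_sum Cmult_comm -Csum_scal. apply: Csum_ext => p Hp. rewrite /B.
      have Dp : (gam th - p)%C <> 0.
      { apply: Cminus_eq_contra. apply: gam_neq_zero. by case: (proj1 (proj2 (HL r) p) Hp). }
      field. repeat split => //. exact: zp. }
    rewrite E3 E1 E2. field. by split.
Qed.

(** The kernels at [z] and [w] differ by [(z - w) / ((zeta - z) * (zeta - w))]. Both factors are at
    least [r / 4], as [|zeta| >= r / 2], and the speed is at most [3 * r]; thus 48 is [3 * 16]. *)
Lemma mittag_leffler_error z w : g z <> 0%C -> g w <> 0%C -> Cmod z <= r / 4 -> Cmod w <= r / 4 ->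
  Cmod ((F z - pole_sum r z) - (F w - pole_sum r w)) <= 48 * CF * Cmod (z - w) / r.
Proof.
  move=> Hz Hw Hzr Hwr.
  have Cz := regular_part_cauchy z Hz ltac:(lra). have Cw := regular_part_cauchy w Hw ltac:(lra).
  have gz : forall th, gam th <> z by move=> th; apply: gam_neq_small; lra.
  have gw : forall th, gam th <> w by move=> th; apply: gam_neq_small; lra.
  have P2 := two_PI_pos. have C0 := CF_ge0.
  set X := ((F z - pole_sum r z) - (F w - pole_sum r w))%C.
  have cz : cont_on 0 (2 * PI) (fun th => F (gam th) * (dgam th / (gam th - z)))%C.
  { move=> x _. apply: Ccont_mult; [exact: F_gam_cont | exact: kernel_cont]. }
  have cw : cont_on 0 (2 * PI) (fun th => F (gam th) * (dgam th / (gam th - w)))%C.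
  { move=> x _. apply: Ccont_mult; [exact: F_gam_cont | exact: kernel_cont]. }
  have E : (2 * PI * Ci * X)%C = CInt (fun th => F (gam th) * (dgam th / (gam th - z)) - F (gam th) * (dgam th / (gam th - w)))%C 0 (2 * PI).
  { rewrite CInt_minus // Cz Cw /X. ring. }
  have B : Cmod (2 * PI * Ci * X) <= (2 * PI - 0) * (CF * (3 * r * (Cmod (z - w) / (r / 4 * (r / 4))))).
  { rewrite E. apply: CInt_norm_le; first lra.
    - move=> x Hx. apply: Ccont_minus; [exact: cz | exact: cw].
    - move=> th _.
      have Dz : (gam th - z)%C <> 0 by exact: Cminus_eq_contra. have Dw : (gam th - w)%C <> 0 by exact: Cminus_eq_contra.
      replace (F (gam th) * (dgam th / (gam th - z)) - F (gam th) * (dgam th / (gam th - w)))%C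
        with (F (gam th) * (dgam th * ((z - w) / ((gam th - z) * (gam th - w)))))%C by (field; by split).
      rewrite Cmod_mult (Cmod_mult (dgam th)) Cmod_div; last exact: Cmult_neq_0. rewrite (Cmod_mult (gam th - z)).
      have Gm := gam_Cmod th.
      have Fz : r / 4 <= Cmod (gam th - z) by have := Cmod_triangle_sub (gam th) z; lra.
      have Fw : r / 4 <= Cmod (gam th - w) by have := Cmod_triangle_sub (gam th) w; lra.
      have r4 : 0 < r / 4 * (r / 4) by nra.
      have PP : r / 4 * (r / 4) <= Cmod (gam th - z) * Cmod (gam th - w) by apply: Rmult_le_compat; lra.
      have Z0 := Cmod_ge_0 (z - w).
      apply: Rmult_le_compat; [exact: Cmod_ge_0 | | exact: (proj2 (gam_F th)) |].
      + apply: Rmult_le_pos; first exact: Cmod_ge_0. apply: Rdiv_le_0_compat => //. lra.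
      + apply: Rmult_le_compat; [exact: Cmod_ge_0 | | exact: dgam_bound |].
        * apply: Rdiv_le_0_compat => //. lra.
        * apply: Rmult_le_compat_l => //. exact: Rinv_le_contravar. }
  rewrite !Cmod_mult Cmod_Ci !Cmod_R (Rabs_pos_eq 2) in B; last lra.
  rewrite (Rabs_pos_eq PI) in B; last by have := PI_RGT_0; lra.
  apply: (Rmult_le_reg_l (2 * PI)) => //.
  replace (2 * PI * (48 * CF * Cmod (z - w) / r)) with ((2 * PI - 0) * (CF * (3 * r * (Cmod (z - w) / (r / 4 * (r / 4)))))) by (field; lra).
  lra.
Qed.

End Radius.
End Forward.

(** * Principal values as Fourier coefficients *)

(** The character of frequency [- k], as an inverse power so that it combines algebraically with
    rational functions of [cis]. *)
Definition mode (k : nat) (th : R) : C := (/ cis th ^ k)%C.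

Lemma mode_S k th : mode (S k) th = (/ cis th * mode k th)%C.
Proof. rewrite /mode Cpow_S. field. split; [exact: Cpow_nz (cis_neq_0 th) | exact: cis_neq_0]. Qed.

Lemma mode_deriv k th : is_curve_deriv (mode k) th (- RtoC (INR k) * Ci * mode k th)%C.
Proof.
  elim: k => [|k IH].
  - have := deriv_const RtoC (/ 1)%C th.
    replace (- RtoC (INR 0) * Ci * mode 0 th)%C with (RtoC 0) by (simpl; ring). by [].
  - apply: (deriv_ext _ (fun th => / cis th * mode k th)%C); first by move=> v; rewrite mode_S.
    have D := deriv_mult _ RtoC_continuous _ _ _ _ _ (deriv_comp RtoC Cinv cis th _ _ (Cderiv_inv _ (cis_neq_0 th)) (cis_cont th) (cis_deriv th)) IH.
    match type of D with deriv_along _ _ _ ?x => replace (- RtoC (INR (S k)) * Ci * mode (S k) th)%C with x; first exact: D end.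
    rewrite S_INR RtoC_plus mode_S. field. exact: cis_neq_0.
Qed.

Lemma mode_cont k th : Rcont (mode k) th.
Proof. exact: curve_deriv_continuous (mode_deriv k th). Qed.

Lemma Cmod_mode k th : Cmod (mode k th) = 1.
Proof.
  rewrite /mode Cmod_inv; last exact: Cpow_nz (cis_neq_0 th). by rewrite Cmod_pow Cmod_cis pow1 Rinv_1.
Qed.

Lemma mode_closed k : mode k (2 * PI) = mode k 0.
Proof. by rewrite /mode cis_2PI. Qed.

Lemma mode_int k : (0 < k)%nat -> CInt (mode k) 0 (2 * PI) = 0.
Proof.
  move=> Hk. have Hn : RtoC (INR k) <> 0 by move=> /RtoC_inj; have := lt_0_INR k Hk; lra.
  have Hc : (- RtoC (INR k) * Ci)%C <> 0.
  { apply: Cmult_neq_0; last exact: Ci_nz. move=> E. apply: Hn.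
    replace (RtoC (INR k)) with (- - RtoC (INR k))%C by ring. rewrite E. ring. }
  rewrite (CInt_FTC _ _ (fun th => / (- RtoC (INR k) * Ci) * mode k th)%C).
  - rewrite mode_closed. ring.
  - move=> th _. have D := deriv_scal RtoC (/ (- RtoC (INR k) * Ci))%C _ _ _ (mode_deriv k th).
    match type of D with deriv_along _ _ _ ?x => replace (mode k th) with x; first exact: D end.
    set q := (- RtoC (INR k) * Ci)%C in Hc *. field. exact: Hc.
  - move=> th _. exact: mode_cont.
Qed.

Definition mode_kernel (k : nat) (r : R) (mu : C) (th : R) : C := (mode k th / (RtoC r * cis th - mu))%C.

Lemma mode_kernel_cont k r mu th : (RtoC r * cis th - mu)%C <> 0 -> Rcont (mode_kernel k r mu) th.
Proof.
  move=> H. apply: Ccont_div => //; first exact: mode_cont.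
  apply: Ccont_minus; last exact: Ccont_const. apply: Ccont_mult; [exact: Ccont_const | exact: cis_cont].
Qed.

(** A pole at the centre produces the frequency [- (k + 1)] only, whose mean is 0; hence [p] itself
    drops out of the sums taken on its own circle. *)
Lemma mode_kernel_int_0 k r : 0 < r -> CInt (mode_kernel k r 0) 0 (2 * PI) = 0.
Proof.
  move=> Hr. have rn : RtoC r <> 0 by move=> /RtoC_inj; lra.
  rewrite (CInt_ext _ (fun th => / RtoC r * mode (S k) th)%C).
  - rewrite CInt_Cscal; last by move=> th _; exact: mode_cont. rewrite mode_int; last lia. ring.
  - move=> th _. rewrite /mode_kernel mode_S. have := cis_neq_0 th => Hc.
    replace (RtoC r * cis th - 0)%C with (RtoC r * cis th)%C by ring. field. by split.
Qed.

(** A Taylor coefficient of [1/(w - mu)] in the disc [|w| < |mu|]. The case [k = 0] follows from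
    [star_cauchy]; then, on the circle, [mode (S k) / (w - mu) = (r / mu) * mode k / (w - mu) - mode
    (S k) / mu] lowers [k], the last term having mean 0. *)
Lemma mode_kernel_int k r mu : 0 < r -> r < Cmod mu ->
  CInt (mode_kernel k r mu) 0 (2 * PI) = (- (2 * PI) * (RtoC r ^ k / mu ^ (k + 1)))%C.
Proof.
  move=> Hr Hmu. have rn : RtoC r <> 0 by move=> /RtoC_inj; lra.
  have mn : mu <> 0 by apply/Cmod_gt_0; lra.
  have nz : forall s th, 0 <= s <= 1 -> (RtoC s * (RtoC r * cis th) - mu)%C <> 0.
  { move=> s th Hs E. have : Cmod (RtoC s * (RtoC r * cis th)) = Cmod mu.
    { f_equal. replace (RtoC s * (RtoC r * cis th))%C with ((RtoC s * (RtoC r * cis th) - mu) + mu)%C by ring. rewrite E. ring. }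
    rewrite !Cmod_mult Cmod_cis !Cmod_RtoC_pos; nra. }
  have nz1 : forall th, (RtoC r * cis th - mu)%C <> 0.
  { move=> th. have := nz 1 th ltac:(lra). by replace (1 * (RtoC r * cis th))%C with (RtoC r * cis th)%C by ring. }
  have kc : forall k th, Rcont (mode_kernel k r mu) th by move=> j th; exact: mode_kernel_cont.
  elim: k => [|k IH].
  - have SC : CInt (fun th => / (circle 0 r th - mu) * dcircle r th)%C 0 (2 * PI) = 0.
    { apply: (star_cauchy _ _ (circle_curve 0 r) (fun w => / (w - mu))%C (fun w => - / ((w - mu) * (w - mu)))%C) => s th Hs.
      have N := nz s th Hs. replace (RtoC s * circle 0 r th)%C with (RtoC s * (RtoC r * cis th))%C by (rewrite /circle; ring).
      set w := (RtoC s * (RtoC r * cis th))%C in N *.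
      have D0 := deriv_minus _ _ _ _ _ _ (deriv_self (fun z : C_UniformSpace => z) w) (deriv_const (fun z : C_UniformSpace => z) mu w).
      split.
      - have D := deriv_comp _ Cinv (fun z : C_UniformSpace => z - mu)%C w _ _ (Cderiv_inv _ N) (Cderiv_continuous _ _ _ D0) D0.
        match type of D with deriv_along _ _ _ ?x => replace (- / _)%C with x; first exact: D end. ring.
      - apply: Ccont_opp. apply: Ccont_inv; first exact: Cmult_neq_0.
        apply: Ccont_mult; exact: (Cderiv_continuous _ _ _ D0). }
    rewrite (CInt_ext _ (fun th => Ci + (Ci * mu) * mode_kernel 0 r mu th)%C) in SC.
    + rewrite CInt_plus in SC; [|by move=> th _; exact: Ccont_const | by move=> th _; apply: Ccont_mult; [exact: Ccont_const | exact: kc]].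
      rewrite CInt_const CInt_Cscal in SC; last by move=> th _; exact: kc.
      set J := CInt _ _ _ in SC *.
      have -> : J = (((RtoC (2 * PI - 0) * Ci + Ci * mu * J) - RtoC (2 * PI - 0) * Ci) / (Ci * mu))%C.
      { field. split => //. exact: Ci_nz. }
      rewrite SC RtoC_minus RtoC_mult /=. field. split => //. exact: Ci_nz.
    + move=> th _. have N := nz1 th. rewrite /mode_kernel /mode /circle /dcircle /=.
      replace (0 + RtoC r * cis th)%C with (RtoC r * cis th)%C by ring. field. exact: N.
  - rewrite (CInt_ext _ (fun th => (RtoC r / mu) * mode_kernel k r mu th - / mu * mode (S k) th)%C).
    + rewrite CInt_minus; [|by move=> th _; apply: Ccont_mult; [exact: Ccont_const | exact: kc] | by move=> th _; apply: Ccont_mult; [exact: Ccont_const | exact: mode_cont]].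
      rewrite !CInt_Cscal; [|by move=> th _; exact: mode_cont | by move=> th _; exact: kc].
      rewrite mode_int; last lia. rewrite IH /=. field. split => //. exact: Cpow_nz.
    + move=> th _. have N := nz1 th. have Hc := cis_neq_0 th. rewrite /mode_kernel mode_S. field. repeat split => //.
Qed.

(** * Comparison of circle integrals with sums over the zeros *)

Section Coefficients.
Variables (phi rho : C -> R) (g : C -> C) (delta ga : R).
Hypothesis phi_cont : forall z, continuous (T := C_UniformSpace) phi z.
Hypothesis rho_pos : forall z, 0 < rho z.
Hypothesis rho_lip : forall z w, rho w <= rho z + Cmod (z - w).
Hypothesis g_entire : entire g.
Hypothesis delta_pos : 0 < delta.
Hypothesis g_sep : forall a b, zeros g a -> zeros g b -> a <> b -> delta * Rmax (rho a) (rho b) <= Cmod (a - b).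
Hypothesis ga_pos : 0 < ga.
Hypothesis g_lower : forall z, ga * (exp (phi z) * dist_set rho z (zeros g)) <= Cmod (g z).
Hypothesis g_zero : zeros g 0%C.
Variables (L : R -> list C).
Hypothesis HL : forall r, enumerates (L r) (fun z => zeros g z /\ Cmod z < r).
Variables (f c : C -> C) (Mf : R).
Hypothesis f_entire : entire f.
Hypothesis f_bound : forall z, Cmod (f z) * exp (- phi z) <= Mf.
Hypothesis f_val : forall l, zeros g l -> f l = c l.

Let a (l : C) : C := (c l / C_derive g l)%C.
Let Fq := F g f.
Let psum := pole_sum g L c.
Let K := CF delta ga Mf.
Let s (l : C) : R := delta / 4 * rho l.

Lemma s_pos' l : 0 < s l.
Proof. apply: Rmult_lt_0_compat => //. lra. Qed.

Lemma small_circle_far p m th : zeros g p -> zeros g m -> s m <= Cmod (circle p (s p) th - m).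
Proof.
  move=> Hp Hm. have Sp := s_pos' p.
  case: (Ceq_dec m p) => [->|Hne]; first by rewrite Cmod_circle; lra.
  have [S1 S2] := rho_le_sep rho delta (zeros g) delta_pos g_sep m p Hm Hp Hne.
  have T := Cmod_triangle3 m (circle p (s p) th) p.
  rewrite (Cmod_sub_sym m (circle p (s p) th)) Cmod_circle in T; last lra.
  have Sm := s_pos' m. rewrite /s in Sm Sp T *. lra.
Qed.

Lemma small_circle_F p th : zeros g p -> g (circle p (s p) th) <> 0%C /\ Cmod (Fq (circle p (s p) th)) <= K.
Proof.
  move=> Hp. apply: (F_bound phi rho g delta ga) => // m Hm.
  apply: Rle_trans (small_circle_far p m th Hp Hm). rewrite /s. have := rho_pos m. nra.
Qed.

Lemma small_circle_F_cont p x : zeros g p -> Rcont (fun th => Fq (circle p (s p) th)) x.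
Proof.
  move=> Hp. apply: Ccont_div; first exact: (proj1 (small_circle_F p x Hp)).
  - apply: (continuous_comp (V := C_UniformSpace) (circle p (s p)) f); [exact: (cc_gcont _ _ (circle_curve _ _)) | exact: entire_continuous].
  - apply: (continuous_comp (V := C_UniformSpace) (circle p (s p)) g); [exact: (cc_gcont _ _ (circle_curve _ _)) | exact: entire_continuous].
Qed.

Lemma circle_sub p l th : (circle p (s p) th - l)%C = (RtoC (s p) * cis th - (l - p))%C.
Proof. rewrite /circle. ring. Qed.

Lemma circle_kernel_cont k p l x : zeros g p -> zeros g l -> Rcont (mode_kernel k (s p) (l - p)) x.
Proof.
  move=> Hp Hl. apply: mode_kernel_cont. rewrite -circle_sub. apply/Cmod_gt_0.
  apply: Rlt_le_trans (small_circle_far p l x Hp Hl). exact: s_pos'.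
Qed.

Definition residue_kernel (k : nat) (p l : C) : C :=
  if em (l <> p) then (- (2 * PI) * (RtoC (s p) ^ k / (l - p) ^ (k + 1)))%C else 0%C.

Lemma circle_kernel_int k p l : zeros g p -> zeros g l ->
  CInt (mode_kernel k (s p) (l - p)) 0 (2 * PI) = residue_kernel k p l.
Proof.
  move=> Hp Hl. have Sp := s_pos' p. rewrite /residue_kernel. case: em => [Hne|Heq].
  - apply: mode_kernel_int => //.
    have [S1 S2] := rho_le_sep rho delta (zeros g) delta_pos g_sep l p Hl Hp Hne. rewrite /s in Sp *. lra.
  - have -> : (l - p)%C = 0%C by have -> : l = p by [apply: NNPP]; ring.
    exact: mode_kernel_int_0.
Qed.

Lemma psum_mode_int k p r : zeros g p ->
  (forall x, Rcont (fun th => mode k th * psum r (circle p (s p) th))%C x) /\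
  CInt (fun th => mode k th * psum r (circle p (s p) th))%C 0 (2 * PI) = Csum (fun l => a l * residue_kernel k p l)%C (L r).
Proof.
  move=> Hp.
  have kc : forall l, In l (L r) -> forall x, Rcont (fun th => a l * mode_kernel k (s p) (l - p) th)%C x.
  { move=> l /(proj2 (HL r)) [Hl _] x. apply: Ccont_mult; [exact: Ccont_const | exact: circle_kernel_cont]. }
  have [I1 I2] := CInt_Csum (fun l th => a l * mode_kernel k (s p) (l - p) th)%C (L r) 0 (2 * PI) kc.
  have E : forall th, Csum (fun l => a l * mode_kernel k (s p) (l - p) th)%C (L r) = (mode k th * psum r (circle p (s p) th))%C.
  { move=> th. rewrite /psum /pole_sum -Csum_scal. apply: Csum_ext => l _. rewrite /mode_kernel circle_sub /a /Cdiv. ring. }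
  split.
  - move=> x. apply: (continuous_ext (fun th => Csum (fun l => a l * mode_kernel k (s p) (l - p) th)%C (L r))); [exact: E | exact: I1].
  - rewrite -(CInt_ext (fun th => Csum (fun l => a l * mode_kernel k (s p) (l - p) th)%C (L r))); last by move=> x _; exact: E.
    rewrite I2. apply: Csum_ext => l /(proj2 (HL r)) [Hl _].
    rewrite CInt_Cscal; last by move=> x _; exact: circle_kernel_cont. by rewrite circle_kernel_int.
Qed.

Definition radius_ok (r : R) : Prop := 0 < r /\ delta / 4 * rho 0%C <= r.

Lemma mode_F_cont k p x : zeros g p -> Rcont (fun th => mode k th * Fq (circle p (s p) th))%C x.
Proof. move=> Hp. apply: Ccont_mult; [exact: mode_cont | exact: small_circle_F_cont]. Qed.

Lemma mode_F_int_bound k p : zeros g p -> Cmod (CInt (fun th => mode k th * Fq (circle p (s p) th))%C 0 (2 * PI)) <= 2 * PI * K.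
Proof.
  move=> Hp. have P2 := two_PI_pos.
  replace (2 * PI * K) with ((2 * PI - 0) * K) by ring.
  apply: CInt_norm_le; first lra.
  - move=> x _. exact: mode_F_cont.
  - move=> x _. rewrite Cmod_mult Cmod_mode Rmult_1_l. exact: (proj2 (small_circle_F p x Hp)).
Qed.

Lemma circle_Cmod_le p th : Cmod (circle p (s p) th) <= Cmod p + s p.
Proof.
  have Sp := s_pos' p. rewrite /circle. apply: Rle_trans (Cmod_triangle _ _) _.
  rewrite Cmod_mult Cmod_cis Cmod_RtoC_pos; lra.
Qed.

(** A positive [k] gives a mode of mean 0, so the value [V] of [Fq - psum r] at one point of the
    circle may be subtracted; what is left is a difference between two points, to which the
    expansion error applies. *)
Lemma high_coef k p r : (0 < k)%nat -> zeros g p -> radius_ok r -> Cmod p + s p <= r / 4 ->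
  Cmod (CInt (fun th => mode k th * Fq (circle p (s p) th))%C 0 (2 * PI) - Csum (fun l => a l * residue_kernel k p l)%C (L r))
    <= 2 * PI * (48 * K * (2 * s p) / r).
Proof.
  move=> Hk Hp [Hr1 Hr2] Hpr. have P2 := two_PI_pos. have Sp := s_pos' p.
  have K0 : 0 <= K by exact: (CF_ge0 phi).
  have [c1 I1] := psum_mode_int k p r Hp.
  set w := circle p (s p) 0. set V := (Fq w - psum r w)%C.
  have mV : forall x, Rcont (fun th => V * mode k th)%C x by move=> x; apply: Ccont_mult; [exact: Ccont_const | exact: mode_cont].
  have cF : forall x, Rcont (fun th => mode k th * Fq (circle p (s p) th))%C x by move=> x; exact: mode_F_cont.
  have -> : (CInt (fun th => mode k th * Fq (circle p (s p) th)) 0 (2 * PI) - Csum (fun l => a l * residue_kernel k p l) (L r))%C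
     = CInt (fun th => (mode k th * Fq (circle p (s p) th) - mode k th * psum r (circle p (s p) th)) - V * mode k th)%C 0 (2 * PI).
  { rewrite CInt_minus; [|by move=> x _; apply: Ccont_minus; [exact: cF | exact: c1] | by move=> x _; exact: mV].
    rewrite CInt_minus; [|by move=> x _; exact: cF | by move=> x _; exact: c1].
    rewrite CInt_Cscal; last by move=> x _; exact: mode_cont.
    rewrite mode_int // I1. ring. }
  replace (2 * PI * (48 * K * (2 * s p) / r)) with ((2 * PI - 0) * (48 * K * (2 * s p) / r)) by ring.
  apply: CInt_norm_le; first lra.
  - move=> x _. apply: Ccont_minus; [apply: Ccont_minus; [exact: cF | exact: c1] | exact: mV].
  - move=> x _. set z := circle p (s p) x.
    replace (mode k x * Fq z - mode k x * psum r z - V * mode k x)%C with (mode k x * ((Fq z - psum r z) - (Fq w - psum r w)))%C by (rewrite /V; ring).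
    rewrite Cmod_mult Cmod_mode Rmult_1_l.
    have Dzw : Cmod (z - w) <= 2 * s p.
    { have := Cmod_triangle3 z p w. rewrite (Cmod_sub_sym p w) !Cmod_circle; lra. }
    apply: Rle_trans (mittag_leffler_error phi rho g delta ga phi_cont rho_pos rho_lip g_entire delta_pos g_sep ga_pos g_lower g_zero L HL f c Mf f_entire f_bound f_val r Hr1 Hr2 z w _ _ _ _) _.
    + exact: (proj1 (small_circle_F p x Hp)).
    + exact: (proj1 (small_circle_F p 0 Hp)).
    + apply: Rle_trans (circle_Cmod_le p x) Hpr.
    + apply: Rle_trans (circle_Cmod_le p 0) Hpr.
    + rewrite -/K. apply: Rmult_le_compat_r; first by apply: Rlt_le; exact: Rinv_0_lt_compat.
      apply: Rmult_le_compat_l => //. lra.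
Qed.

(** Here a constant would survive integration. Running along the circles about [p] and about 0 at
    the same angle makes it cancel, at the price of comparing points up to [|p| + s p + s 0]
    apart. *)
Lemma zero_coef p r : zeros g p -> radius_ok r -> Cmod p + s p <= r / 4 -> s 0%C <= r / 4 ->
  Cmod ((CInt (fun th => mode 0 th * Fq (circle p (s p) th)) 0 (2 * PI) - CInt (fun th => mode 0 th * Fq (circle 0 (s 0%C) th)) 0 (2 * PI))
     - Csum (fun l => a l * (residue_kernel 0 p l - residue_kernel 0 0 l)) (L r))%C
    <= 2 * PI * (48 * K * (Cmod p + s p + s 0%C) / r).
Proof.
  move=> Hp [Hr1 Hr2] Hpr H0r. have P2 := two_PI_pos. have Sp := s_pos' p. have S0 := s_pos' 0%C.
  have K0 : 0 <= K by exact: (CF_ge0 phi).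
  have [c1 I1] := psum_mode_int 0 p r Hp. have [c2 I2] := psum_mode_int 0 0%C r g_zero.
  have cF : forall x, Rcont (fun th => mode 0 th * Fq (circle p (s p) th))%C x by move=> x; exact: mode_F_cont.
  have cF0 : forall x, Rcont (fun th => mode 0 th * Fq (circle 0 (s 0%C) th))%C x by move=> x; exact: mode_F_cont.
  have d1 : forall x, Rcont (fun th => mode 0 th * Fq (circle p (s p) th) - mode 0 th * psum r (circle p (s p) th))%C x by move=> x; apply: Ccont_minus.
  have d2 : forall x, Rcont (fun th => mode 0 th * Fq (circle 0 (s 0%C) th) - mode 0 th * psum r (circle 0 (s 0%C) th))%C x by move=> x; apply: Ccont_minus.
  rewrite (Csum_ext _ (fun l => a l * residue_kernel 0 p l - a l * residue_kernel 0 0 l)%C); last by move=> l _; ring.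
  rewrite Csum_minus.
  set J1 := CInt _ _ _. set J2 := CInt _ _ _.
  have -> : (J1 - J2 - (Csum (fun l => a l * residue_kernel 0 p l) (L r) - Csum (fun l => a l * residue_kernel 0 0 l) (L r)))%C
     = CInt (fun th => (mode 0 th * Fq (circle p (s p) th) - mode 0 th * psum r (circle p (s p) th)) -
          (mode 0 th * Fq (circle 0 (s 0%C) th) - mode 0 th * psum r (circle 0 (s 0%C) th)))%C 0 (2 * PI).
  { rewrite CInt_minus; [|by move=> x _ | by move=> x _].
    rewrite !CInt_minus; try by move=> x _.
    rewrite I1 I2 -/J1 -/J2. ring. }
  replace (2 * PI * (48 * K * (Cmod p + s p + s 0%C) / r)) with ((2 * PI - 0) * (48 * K * (Cmod p + s p + s 0%C) / r)) by ring.
  apply: CInt_norm_le; first lra.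
  - move=> x _. by apply: Ccont_minus.
  - move=> x _. set z := circle p (s p) x. set w := circle 0 (s 0%C) x.
    replace (mode 0 x * Fq z - mode 0 x * psum r z - (mode 0 x * Fq w - mode 0 x * psum r w))%C with (mode 0 x * ((Fq z - psum r z) - (Fq w - psum r w)))%C by ring.
    rewrite Cmod_mult Cmod_mode Rmult_1_l.
    have Mz := circle_Cmod_le p x. have Mw := circle_Cmod_le 0%C x. rewrite Cmod_0 in Mw.
    apply: Rle_trans (mittag_leffler_error phi rho g delta ga phi_cont rho_pos rho_lip g_entire delta_pos g_sep ga_pos g_lower g_zero L HL f c Mf f_entire f_bound f_val r Hr1 Hr2 z w _ _ _ _) _.
    + exact: (proj1 (small_circle_F p x Hp)).
    + exact: (proj1 (small_circle_F 0%C x g_zero)).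
    + rewrite /z. lra.
    + rewrite /w. lra.
    + rewrite -/K. apply: Rmult_le_compat_r; first by apply: Rlt_le; exact: Rinv_0_lt_compat.
      apply: Rmult_le_compat_l; first lra. have := Cmod_minus_le z w. rewrite /z /w. lra.
Qed.

Lemma small_over_radius (B eps : R) : 0 <= B -> 0 < eps -> exists R0, 0 <= R0 /\ forall r, R0 < r -> B / r < eps.
Proof.
  move=> HB He. exists (B / eps). split; first exact: Rdiv_le_0_compat.
  move=> r Hr. have Hr0 : 0 < r. { have : 0 <= B / eps by apply: Rdiv_le_0_compat. lra. }
  apply/(Rlt_div_l _ _ _ Hr0). move/(Rlt_div_l _ _ _ He): Hr. lra.
Qed.

Lemma enumerates_sub (B : C -> Prop) r :
  enumerates (filter (fun z => decb (B z)) (L r)) (fun z => (zeros g z /\ B z) /\ Cmod z < r).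
Proof. apply: enumerates_iff (enumerates_filter _ _ B (HL r)) => z. tauto. Qed.

(** The error in [high_coef] tends to 0 as [r] grows, so the sums converge to [I / D]. Since
    [|I| <= 2 * PI * K] and [s p] is a fixed multiple of [rho p], multiplying by [rho p ^ k] leaves
    a bound independent of [p]. *)
Theorem high_principal_values k : (0 < k)%nat -> exists M, forall p, zeros g p -> exists v,
  is_pv (fun l => zeros g l /\ l <> p) (fun l => (c l / (C_derive g l * (l - p) ^ (k + 1)))%C) v /\
  Cmod (RtoC (rho p ^ k) * v)%C <= M.
Proof.
  move=> Hk. have P2 := two_PI_pos. have K0 : 0 <= K by exact: (CF_ge0 phi).
  have PIn : (2 * PI)%C <> 0 by apply: Cmult_neq_0 => /RtoC_inj; have := PI_RGT_0; lra.
  exists (K / (delta / 4) ^ k) => p Hp. have Sp := s_pos' p. have Pp := rho_pos p.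
  have Sk : 0 < s p ^ k by exact: pow_lt.
  have Skn : (RtoC (s p) ^ k)%C <> 0 by apply: Cpow_nz => /RtoC_inj; lra.
  set I := CInt (fun th => mode k th * Fq (circle p (s p) th))%C 0 (2 * PI).
  set D := (- (2 * PI) * RtoC (s p) ^ k)%C.
  have Dn : D <> 0.
  { rewrite /D => E. apply: (Cmult_neq_0 _ _ PIn Skn). replace (2 * PI * RtoC (s p) ^ k)%C with (- (- (2 * PI) * RtoC (s p) ^ k))%C by ring. rewrite E. ring. }
  have DM : Cmod D = 2 * PI * s p ^ k.
  { rewrite /D Cmod_mult Cmod_pow Cmod_opp Cmod_RtoC_pos; last lra.
    rewrite -RtoC_mult Cmod_RtoC_pos; lra. }
  exists (I / D)%C. split.
  - apply: (is_pv_intro _ _ _ (fun r => filter (fun z => decb (z <> p)) (L r))); first exact: enumerates_sub.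
    move=> eps He.
    have Hep : 0 < eps * Cmod D by rewrite DM; apply: Rmult_lt_0_compat => //; exact: Rmult_lt_0_compat.
    have [R0 [HR0 HR]] := small_over_radius (2 * PI * (48 * K * (2 * s p))) (eps * Cmod D)
      ltac:(apply: Rmult_le_pos; [lra | apply: Rmult_le_pos; lra]) Hep.
    exists (R0 + s 0%C + 4 * (Cmod p + s p)) => r Hr.
    have S0 := s_pos' 0%C. have Mp := Cmod_ge_0 p.
    have Hok : radius_ok r by split; rewrite -?/(s 0%C); lra.
    have H := high_coef k p r Hk Hp Hok ltac:(lra). rewrite -/I in H.
    have E : Csum (fun l => a l * residue_kernel k p l)%C (L r) =
       (D * Csum (fun l => c l / (C_derive g l * (l - p) ^ (k + 1)))%C (filter (fun z => decb (z <> p)) (L r)))%C.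
    { rewrite -Csum_scal -Csum_filter_if. apply: Csum_ext => l /(proj2 (HL r)) [Hl _].
      rewrite /residue_kernel. case: em => [Hne|_]; last ring.
      rewrite /a /D. field.
      split; first [exact: (g_deriv_neq_0 phi rho g delta ga) | apply: Cpow_nz; exact: Cminus_eq_contra]. }
    rewrite E in H. set S := Csum _ _ in H *.
    have -> : (S - I / D)%C = (- ((I - D * S) / D))%C by field.
    rewrite Cmod_opp Cmod_div //. apply/(Rlt_div_l _ _ _); first by apply/Cmod_gt_0.
    apply: Rle_lt_trans H _. have := HR r ltac:(lra). rewrite /Rdiv. lra.
  - have HI := mode_F_int_bound k p Hp. rewrite -/I in HI.
    rewrite Cmod_mult Cmod_div // DM Cmod_RtoC_pos; last by apply: pow_le; lra.
    have dk : 0 < (delta / 4) ^ k by apply: pow_lt; lra.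
    have rk : 0 < rho p ^ k by exact: pow_lt.
    apply: Rle_trans (_ : rho p ^ k * (2 * PI * K / (2 * PI * s p ^ k)) <= _).
    + apply: Rmult_le_compat_l; first lra. apply: Rmult_le_compat_r => //.
      apply: Rlt_le. apply: Rinv_0_lt_compat. exact: Rmult_lt_0_compat.
    + apply: Req_le. rewrite /s Rpow_mult_distr. field. have := PI_RGT_0. lra.
Qed.

Theorem first_principal_value : exists M, forall p, zeros g p -> p <> 0%C -> exists v,
  is_pv (fun l => zeros g l /\ l <> p /\ l <> 0%C) (fun l => (c l / C_derive g l * (1 / (l - p) - 1 / l))%C) v /\
  Cmod (- (c 0 / (C_derive g 0 * p)) + v)%C <= M.
Proof.
  have P2 := two_PI_pos. have K0 : 0 <= K by exact: (CF_ge0 phi).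
  have PIn : (2 * PI)%C <> 0 by apply: Cmult_neq_0 => /RtoC_inj; have := PI_RGT_0; lra.
  have PIM : Cmod (2 * PI)%C = 2 * PI by rewrite -RtoC_mult Cmod_RtoC_pos; lra.
  have Hc1 : forall l, zeros g l -> Cmod (c l) * exp (- phi l) <= Mf by move=> l Hl; rewrite -f_val.
  have ab := coef_bound phi rho g delta ga phi_cont rho_pos rho_lip g_entire delta_pos g_sep ga_pos g_lower g_zero c Mf Hc1.
  set A := 2 * Mf / ga in ab.
  exists (A / delta + 2 * K) => p Hp Hp0. have Sp := s_pos' p. have S0 := s_pos' 0%C.
  set I1 := CInt (fun th => mode 0 th * Fq (circle p (s p) th))%C 0 (2 * PI).
  set I2 := CInt (fun th => mode 0 th * Fq (circle 0 (s 0%C) th))%C 0 (2 * PI).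
  (* The zeros [p] and 0 contribute [2 * PI * (a p + a 0) / p] to the sum in [zero_coef]. The part
     with [a 0] is cancelled by the isolated term of the condition, and [a p / p] is bounded by
     separation from 0. *)
  exists ((a p + a 0%C) / p - (I1 - I2) / (2 * PI))%C. split.
  - apply: (is_pv_intro _ _ _ (fun r => filter (fun z => decb (z <> p /\ z <> 0%C)) (L r))); first exact: enumerates_sub.
    move=> eps He.
    have Mp := Cmod_ge_0 p.
    have [R0 [HR0 HR]] := small_over_radius (48 * K * (Cmod p + s p + s 0%C)) eps ltac:(apply: Rmult_le_pos; lra) He.
    exists (R0 + 4 * s 0%C + 4 * (Cmod p + s p)) => r Hr.
    have Hok : radius_ok r by split; rewrite -?/(s 0%C); lra.
    have H := zero_coef p r Hp Hok ltac:(lra) ltac:(lra). rewrite -/I1 -/I2 in H.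
    set S := Csum _ _.
    have E : Csum (fun l => a l * (residue_kernel 0 p l - residue_kernel 0 0 l))%C (L r) = (2 * PI * ((a p + a 0%C) / p - S))%C.
    (* [u1] and [u2] collect the two exceptional zeros, each absent from one of the two kernels. *)
    { pose u1 : C -> C := fun l => if em (l <> p) then 0%C else (2 * PI * (a l / p))%C.
      pose u2 : C -> C := fun l => if em (l <> 0%C) then 0%C else (2 * PI * (a l / p))%C.
      pose u3 : C -> C := fun l => if em (l <> p /\ l <> 0%C) then (- (2 * PI) * (a l * (1 / (l - p) - 1 / l)))%C else 0%C.
      have Ein : forall l, zeros g l -> Cmod l < r -> In l (L r) by move=> l A1 A2; apply/(proj2 (HL r)).
      rewrite (Csum_ext _ (fun l => u1 l + u2 l + u3 l)%C).
      - rewrite !Csum_plus (Csum_single u1 _ p).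
        + rewrite (Csum_single u2 _ 0%C).
          * rewrite /u3 (Csum_filter_if (fun l => - (2 * PI) * (a l * (1 / (l - p) - 1 / l)))%C) Csum_scal -/S.
            rewrite /u1 /u2. case: em => // _. case: em => // _. rewrite -/S. field. exact: Hp0.
          * exact: (proj1 (HL r)).
          * apply: Ein => //. rewrite Cmod_0. exact: (proj1 Hok).
          * move=> l _ Hne. rewrite /u2. by case: em.
        + exact: (proj1 (HL r)).
        + apply: Ein => //. lra.
        + move=> l _ Hne. rewrite /u1. by case: em.
      - move=> l _. rewrite /residue_kernel /u1 /u2 /u3 /=.
        case: (em (l <> p)) => [Hlp|Hlp]; case: (em (l <> 0%C)) => [Hl0|Hl0].
        + case: em => [_|H1]; last by exfalso; apply: H1.
          have Dlp : (l - p)%C <> 0 by exact: Cminus_eq_contra.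
          replace (l - 0)%C with l by ring. field. by split.
        + case: em => [[_ H1]|_] //. have -> : l = 0%C by apply: NNPP.
          replace (0 - p)%C with (- p)%C by ring. field. exact: Hp0.
        + case: em => [[H1 _]|_] //. have -> : l = p by apply: NNPP.
          replace (p - 0)%C with p by ring. field. exact: Hp0.
        + exfalso. apply: Hp0. have E1 : l = p by apply: NNPP. have E2 : l = 0%C by apply: NNPP. by rewrite -E1. }
    rewrite E in H.
    have -> : (S - ((a p + a 0%C) / p - (I1 - I2) / (2 * PI)))%C = ((I1 - I2 - 2 * PI * ((a p + a 0%C) / p - S)) / (2 * PI))%C.
    { set Y := ((a p + a 0%C) / p)%C. field. move=> E1. apply: PIn. rewrite E1. ring. }
    rewrite Cmod_div // PIM. apply/(Rlt_div_l _ _ _ P2).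
    apply: Rle_lt_trans H _. rewrite (Rmult_comm eps). apply: Rmult_lt_compat_l => //. apply: HR. lra.
  - have E : (- (c 0 / (C_derive g 0 * p)) + ((a p + a 0%C) / p - (I1 - I2) / (2 * PI)))%C = (a p / p - (I1 - I2) / (2 * PI))%C.
    { have G0 := g_deriv_neq_0 phi rho g delta ga phi_cont rho_pos rho_lip g_entire delta_pos g_sep ga_pos g_lower g_zero 0%C g_zero.
      have -> : (c 0 / (C_derive g 0 * p))%C = (a 0%C / p)%C by rewrite /a; field; split.
      set Y := ((I1 - I2) / (2 * PI))%C. field. exact: Hp0. }
    rewrite E. apply: Rle_trans (Cmod_minus_le _ _) _. apply: Rplus_le_compat.
    + rewrite Cmod_div //. have Pl : 0 < Cmod p by apply/Cmod_gt_0.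
      apply/(Rle_div_l _ _ _ Pl).
      have [Sq _] := rho_le_sep rho delta (zeros g) delta_pos g_sep p 0%C Hp g_zero Hp0.
      replace (p - 0)%C with p in Sq by ring.
      apply: Rle_trans (ab p Hp) _.
      have A0 : 0 <= A. { have := ab p Hp. have := Cmod_ge_0 (c p / C_derive g p). have := rho_pos p. nra. }
      apply: (Rmult_le_reg_l delta) => //. replace (delta * (A / delta * Cmod p)) with (A * Cmod p) by (field; lra). nra.
    + rewrite Cmod_div // PIM. apply/(Rle_div_l _ _ _ P2).
      have B1 := mode_F_int_bound 0 p Hp. have B2 := mode_F_int_bound 0 0%C g_zero.
      have := Cmod_minus_le I1 I2. rewrite -/I1 in B1. rewrite -/I2 in B2. lra.
Qed.

End Coefficients.

(** * The two implications *)

Theorem theorem13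
  (phi rho : C -> R) (t : R) (g : C -> C) (Lambda : C -> Prop) (c : C -> C)
  (phi_smooth : smooth phi)
  (phi_subharmonic : subharmonic phi)
  (phi_nonharmonic : ~ harmonic phi)
  (phi_doubling : doubling phi)
  (rho_radius : is_radius phi rho)
  (t_exponent : growth_exponent rho t)
  (Lambda_critical : critical_lattice phi rho g Lambda)
  (Lambda_0 : Lambda 0%C) :
  (exists f : C -> C,
     Fock_infty phi f /\ forall l : C, Lambda l -> f l = c l)
  <->
  ((exists M : R, forall l : C, Lambda l -> Cmod (c l) * exp (- phi l) <= M)
   /\
   (exists M : R, forall l' : C, Lambda l' -> l' <> 0%C ->
      exists s : C,
        is_pv (fun l => Lambda l /\ l <> l' /\ l <> 0%C)
              (fun l => (c l / C_derive g l * (1 / (l - l') - 1 / l))%C) s /\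
        Cmod (- (c 0 / (C_derive g 0 * l')) + s)%C <= M)
   /\
   (exists N : nat, 1 / t < INR N /\
      forall n : nat, (2 <= n <= N)%nat ->
        exists M : R, forall l' : C, Lambda l' ->
          exists s : C,
            is_pv (fun l => Lambda l /\ l <> l')
                  (fun l => (c l / (C_derive g l * (l - l') ^ n))%C) s /\
            Cmod (RtoC (rho l' ^ (n - 1)) * s)%C <= M)).
Proof.
  have [[g_entire [[delta [Hd g_sep]] [[dmax d_max] [ga [gb [Hga [Hgb g_bounds]]]]]]] Lz] := Lambda_critical.
  have E : Lambda = zeros g.
  { apply: functional_extensionality => z. apply: propositional_extensionality. exact: Lz. }
  rewrite E in Lambda_0 *. clear E Lz Lambda_critical Lambda.
  have phi_cont : forall z, continuous (T := C_UniformSpace) phi z by move=> z; exact: (proj1 (phi_smooth 0%nat) z).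
  have rho_pos : forall z, 0 < rho z by move=> z; exact: (proj1 (rho_radius z)).
  have rho_lip := rho_lipschitz phi rho phi_smooth phi_doubling rho_radius.
  have g_lower := fun z => proj1 (g_bounds z). have g_upper := fun z => proj2 (g_bounds z).
  have [[Ht0 Ht1] _] := t_exponent.
  have enum := lattice_enumerates rho t delta (zeros g) rho_pos rho_lip t_exponent Hd g_sep Lambda_0.
  (* One enumeration is fixed for each radius and shared by all partial sums. *)
  pose L := fun r => epsilon (inhabits nil) (fun l => enumerates l (fun z => zeros g z /\ Cmod z < r)).
  have HL : forall r, enumerates (L r) (fun z => zeros g z /\ Cmod z < r).
  { move=> r. exact: (epsilon_spec (inhabits nil) _ (enum r)). }
  split.
  - move=> [f [[f_entire [Mf f_bound]] f_val]].
    split; first by exists Mf => l Hl; rewrite -f_val.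
    split; first exact: (first_principal_value phi rho g delta ga phi_cont rho_pos rho_lip g_entire Hd g_sep Hga g_lower Lambda_0 L HL f c Mf).
    (* Any integer above [1/t] will do, since the bounds hold for every exponent. *)
    have [N HN] := INR_unbounded (1 / t). exists N. split; first lra.
    move=> n [Hn2 HnN].
    have [M HM] := high_principal_values phi rho g delta ga phi_cont rho_pos rho_lip g_entire Hd g_sep Hga g_lower Lambda_0 L HL f c Mf f_entire f_bound f_val (n - 1)%nat ltac:(lia).
    exists M. by replace (n - 1 + 1)%nat with n in HM by lia.
  - move=> [[Mc Hc1] [Hc2 [N [HN Hc3]]]].
    (* [t < 1] gives [N > 1], so [N] has the form [S m], with [m] the order of the expansion. *)
    have N1 : 1 < INR N.
    { apply: Rlt_trans HN. apply/(Rlt_div_r _ _ _ Ht0). lra. }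
    case: N HN Hc3 N1 => [|m] HN Hc3 N1; first by move: N1 => /=; lra.
    apply: (interpolation_exists phi rho g t delta dmax ga gb phi_cont rho_pos rho_lip t_exponent g_entire Hd g_sep d_max Hga Hgb g_lower g_upper Lambda_0 L HL c Mc Hc1 m HN) => //.
    move=> k Hk. have := Hc3 (k + 2)%nat ltac:(lia).
    by replace (k + 2 - 1)%nat with (k + 1)%nat by lia.
Qed.
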